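(* For every positive integer $n$, \[ \sum_{w\in\mathrm{FC}(B_n)}\mathbf{x}^{\mathrm{Des}_B(w)}q^{\mathrm{bl}(w^{-1})} =\sum_{k=0}^{n}\sum_{(\mathsf P,\mathsf Q)\in\mathrm{SDT}(2n-k,k)^2}\mathbf{x}^{\mathrm{Des}_B(\mathsf Q)}q^{\,n-\mathrm{ldes}(\mathsf P)} +\sum_{k=1}^{\lfloor n/2\rfloor}\sum_{(\mathsf P,\mathsf Q)\in\mathrm{SDT}(2n-2k,2k-1,1)^2}\mathbf{x}^{\mathrm{Des}_B(\mathsf Q)}q^{\,n-\mathrm{ldes}(\mathsf P)}. \]
   Context: $B_n$: signed permutations $w=[w_1,\ldots,w_n]$ of $\{\pm1,\ldots,\pm n\}$, Coxeter generators $s_0=[-1,2,\ldots,n]$, $s_i=[1,\ldots,i+1,i,\ldots,n]$; $\mathrm{FC}(B_n)$ = fully commutative elements (any two reduced expressions related by commutations only). With $w_0=0$: $\mathrm{Des}_B(w)=\{0\le i\le n-1\mid w_i>w_{i+1}\}$; $\mathrm{bl}(w)=1+\#\{1\le i\le n-1\mid\max(w_1..w_i)<\min(w_{i+1}..w_n)\}$; $\mathbf{x}^J=\prod_{i\in J}x_i$. For $\lambda\vdash 2n$, $\mathrm{SDT}(\lambda)$ is the set of standard domino tableaux of shape $\lambda$: tilings of the Young diagram of $\lambda$ by $n$ dominoes labelled bijectively by $1,\ldots,n$, strictly increasing along rows (left to right) and columns (top to bottom). For $\mathsf T\in\mathrm{SDT}(\lambda)$, $\mathrm{Des}(\mathsf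 T)$ is the set of $1\le i<n$ such that the north-east cell of the domino labelled $i+1$ lies in a lower row than the north-east cell of the domino labelled $i$; $\mathrm{Des}_B(\mathsf T)=\mathrm{Des}(\mathsf T)\cup\{0\}$ if the domino labelled $1$ is vertical (occupies cells $(1,1),(2,1)$) and $\mathrm{Des}_B(\mathsf T)=\mathrm{Des}(\mathsf T)$ otherwise; $\mathrm{ldes}(\mathsf T)=\max\mathrm{Des}_B(\mathsf T)$, or $0$ if empty. *)

(* Defs.v *)
From HB Require Import structures.
From mathcomp Require Import all_boot all_order fingroup perm all_algebra.
From mathcomp Require Import boolp.
Set Implicit Arguments. Unset Strict Implicit. Unset Printing Implicit Defensive.
Import Order.TTheory GRing.Theory Num.Theory.

(* w = (p, e) represents the signed permutation with window            *)
(*   w_{i+1} = (if e i then -1 else 1) * (p i + 1)   (i : 'I_n).       *)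
Definition SP (n : nat) := ({perm 'I_n} * {ffun 'I_n -> bool})%type.

(* w_{i+1} for 0-based position i *)
Definition wval n (w : SP n) (i : 'I_n) : int :=
  if w.2 i then (- (Posz (w.1 i).+1))%R else Posz (w.1 i).+1.

(* composition u o v of signed permutations: (u o v)(a) = u(v(a)) *)
Definition mulSP n (u v : SP n) : SP n :=
  ((v.1 * u.1)%g, [ffun i => v.2 i (+) u.2 (v.1 i)]).

Definition idSP n : SP n := (1%g, [ffun=> false]).

Definition invSP n (w : SP n) : SP n :=
  ((w.1^-1)%g, [ffun j => w.2 ((w.1^-1)%g j)]).

Definition prevI n (i : 'I_n) : 'I_n :=
  Ordinal (leq_ltn_trans (leq_pred i) (ltn_ord i)).

(* Coxeter generators: s_0 = [-1,2,...,n], s_i = [1,..,i+1,i,..,n] (i >= 1) *)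
Definition gen n (i : 'I_n) : SP n :=
  if val i == 0 then (1%g, [ffun j : 'I_n => val j == 0])
  else (tperm (prevI i) i, [ffun=> false]).

Definition wordProd n (s : seq 'I_n) : SP n :=
  foldr (fun i acc => mulSP (gen i) acc) (idSP n) s.

Definition reducedWord n (s : seq 'I_n) (w : SP n) : Prop :=
  wordProd s = w /\ forall t : seq 'I_n, wordProd t = w -> size s <= size t.

Definition commStep n (s t : seq 'I_n) : Prop :=
  exists (a b : seq 'I_n) (i j : 'I_n),
    mulSP (gen i) (gen j) = mulSP (gen j) (gen i) /\
    s = a ++ i :: j :: b /\ t = a ++ j :: i :: b.

Inductive commEquiv n : seq 'I_n -> seq 'I_n -> Prop :=
  | commEquiv_refl s : commEquiv s s
  | commEquiv_step s t u : commStep s t -> commEquiv t u -> commEquiv s u.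

Definition fullyCommutative n (w : SP n) : Prop :=
  forall s t : seq 'I_n, reducedWord s w -> reducedWord t w -> commEquiv s t.

(* window with w_0 = 0 : wn w j = w_j for 0 <= j <= n *)
Definition wseq n (w : SP n) : seq int := (0%R : int) :: [seq wval w j | j <- enum 'I_n].
Definition wn n (w : SP n) (j : nat) : int := nth (0%R : int) (wseq w) j.

Definition DesBw n (w : SP n) (i : nat) : bool := (wn w i.+1 < wn w i)%R.

(* bl(w) = 1 + #{1 <= i <= n-1 | max(w_1..w_i) < min(w_{i+1}..w_n)} *)
Definition bl n (w : SP n) : nat :=
  1 + \sum_(1 <= i < n)
        nat_of_bool [forall j : 'I_n, forall k : 'I_n,
                       ((j < i)%N && (i <= k)%N) ==> (wval w j < wval w k)%R].

(* Standard domino tableaux.  A filling of the cells (r, c) (0-based,  *)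
(* row r from top, column c from left) of a 2n x 2n box by labels in   *)
(* {0,...,n}; 0 means "not a cell of the diagram".                     *)
Definition cell n := ('I_(2 * n) * 'I_(2 * n))%type.
Definition Tab n := {ffun cell n -> 'I_n.+1}.

Definition inShape n (la : seq nat) (c : cell n) : bool :=
  (c.1 < size la) && (c.2 < nth 0 la c.1).

Definition adjacent n (c d : cell n) : bool :=
  ((val c.1 == val d.1) && ((c.2.+1 == d.2 :> nat) || (d.2.+1 == c.2 :> nat)))
  || ((val c.2 == val d.2) && ((c.1.+1 == d.1 :> nat) || (d.1.+1 == c.1 :> nat))).

Definition isSDT n (la : seq nat) (T : Tab n) : bool :=
  [&&
      [forall c : cell n, inShape la c == (val (T c) != 0)],
      [forall l : 'I_n.+1, (val l != 0) ==> (#|[set c | T c == l]| == 2)],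
      [forall c : cell n, forall d : cell n,
          [&& T c == T d, val (T c) != 0 & c != d] ==> adjacent c d],
      [forall c : cell n, forall d : cell n,
          [&& inShape la c, inShape la d, val c.1 == val d.1 & (c.2 <= d.2)%N]
            ==> (T c <= T d)%N] &
      [forall c : cell n, forall d : cell n,
          [&& inShape la c, inShape la d, val c.2 == val d.2 & (c.1 <= d.1)%N]
            ==> (T c <= T d)%N]].

(* row of the north-east cell of the domino labelled l (= its top row) *)
Definition neRow n (T : Tab n) (l : nat) : nat :=
  \big[minn/(2 * n)]_(c : cell n | val (T c) == l) val c.1.

Definition DesT n (T : Tab n) (i : nat) : bool :=
  [&& 1 <= i, i < n & neRow T i < neRow T i.+1].

Definition firstVertical n (T : Tab n) : bool :=
  [exists c : cell n, exists d : cell n,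
     [&& val c.1 == 0, val c.2 == 0, val d.1 == 1, val d.2 == 0,
         val (T c) == 1 & val (T d) == 1]].

Definition DesBT n (T : Tab n) (i : nat) : bool :=
  DesT T i || ((i == 0) && firstVertical T).

Definition ldes n (T : Tab n) : nat := \max_(i < n | DesBT T i) i.

(* Main.v *)
(** Writing each descent weight as x_i = 1 + (x_i - 1) expands both sides over the tilings of n cells
    by r squares and t dominoes, a domino on the cells i, i+1 carrying x_i - 1; the two sides are then
    compared tiling by tiling, through polynomials in q that depend only on r and t.

    A domino tableau is read off label by label as a walk on the nonnegative integers: a horizontal
    domino in the first row is an up step, one in the second row a down step, and a vertical one in
    the first two rows is a loop at height 0.  For the three-row shapes loops do not occur, and the
    first down step stands for the vertical domino in rows two and three.  An up step followed by a
    down step acts as the identity, so the sum over Q is the tiling sum of the powers of a single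
    operator T.  The statistic n - ldes(P) is the length of the longest descent-free suffix of the
    walk; its generating function commutes with T, and since T is symmetric the sum over all end
    heights collapses to one value R(n, r).

    On the other side, w is fully commutative if and only if its window avoids Stembridge's patterns.
    Such a window either has increasing exceedances and increasing non-exceedances, and is then encoded
    by two subsets of {1..n} (the positions of the exceedances; the absolute values of the exceedances
    and of the negative entries), or it is a nonempty identity prefix followed by a shifted window of
    the first kind with exactly one negative entry.  Reading the two subsets simultaneously gives
    another transfer system in which a descent factors through the same tiling expansion.  The first
    kind matches the two-row shapes, the second the three-row shapes. *)

Require Import Defs.
From HB Require Import structures.
From mathcomp Require Import all_boot all_order fingroup perm all_algebra.
From mathcomp Require Import boolp.
From mathcomp Require Import ring zify.
Set Implicit Arguments. Unset Strict Implicit. Unset Printing Implicit Defensive.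
Import Order.TTheory GRing.Theory Num.Theory.
Local Open Scope ring_scope.

(** * Words, tilings and transfer operators *)

(** No bijection between windows and pairs of tableaux is set up; the two sides agree because their
    tiling coefficients obey the same recurrences in r and t. On the walk side a tiling is felt
    through its r squares and through n = r + 2t. On the subset side, once the flag is down, a plus
    followed by a minus acts like one single letter, so the coefficients depend on r + t alone. The
    two are reconciled by [zeta]: without loops, R(r + 2t, r) involves walks of total length 2(r +
    t), which can be taken two steps at a time.

    The obstacle is the flag. The inverse has a block boundary either when the state returns to 0 or
    when all values so far lie in the second subset, and only the flag sees the latter. Closed forms
    for flagged states are proved for difference 1 and for the sum over all starting differences.
    The first serves the shifted windows, where the sum over prefix lengths telescopes; the second
    serves the first kind, where the number of negative entries is summed out. On the tableau side
    the matching tool is that, with the loop, every height has exactly two exits, which produces the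
    factors 2 and the powers of 2. *)

Fixpoint words (L : Type) (al : seq L) (n : nat) : seq (seq L) :=
  if n is n'.+1 then [seq a :: s | a <- al, s <- words al n'] else [:: [::]].

Lemma big_words0 (R : nmodType) (L : Type) (al : seq L) (F : seq L -> R) :
  \sum_(s <- words al 0) F s = F [::].
Proof. by rewrite big_seq1. Qed.

Lemma big_wordsS (R : nmodType) (L : Type) (al : seq L) n (F : seq L -> R) :
  \sum_(s <- words al n.+1) F s = \sum_(a <- al) \sum_(s <- words al n) F (a :: s).
Proof.
by rewrite /= big_allpairs_dep.
Qed.

Lemma mem_words (L : eqType) (al : seq L) n s :
  (s \in words al n) = (size s == n) && all (mem al) s.
Proof.
elim: n s => [|n IH] s.
  by case: s => [|a s] //=; rewrite inE.
case: s => [|a s].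
  by apply/allpairsP => -[[b t]] [].
rewrite [words _ _]/= [size _]/= eqSS [all _ _]/=.
apply/allpairsP/idP => [[[b t] /= [hb ht [-> ->]]]|].
  by move: ht; rewrite IH hb.
move=> /and3P[hs ha hall]; exists (a, s) => /=.
by rewrite IH hs hall.
Qed.

Lemma words_uniq (L : eqType) (al : seq L) n : uniq al -> uniq (words al n).
Proof.
move=> u; elim: n => [|n IH] //=.
by apply: allpairs_uniq => // -[a s] [b t] _ _ /= [-> ->].
Qed.

Section Tile.
Variables (R : comNzRingType) (y : nat -> R).

(* Tilings of [n] cells after an offset [o]: a domino on the cells [o], [o+1] (counted from 0) weighs
   [y o.+1], and a tiling by [r] squares and [t] dominoes contributes [S r t]. *)
Fixpoint tile (n o : nat) (S : nat -> nat -> R) : R :=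
  match n with
  | 0 => S 0 0
  | n1.+1 => tile n1 o.+1 (fun r t => S r.+1 t) +
      match n1 with
      | 0 => 0
      | n2.+1 => y o.+1 * tile n2 o.+2 (fun r t => S r t.+1)
      end
  end.

Lemma tile0 o S : tile 0 o S = S 0 0. Proof. by []. Qed.
Lemma tile1 o S : tile 1 o S = S 1 0. Proof. by rewrite /= addr0. Qed.
Lemma tileSS n o S : tile n.+2 o S =
  tile n.+1 o.+1 (fun r t => S r.+1 t) + y o.+1 * tile n o.+2 (fun r t => S r t.+1).
Proof. by []. Qed.

Lemma nat_ind2 (P : nat -> Prop) :
  P 0 -> P 1 -> (forall n, P n -> P n.+1 -> P n.+2) -> forall n, P n.
Proof.
move=> h0 h1 hs n; suff [] : P n /\ P n.+1 by [].
by elim: n => [|n [IH1 IH2]]; split => //; apply: hs.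
Qed.

Lemma eq_tile n o S S' :
  (forall r t, (r + t.*2)%N = n -> S r t = S' r t) -> tile n o S = tile n o S'.
Proof.
elim/nat_ind2: n o S S' => [|| n IH0 IH1] o S S' h.
- exact: h.
- by rewrite !tile1 h.
rewrite !tileSS; congr (_ + _ * _).
  by apply: IH1 => r t e; apply: h; lia.
by apply: IH0 => r t e; apply: h; lia.
Qed.

Lemma tileD n o S S' :
  tile n o (fun r t => S r t + S' r t) = tile n o S + tile n o S'.
Proof.
elim/nat_ind2: n o S S' => [|| n IH0 IH1] o S S'.
- by [].
- by rewrite !tile1.
by rewrite !tileSS IH0 IH1; ring.
Qed.

Lemma tileZ n o a S : tile n o (fun r t => a * S r t) = a * tile n o S.
Proof.
elim/nat_ind2: n o S => [|| n IH0 IH1] o S.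
- by [].
- by rewrite !tile1.
by rewrite !tileSS IH0 IH1; ring.
Qed.

Lemma tile_zero n o : tile n o (fun _ _ => 0) = 0.
Proof.
rewrite -[RHS](mul0r (tile n o (fun _ _ => 0))) -tileZ.
by apply: eq_tile => r t _; rewrite mul0r.
Qed.

Lemma tile_sum n o I (r : seq I) (S : I -> nat -> nat -> R) :
  tile n o (fun a b => \sum_(i <- r) S i a b) = \sum_(i <- r) tile n o (S i).
Proof.
elim: r => [|i r IH].
  rewrite big_nil -[RHS](tile_zero n o).
  by apply: eq_tile => a b _; rewrite big_nil.
rewrite big_cons -IH -tileD; apply: eq_tile => a b _; by rewrite big_cons.
Qed.

Lemma tile_mono n o c : tile n o (fun r t => c r *+ (t == 0%N)) = c n.
Proof.
elim/nat_ind2: n o c => [|| n IH0 IH1] o c.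
- by [].
- by rewrite tile1.
rewrite tileSS (IH1 _ (fun r => c r.+1)).
rewrite (@eq_tile n _ _ (fun _ _ => 0)) ?tile_zero ?mulr0 ?addr0 //.
Qed.

End Tile.
Arguments tile : simpl never.

Section Transfer.
Variables (R : comNzRingType) (St L : Type) (al : seq L) (plus : L -> bool).
Variables (wt : St -> L -> R) (nx : St -> L -> St) (x : nat -> R).

Fixpoint run (F : St -> R) (st : St) (s : seq L) : R :=
  if s is a :: s' then wt st a * run F (nx st a) s' else F st.

(* [o] letters precede [s]; [prev] tells whether the last of them is a plus. *)
Fixpoint xw (o : nat) (prev : bool) (s : seq L) : R :=
  if s is a :: s' then
    (if prev && ~~ plus a then x o else 1) * xw o.+1 (plus a) s'
  else 1.

Definition Z (F : St -> R) (o n : nat) (prev : bool) (st : St) : R :=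
  \sum_(s <- words al n) xw o prev s * run F st s.

Definition Mp (g : St -> R) (st : St) : R :=
  \sum_(a <- al | plus a) wt st a * g (nx st a).
Definition Mm (g : St -> R) (st : St) : R :=
  \sum_(a <- al | ~~ plus a) wt st a * g (nx st a).

Lemma Z0 F o prev st : Z F o 0 prev st = F st.
Proof. by rewrite /Z big_words0 /= mul1r. Qed.

Lemma ZS F o n prev st : Z F o n.+1 prev st =
  Mp (Z F o.+1 n true) st + (if prev then x o else 1) * Mm (Z F o.+1 n false) st.
Proof.
rewrite /Z big_wordsS (bigID plus) /= /Mp /Mm; congr (_ + _).
  apply: eq_bigr => a pa; rewrite mulr_sumr; apply: eq_bigr => s _.
  by rewrite pa andbF /=; ring.
rewrite mulr_sumr; apply: eq_bigr => a pa.
rewrite !mulr_sumr; apply: eq_bigr => s _.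
by rewrite (negbTE pa) /= andbT; ring.
Qed.

Lemma eq_Mp g g' st : g =1 g' -> Mp g st = Mp g' st.
Proof. by move=> e; apply: eq_bigr => a _; rewrite e. Qed.
Lemma eq_Mm g g' st : g =1 g' -> Mm g st = Mm g' st.
Proof. by move=> e; apply: eq_bigr => a _; rewrite e. Qed.

Lemma MpD g g' a st : Mp (fun u => g u + a * g' u) st = Mp g st + a * Mp g' st.
Proof.
by rewrite /Mp mulr_sumr -big_split; apply: eq_bigr => b _ /=; ring.
Qed.

(** The summand 1 of [x o] forgets the previous letter; the summand [x o - 1] forces the next letter
    to be a minus. *)
Lemma Z_true F o n st : Z F o n.+1 true st =
  Z F o n.+1 false st + (x o - 1) * Mm (Z F o.+1 n false) st.
Proof. by rewrite !ZS; ring. Qed.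

Lemma Z1 F o st : Z F o 1 false st = Mp F st + Mm F st.
Proof.
rewrite ZS mul1r; congr (_ + _).
  by apply: eq_Mp => u; rewrite Z0.
by apply: eq_Mm => u; rewrite Z0.
Qed.

(** The tiling recursion: a square is one free letter, a domino is a plus followed by a minus, and
    the letters after a domino are free again. *)
Lemma ZSS F o n st : Z F o n.+2 false st =
  Mp (Z F o.+1 n.+1 false) st + Mm (Z F o.+1 n.+1 false) st
  + (x o.+1 - 1) * Mp (Mm (Z F o.+2 n false)) st.
Proof.
rewrite [LHS]ZS mul1r addrAC; congr (_ + _).
rewrite -MpD; apply: eq_Mp => u; exact: Z_true.
Qed.

End Transfer.

(** * Walks on the half-line *)

Definition steps := [:: Some true; Some false; None : option bool].
Definition nonD (a : option bool) := if a is Some false then false else true.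

Section Walks.
Variables (R : comNzRingType) (q : R).

(* [Some true] goes up, [Some false] down, [None] is the loop at height 0, allowed when [b]. *)
Definition wtW (b : bool) (h : nat) (a : option bool) : R :=
  match a with Some true => 1 | Some false => (0 < h)%N%:R | None => (b && (h == 0%N))%:R end.
Definition nxW (h : nat) (a : option bool) : nat :=
  match a with Some true => h.+1 | Some false => h.-1 | None => h end.

(** The adjacency operator of the half-line, with a loop at 0 when [b] holds. *)
Definition Top (b : bool) (p : nat -> R) (h : nat) : R :=
  if h is h'.+1 then p h.+1 + p h' else p 1 + b%:R * p 0.

Definition MpW b := Mp steps nonD (wtW b) nxW.
Definition MmW b := Mm steps nonD (wtW b) nxW.

Lemma MpWE b g h : MpW b g h = g h.+1 + (b && (h == 0%N))%:R * g h.
Proof. by rewrite /MpW /Mp /steps !big_cons big_nil /= mul1r addr0. Qed.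
Lemma MmWE b g h : MmW b g h = (0 < h)%N%:R * g h.-1.
Proof. by rewrite /MmW /Mm /steps !big_cons big_nil /= addr0. Qed.

Lemma MpMmW b g h : MpW b g h + MmW b g h = Top b g h.
Proof.
rewrite MpWE MmWE; case: h => [|h]; rewrite /Top /= ?andbT ?andbF.
  by rewrite mul0r addr0.
by rewrite mul0r mul1r addr0.
Qed.

(* An up step followed by a down step acts as the identity. *)
Lemma peakW b g h : MpW b (MmW b g) h = g h.
Proof.
rewrite MpWE !MmWE /=; case: h => [|h] /=; rewrite ?andbF ?mul1r ?mul0r ?mulr0 addr0 //.
Qed.

Lemma eq_Top b p p' : p =1 p' -> Top b p =1 Top b p'.
Proof. by move=> e [|h] /=; rewrite !e. Qed.

Lemma eq_iter_Top b p p' r : p =1 p' -> iter r (Top b) p =1 iter r (Top b) p'.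
Proof. by move=> e; elim: r => [|r IH] //= h; apply: eq_Top. Qed.

Lemma iter_TopD b p p' c r h :
  iter r (Top b) (fun u => p u + c * p' u) h =
  iter r (Top b) p h + c * iter r (Top b) p' h.
Proof.
elim: r h => [|r IH] h //=.
by case: h => [|h] /=; rewrite !IH; ring.
Qed.

Lemma TopD b p p' c h :
  Top b (fun u => p u + c * p' u) h = Top b p h + c * Top b p' h.
Proof. exact: (iter_TopD b p p' c 1). Qed.

Definition ZW (x : nat -> R) b F o n prev h :=
  Z steps nonD (wtW b) nxW x F o n prev h.

Lemma ZW1 x b F o h : ZW x b F o 1 false h = Top b F h.
Proof. by rewrite /ZW Z1 -MpMmW. Qed.

Lemma ZWSS x b F o n h : ZW x b F o n.+2 false h =
  Top b (ZW x b F o.+1 n.+1 false) h + (x o.+1 - 1) * ZW x b F o.+2 n false h.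
Proof. by rewrite /ZW ZSS -MpMmW -[Mp _ _ _ _ (Mm _ _ _ _ _) _]/(MpW b (MmW b _) h) peakW. Qed.

(** By [peakW] a domino leaves nothing but its weight, so only the number of squares survives, as an
    exponent of [Top b]. *)
Lemma ZW_tile x b F o n h : ZW x b F o n false h =
  tile (fun i => x i - 1) n o (fun r _ => iter r (Top b) F h).
Proof.
elim/nat_ind2: n o h => [|| n IH0 IH1] o h.
- by rewrite /ZW Z0.
- by rewrite ZW1 tile1.
rewrite ZWSS tileSS IH0; congr (_ + _).
rewrite (eq_Top b (IH1 o.+1)).
set y := fun i => x i - 1.
case: h => [|h] /=.
  by rewrite -tileZ -tileD.
by rewrite -tileD.
Qed.

(** * The longest descent-free suffix of a walk *)

Definition noDes : rel (option bool) := fun a c => ~~ (nonD a && ~~ nonD c).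

(* On the word of a tableau [P] this is [n - ldes P]. *)
Fixpoint tlen (s : seq (option bool)) : nat :=
  if s is a :: s' then if sorted noDes s then size s else tlen s' else 0.

Lemma tlen_sorted s : sorted noDes s -> tlen s = size s.
Proof. by case: s => [|a s] //= ->. Qed.

(** Putting every [x] to 0 kills exactly the words with a descent. [None] and [Some false] are
    representatives of a previous plus and a previous minus. *)
Lemma xw0_sorted o prev s : xw nonD (fun _ => 0 : R) o prev s =
  (path noDes (if prev then None else Some false) s)%:R.
Proof.
elim: s o prev => [|a s IH] o prev //=.
rewrite IH; have -> : path noDes (if nonD a then None else Some false) s = path noDes a s.
  by case: s {IH} => [|c s]; case: a => [[]|].
by case: prev; case: a => [[]|] /=; rewrite ?mul1r ?mul0r.
Qed.

Definition XW b n p h :=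
  \sum_(s <- words steps n) q ^+ tlen s * run (wtW b) nxW p h s.

Definition HW b n p h := ZW (fun _ => 0) b p 0 n false h.

Lemma XW0 b p h : XW b 0 p h = p h.
Proof. by rewrite /XW big_words0 /= mul1r. Qed.

(** Prepending a letter does not change [tlen] unless the whole new word is descent-free, in which
    case it grows from [n] to [n.+1]. *)
Lemma XWS b n p h : XW b n.+1 p h =
  Top b (XW b n p) h + (q ^+ n.+1 - q ^+ n) * HW b n.+1 p h.
Proof.
rewrite -MpMmW /MpW /MmW /Mp /Mm.
rewrite -(bigID nonD (fun _ => true) (fun a => wtW b h a * XW b n p (nxW h a))) /=.
rewrite /HW /ZW /Z /XW !big_wordsS mulr_sumr -big_split /=.
apply: eq_bigr => a _; rewrite !mulr_sumr -big_split /=.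
apply: eq_big_seq => s; rewrite mem_words => /andP[/eqP hs _].
have -> : xw nonD (fun _ : nat => 0 : R) 1 (nonD a) s = (path noDes a s)%:R.
  by rewrite xw0_sorted; case: s {hs} => [|c s]; case: a => [[]|].
rewrite /=; case: ifP => hp; last by rewrite /=; ring.
rewrite tlen_sorted ?(path_sorted hp) // hs -[true%:R]/(1 : R); ring.
Qed.

(** By [ZWSS] with all [x] equal to 0, [HW] is a polynomial in [Top b] (each domino weighs -1),
    hence commutes with it. *)
Lemma HW_Top b n p h : HW b n (Top b p) h = Top b (HW b n p) h.
Proof.
rewrite /HW; move: 0%N => o; elim/nat_ind2: n o h => [|| n IH0 IH1] o h.
- rewrite /ZW Z0; apply: eq_Top => u; by rewrite Z0.
- by rewrite ZW1; apply: eq_Top => u; rewrite ZW1.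
rewrite ZWSS IH0 (eq_Top b (IH1 o.+1)) -TopD.
by apply: eq_Top => u; rewrite ZWSS.
Qed.

Lemma XW_Top b n p h : XW b n (Top b p) h = Top b (XW b n p) h.
Proof.
elim: n h => [|n IH] h.
  by rewrite XW0; apply: eq_Top => u; rewrite XW0.
rewrite XWS (eq_Top b IH) HW_Top -TopD.
by apply: eq_Top => u; rewrite XWS.
Qed.

(** After a plus no down step is allowed any more: from 0 the walk loops for a while and then only
    climbs, so it can end at every height up to [n]. *)
Lemma ZW_plus b p n o h :
  ZW (fun _ => 0) b p o n true h =
  if h is 0 then p n + b%:R * \sum_(i < n) p i else p (h + n)%N.
Proof.
elim: n o h => [|n IH] o h.
  by rewrite /ZW Z0; case: h => [|h]; rewrite ?addn0 // big_ord0 mulr0 addr0.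
rewrite /ZW ZS mul0r addr0 -[Mp _ _ _ _ _ _]/(MpW b _ _) MpWE -!/(ZW _ b _ _ _ _ _) !IH.
case: h => [|h]; last by rewrite andbF mul0r addr0 addnS addSn.
rewrite andbT add1n big_ord_recr /=; case: b {IH} => /=; ring.
Qed.

Lemma HW_at0 b n p :
  HW b n.+1 p 0 = p n.+1 + b%:R * \sum_(i < n.+1) p i.
Proof.
rewrite /HW /ZW ZS mul1r -[Mp _ _ _ _ _ _]/(MpW b _ _) -[Mm _ _ _ _ _ _]/(MmW b _ _).
rewrite MpWE MmWE -!/(ZW _ b _ _ _ _ _) !ZW_plus /= andbT mul0r addr0.
rewrite big_ord_recr add1n; case: b => /=; ring.
Qed.

(** * Walk counts and the value R(n, r) *)

Definition delta (e h : nat) : R := (h == e)%:R.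
Definition NW b r h := iter r (Top b) (delta 0) h.
Arguments NW : simpl never.
Definition RW b n r := XW b n (NW b r) 0.

Lemma NWS b r h : NW b r.+1 h = Top b (NW b r) h. Proof. by []. Qed.

Lemma NW0S b h : NW b 0 h.+1 = 0. Proof. by []. Qed.

Lemma NW_gt b r h : (r < h)%N -> NW b r h = 0.
Proof.
elim: r h => [|r IH] [|h] // hr.
by rewrite NWS /= !IH ?addr0 //; lia.
Qed.

Lemma Top_delta b e u : Top b (delta e) u =
  if e is e'.+1 then delta e.+1 u + 1 * delta e' u else delta 1 u + b%:R * delta 0 u.
Proof.
rewrite /delta; case: e u => [|e] [|u] //; rewrite [LHS]/= ?eqSS.
- by rewrite [(_ == _)%:R in RHS]/= ?mulr0 addr0 add0r.
- by rewrite mulr0 addr0 add0r mul1r.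
- by rewrite mul1r addrC.
Qed.

(** [Top b] is a symmetric matrix: neighbourhood is mutual and the loop is diagonal. *)
Lemma iter_delta_sym b r e h : iter r (Top b) (delta e) h = iter r (Top b) (delta h) e.
Proof.
elim: r e h => [|r IH] e h; first by rewrite /= /delta eq_sym.
rewrite iterSr (eq_iter_Top _ _ (Top_delta b e)).
case: e => [|e]; rewrite iter_TopD /= !(IH _ h) //.
by rewrite mul1r.
Qed.

Lemma RW0 b r : RW b 0 r = NW b r 0. Proof. by rewrite /RW XW0. Qed.

(** Commuting [Top b] past [XW] moves one step from the part of the walk weighted by [q] to the
    unweighted part. *)
Lemma RWS b n r : RW b n.+1 r = RW b n r.+1 +
  (q ^+ n.+1 - q ^+ n) * (NW b r n.+1 + b%:R * \sum_(i < n.+1) NW b r i).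
Proof. by rewrite /RW XWS HW_at0 -XW_Top. Qed.

Lemma RW_falseS n r : RW false n.+1 r = RW false n r.+1 +
  (q ^+ n.+1 - q ^+ n) * NW false r n.+1.
Proof. by rewrite RWS mul0r addr0. Qed.

Definition OW r h := \sum_(i < h.+1) NW true r i.

Lemma OW0 h : OW 0 h = 1.
Proof.
rewrite /OW big_ord_recl big1 ?addr0 // => i _.
Qed.
Lemma OWS0 r : OW r.+1 0 = OW r 1.
Proof. by rewrite /OW !big_ord_recr !big_ord0 /= NWS /=; ring. Qed.
Lemma OWSS r h : OW r.+1 h.+1 = OW r h + OW r h.+2.
Proof.
elim: h => [|h IH].
  by rewrite /OW !big_ord_recr !big_ord0 /= !NWS /=; ring.
rewrite [LHS]/OW big_ord_recr /= -/(OW r.+1 h.+1) IH NWS /=.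
rewrite {2}/OW [in RHS]/OW !big_ord_recr /= -/(OW r h) /OW !big_ord_recr /=; ring.
Qed.

(** With the loop, every height has two exits, whence the factor 2; the error from walks crossing
    between [h] and [h.+1] is [NW true r h - NW true r h.+1], which is the number of loopless
    walks. *)
Lemma OW_double r h : OW r.+1 h = 2%:R * OW r h - NW false r h.
Proof.
elim: r h => [|r IH] h.
  case: h => [|h]; rewrite ?OWS0 ?OWSS !OW0 /NW /= /delta /=; ring.
case: h => [|h]; first by rewrite OWS0 [OW r.+1 0]OWS0 IH NWS /=; ring.
by rewrite OWSS [OW r.+1 h.+1]OWSS !IH NWS /=; ring.
Qed.

(** The bound [h] is not felt in [r] steps, so all walks are counted, with two choices per step. *)
Lemma OW_pow r h : (r <= h)%N -> OW r h = 2%:R ^+ r.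
Proof.
elim: r => [|r IH] hr; first exact: OW0.
by rewrite OW_double NW_gt // subr0 IH ?exprS //; apply: ltnW.
Qed.

Definition QW n r := RW true n r.
Lemma QW0 r : QW 0 r = OW r 0.
Proof. by rewrite /QW RW0 /OW big_ord_recl big_ord0 addr0. Qed.
Lemma QWS n r : QW n.+1 r = QW n r.+1 + (q ^+ n.+1 - q ^+ n) * OW r n.+1.
Proof. by rewrite /QW RWS mul1r /OW [in RHS]big_ord_recr /= [X in _ * X]addrC. Qed.

(** [OW_double] carried through the recursion in [n] that [QW] and [RW false] share. *)
Lemma QW_double n r : QW n r.+1 = 2%:R * QW n r - RW false n r.
Proof.
elim: n r => [|n IH] r; first by rewrite !QW0 OW_double RW0.
by rewrite !QWS !IH OW_double RW_falseS; ring.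
Qed.

(* [rho l h] counts walks of length [l] from [h] to 0, weighted by [q] for each step leaving 0;
   [rhoE] expresses it through the ballot generating function [VW]. *)
Fixpoint rho (l h : nat) : R :=
  if l is l'.+1 then if h is h'.+1 then rho l' h' + rho l' h.+1 else q * rho l' 1
  else delta 0 h.
Fixpoint VW (l h : nat) : R :=
  NW false l h + if l is l'.+1 then q * VW l' h.+1 else 0.

Lemma VW_gt l h : (l < h)%N -> VW l h = 0.
Proof.
elim: l h => [|l IH] h hl; rewrite [VW _ _]/= NW_gt // ?add0r ?addr0 //.
by rewrite IH ?mulr0 //; lia.
Qed.

Lemma VWSS l h : VW l.+1 h.+1 = VW l h + VW l h.+2.
Proof.
elim: l h => [|l IH] h.
  by rewrite /= NWS /= !NW0S; ring.
rewrite [LHS]/= NWS /= -/(VW l.+1 h.+2) {1}IH /=; ring.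
Qed.

Lemma rhoE l h : rho l.+1 h = VW l.+1 h - VW l h.+1.
Proof.
elim: l h => [|l IH] [|h].
- by rewrite /= NWS /= !NW0S -[delta 0 1]/(0 : R) -[false%:R]/(0 : R); ring.
- by rewrite /= NWS /= !NW0S -[delta 0 h]/(NW false 0 h) -[delta 0 h.+2]/(0 : R); ring.
- rewrite [LHS]/= -/(rho l.+1 1) IH [VW l.+2 0]/= -/(VW l.+1 1) NWS /=; ring.
- by rewrite [LHS]/= -/(rho l.+1 h) -/(rho l.+1 h.+2) !IH [VW l.+2 _]VWSS VWSS; ring.
Qed.

(** Trades [q] marking the descent-free suffix for [q] marking departures from 0. The correction
    vanishes for [r <= n], since a ballot walk of [r] steps does not reach height [n.+1]. *)
Lemma RW_rho n r : RW false n r.+1 =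
  rho (n + r).+1 0 - (q ^+ n.+1 - q ^+ n) * VW r n.+1.
Proof.
elim: n r => [|n IH] r.
  rewrite RW0 add0n rhoE /= NWS /=; ring.
rewrite RW_falseS IH addSnnS [VW r.+1 _]/= !exprS; ring.
Qed.

Lemma RW_rho0 n : RW false n 0 = rho n 0.
Proof.
case: n => [|n]; first by rewrite RW0.
rewrite RW_falseS RW_rho addn0 NW_gt // VW_gt //; ring.
Qed.

Lemma RW_rho_le n r : (r <= n.+1)%N -> RW false n r = rho (n + r) 0.
Proof.
case: r => [|r] hr; first by rewrite RW_rho0 addn0.
by rewrite RW_rho VW_gt // mulr0 subr0 addnS.
Qed.

Lemma rho_odd l h : odd (l + h) -> rho l h = 0.
Proof.
elim: l h => [|l IH] [|h] // hl; rewrite /= !IH ?addr0 ?mulr0 //; lia.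
Qed.

(* [rho] taken two steps at a time, up to a factor [q] at positive heights. *)
Fixpoint zeta (m d : nat) : R :=
  if m is m'.+1 then
    match d with
    | 0 => q * zeta m' 0 + zeta m' 1
    | 1 => zeta m' 2 + 2%:R * zeta m' 1 + q * zeta m' 0
    | d'.+1 => zeta m' d.+1 + 2%:R * zeta m' d + zeta m' d'
    end
  else delta 0 d.

Lemma zetaE m d : zeta m d = (if d is 0 then 1 else q) * rho m.*2 d.*2.
Proof.
elim: m d => [|m IH] [|[|d]] //=; rewrite ?IH /delta /=; try ring.
Qed.

Lemma zeta0E m : rho m.*2 0 = zeta m 0.
Proof. by rewrite zetaE mul1r. Qed.

Lemma zeta_gt m d : (m < d)%N -> zeta m d = 0.
Proof.
elim: m d => [|m IH] [|[|d]] // hm; rewrite /= !IH ?mulr0 ?addr0 //; lia.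
Qed.

(** The weighted and unweighted parts have total length [2(r + t)], which is even, so [rho] can be
    read in double steps. *)
Lemma RW_zeta r t : RW false (r + t.*2) r = zeta (r + t) 0.
Proof. rewrite RW_rho_le -?zeta0E; [congr (rho _ 0) |]; lia. Qed.

(** Doubling twice produces two [RW false] corrections; the one of odd total length is zero by
    parity. *)
Lemma QW_step1 r t : QW (r + t.*2).+1 r.+1 = 4%:R * QW (r + t.*2) r
   - 2%:R * zeta (r + t) 0 + 2%:R ^+ r.+1 * q ^+ (r + t.*2) * (q - 1).
Proof.
rewrite QWS !QW_double RW_zeta OW_pow; last lia.
rewrite (@RW_rho_le _ r.+1); last lia.
rewrite rho_odd; last by rewrite addn0; lia.
rewrite !exprS; ring.
Qed.

Lemma QW_step2 r n : (r <= n.+1)%N ->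
  QW n.+1 r = QW n r.+1 + 2%:R ^+ r * q ^+ n * (q - 1).
Proof. by move=> hr; rewrite QWS OW_pow // exprS; ring. Qed.

End Walks.

(** * Sums over pairs of subsets *)

Definition pairs2 := [:: (true, true); (true, false); (false, true); (false, false)].

(* A letter [(a, v)] at position [p] tells whether [p] is the position of an exceedance ([a]) and
   whether [p] is the absolute value of a negative entry or the value of an exceedance ([v]).  The state
   is [d], the number of such values still to come minus the number of exceedances still to come, with
   a flag [i] saying that all values so far were of this kind; [q] marks the block boundaries of the
   inverse. *)
Definition okP (d : nat) (a v : bool) : bool := (v <= d + a)%N && (a ==> (v < d + a)%N).

Section Paths.
Variables (R : comNzRingType) (q : R) (x : nat -> R).
Let y i := x i - 1.

Definition wtP (st : nat * bool) (l : bool * bool) : R :=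
  let: (d, i) := st in let: (a, v) := l in
  if okP d a v then (if (d + a - v == 0)%N || (i && v) then q else 1) else 0.
Definition nxP (st : nat * bool) (l : bool * bool) : nat * bool :=
  let: (d, i) := st in let: (a, v) := l in ((d + a - v)%N, i && v).
Definition finP (st : nat * bool) : R := (st.1 == 0%N)%:R.

Definition ZP o n prev st := Z pairs2 fst wtP nxP x finP o n prev st.
Definition MpP := Mp pairs2 fst wtP nxP.
Definition MmP := Mm pairs2 fst wtP nxP.

Lemma MpP0 g i : MpP g (0%N, i) = g (1%N, false).
Proof.
rewrite /MpP /Mp /pairs2 !big_cons big_nil /= /okP /= andbF; ring.
Qed.
Lemma MpPS g d i : MpP g (d.+1, i) =
  (if i then q else 1) * g (d.+1, i) + g (d.+2, false).
Proof.
rewrite /MpP /Mp /pairs2 !big_cons big_nil /= /okP /= andbF andbT.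
rewrite !addn1 subn0 subn1 /=; ring.
Qed.
Lemma MmP0 g i : MmP g (0%N, i) = q * g (0%N, false).
Proof.
rewrite /MmP /Mm /pairs2 !big_cons big_nil /= /okP /= andbF; ring.
Qed.
Lemma MmPS g d i : MmP g (d.+1, i) =
  (if (d == 0%N) || i then q else 1) * g (d, i) + g (d.+1, false).
Proof.
rewrite /MmP /Mm /pairs2 !big_cons big_nil /= /okP /= andbF andbT.
rewrite !addn0 subn0 subn1 /=; ring.
Qed.

Lemma ZP0 o prev st : ZP o 0 prev st = finP st. Proof. exact: Z0. Qed.
Lemma ZP1 o st : ZP o 1 false st = MpP finP st + MmP finP st.
Proof. exact: Z1. Qed.
Lemma ZPSS o n st : ZP o n.+2 false st =
  MpP (ZP o.+1 n.+1 false) st + MmP (ZP o.+1 n.+1 false) st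
  + y o.+1 * MpP (MmP (ZP o.+2 n false)) st.
Proof. exact: ZSS. Qed.
Lemma ZP_true o n st : ZP o n.+1 true st =
  ZP o n.+1 false st + y o * MmP (ZP o.+1 n false) st.
Proof. exact: Z_true. Qed.

(** At difference 0 only letters with [v] false are admissible, so the flag is dropped at once and
    never earns a [q]. *)
Lemma ZP_0ini o n prev i : ZP o n prev (0%N, i) = ZP o n prev (0%N, false).
Proof.
case: n => [|n]; first by rewrite !ZP0.
by rewrite /ZP !ZS -!/(MpP _ _) -!/(MmP _ _) !MpP0 !MmP0.
Qed.

Lemma ZP_gt o n prev d i : (n < d)%N -> ZP o n prev (d, i) = 0.
Proof.
elim: n o prev d i => [|n IH] o prev [|d] i // hd; first by rewrite ZP0.
rewrite /ZP ZS -/(MpP _ _) -/(MmP _ _) MpPS MmPS -!/(ZP _ _ _ _) !IH; last by lia.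
- ring.
- lia.
- lia.
- lia.
Qed.

(** Without the flag, [MpP] after [MmP] and the sum of [MpP] and [MmP] are the same operator, namely
    the step of [zeta]; squares and dominoes therefore both advance the first argument by one. *)
Lemma ZP_normal o n d :
  ZP o n false (d, false) = tile y n o (fun r t => zeta q (r + t) d).
Proof.
elim/nat_ind2: n o d => [|| n IH0 IH1] o d.
- by rewrite ZP0 tile0.
- rewrite ZP1 tile1 addn0; case: d => [|[|d]];
   rewrite ?MpP0 ?MmP0 ?MpPS ?MmPS /finP /= /delta /=; ring.
rewrite ZPSS tileSS -!/(y _).
case: d => [|d].
  rewrite !MpP0 !MmP0 MmPS /= !IH0 !IH1; congr (_ + _ * _); rewrite -tileZ -tileD;
    apply: eq_tile => r t _; rewrite ?addSn ?addnS /=; ring.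
rewrite !MpPS !MmPS /= !IH0 !IH1 !orbF !mul1r; congr (_ + _ * _);
  rewrite -!tileZ -!tileD; apply: eq_tile => r t _; rewrite ?addSn ?addnS;
  case: d => [|d] /=; ring.
Qed.

(** The increment, when [r] grows by 1, of [zeta q (r + t) 0] minus [q ^+ r] for [t = 0]. The latter
    is the coefficient expected from the shifted windows, so the sum over prefix lengths
    telescopes. *)
Definition kappa (r t : nat) : R :=
  zeta q (r + t).+1 0 - zeta q (r + t) 0 - (q ^+ r * (q - 1)) *+ (t == 0%N).

Lemma ZP_ini1 o n : ZP o n false (1%N, true) = tile y n o kappa.
Proof.
elim/nat_ind2: n o => [|| n IH0 IH1] o.
- by rewrite ZP0 tile0 /kappa /= /finP /delta /=; ring.
- by rewrite ZP1 MpPS MmPS tile1 /kappa /= /finP /delta /=; ring.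
rewrite ZPSS tileSS -/(y _) !MpPS !MmPS /= !ZP_0ini !IH1 !ZP_normal.
congr (_ + _ * _); rewrite -!tileZ -!tileD -?tileZ -?tileD;
  apply: eq_tile => r t _; rewrite /kappa ?addSn ?addnS.
  by case: t => [|t]; rewrite /= ?mulr0n ?mulr1n ?exprS; ring.
by rewrite /= mulr0n; ring.
Qed.

(** Column sums of the step matrix of [zeta]: each column sums to 4 except column 0, which sums to
    [2q]. The bound on [m] keeps the truncation at [N] invisible. *)
Lemma zeta_sum_step N m : (m < N)%N ->
  \sum_(c < N.+1) zeta q m.+1 c =
  4%:R * (\sum_(c < N.+1) zeta q m c) + (2%:R * q - 4%:R) * zeta q m 0.
Proof.
case: N => // N hm.
rewrite big_ord_recl big_ord_recl.
have -> : \sum_(i < N) zeta q m.+1 (lift ord0 (lift ord0 i)) =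
  \sum_(i < N) zeta q m i.+3 + 2%:R * (\sum_(i < N) zeta q m i.+2)
   + \sum_(i < N) zeta q m i.+1.
  by rewrite mulr_sumr -!big_split.
have e1 : \sum_(c < N.+2) zeta q m c =
    zeta q m 0 + zeta q m 1 + \sum_(i < N) zeta q m i.+2.
  by rewrite !big_ord_recl addrA.
have e2 : \sum_(c < N.+2) zeta q m c = zeta q m 0 + \sum_(i < N) zeta q m i.+1.
  rewrite big_ord_recl big_ord_recr /= [zeta q m N.+1]zeta_gt ?addr0 //.
have e3 : \sum_(c < N.+2) zeta q m c =
    zeta q m 0 + zeta q m 1 + zeta q m 2 + \sum_(i < N) zeta q m i.+3.
  have -> : \sum_(c < N.+2) zeta q m c = \sum_(c < N.+3) zeta q m c.
    by rewrite [RHS]big_ord_recr /= zeta_gt ?addr0 //; lia.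
  by rewrite !big_ord_recl !addrA.
set S := \sum_(c < N.+2) _ in e1 e2 e3 *.
have -> : \sum_(i < N) zeta q m i.+2 = S - zeta q m 0 - zeta q m 1 by rewrite e1; ring.
have -> : \sum_(i < N) zeta q m i.+1 = S - zeta q m 0 by rewrite e2; ring.
have -> : \sum_(i < N) zeta q m i.+3 = S - zeta q m 0 - zeta q m 1 - zeta q m 2.
  by rewrite e3; ring.
by rewrite /=; ring.
Qed.

Lemma QW_stept r t : QW q (r + t.+1.*2) r = 4%:R * QW q (r + t.*2) r
   - 2%:R * zeta q (r + t) 0 + (q + 2%:R) * (q - 1) * (2%:R ^+ r * q ^+ (r + t.*2)).
Proof.
rewrite doubleS !addnS QW_step2; last lia.
rewrite QW_step1 !exprS; ring.
Qed.

(** The bridge between subset paths and walks with a loop: [zeta_sum_step] is [2 - q] times the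
    recurrences [QW_step1] and [QW_stept], up to the explicit powers. *)
Lemma zeta_total N r t : (r + t <= N)%N ->
  \sum_(c < N.+1) zeta q (r + t) c =
  (2%:R - q) * QW q (r + t.*2) r + 2%:R ^+ r * q ^+ (r + t.*2) * (q - 1).
Proof.
elim: t r => [|t IHt] r.
  elim: r => [|r IH] hr.
    rewrite big_ord_recl big1 => [|i _]; last by [].
    by rewrite QW0 OW0 /= /delta /=; ring.
  have := QW_step1 q r 0; rewrite !addn0 => e.
  rewrite !addn0 in IH hr *.
  rewrite zeta_sum_step // IH; last exact: ltnW.
  by rewrite e !exprS; ring.
move=> hr; rewrite addnS zeta_sum_step; last lia.
rewrite IHt; last lia.
rewrite QW_stept doubleS !addnS !exprS; ring.
Qed.

Lemma sum_shift (N : nat) (g : nat -> R) : g N = 0 ->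
  \sum_(c < N) g c = g 0%N + \sum_(c < N) g c.+1.
Proof.
move=> gN; transitivity (\sum_(c < N.+1) g c); last by rewrite big_ord_recl.
by rewrite big_ord_recr /= gN addr0.
Qed.

(** Summing over the starting difference makes the flagged part reproduce itself up to a boundary
    term at 0; whatever loses the flag is a complete sum, evaluated by [zeta_total]. *)
Lemma sum_ini N o n : (n <= N)%N ->
  \sum_(c < N) ZP o n false (c.+1, true) =
  tile y n o (fun r t => QW q (r + t.*2) r - zeta q (r + t) 0).
Proof.
elim/nat_ind2: n o => [|| n IH0 IH1] o hn.
- by rewrite big1 ?tile0 => [|i _]; rewrite ?ZP0 ?QW0 ?OW0 /= /delta ?subrr.
- case: N hn => // N _; rewrite big_ord_recl big1 => [|i _]; last first.
    by rewrite ZP_gt.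
  rewrite /= ZP1 MpPS MmPS tile1.
  have := QW_step1 q 0 0; rewrite /= !addn0 => ->.
  by rewrite QW0 OW0 /= /finP /delta /=; ring.
have hs o' k : (k < N)%N -> \sum_(c < N) ZP o' k false (c : nat, true) =
    ZP o' k false (0%N, false) + \sum_(c < N) ZP o' k false (c.+1, true).
  move=> hk; rewrite -(ZP_0ini o' k false true).
  by apply: (@sum_shift _ (fun c => ZP o' k false (c, true))); apply: ZP_gt.
have hn0 o' k : (k <= N)%N -> \sum_(c < N) ZP o' k false (c.+1, false) =
    tile y k o' (fun r t => \sum_(c < N.+1) zeta q (r + t) c - zeta q (r + t) 0).
  move=> hk; under eq_bigr do rewrite ZP_normal.
  rewrite -tile_sum; apply: eq_tile => r t _.
  by rewrite big_ord_recl /=; ring.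
have hn1 o' k : (k <= N)%N -> \sum_(c < N) ZP o' k false (c.+2, false) =
    \sum_(c < N) ZP o' k false (c.+1, false) - ZP o' k false (1%N, false).
  move=> hk.
  rewrite (@sum_shift _ (fun c => ZP o' k false (c.+1, false))) /=; first by ring.
  by apply: ZP_gt.
have hq1 : (n.+1 <= N)%N by lia.
have hq0 : (n <= N)%N by lia.
(* The first four sums are one free letter, the bracket is a plus followed by a minus: [q ^+ 2] when
   both letters keep the flag, [q + 1] for losing it at the second or at the first letter with [v]
   true once, and 1 when [v] is false twice. *)
transitivity (
  q * (\sum_(c < N) ZP o.+1 n.+1 false (c.+1, true))
  + (\sum_(c < N) ZP o.+1 n.+1 false (c.+2, false))
  + q * (\sum_(c < N) ZP o.+1 n.+1 false (c : nat, true))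
  + (\sum_(c < N) ZP o.+1 n.+1 false (c.+1, false))
  + y o.+1 * (q ^+ 2 * (\sum_(c < N) ZP o.+2 n false (c : nat, true))
    + (q + 1) * (\sum_(c < N) ZP o.+2 n false (c.+1, false))
    + \sum_(c < N) ZP o.+2 n false (c.+2, false))).
  rewrite !mulr_sumr -!big_split /= mulr_sumr -big_split /=; apply: eq_bigr => c _.
  by rewrite ZPSS !MpPS !MmPS /= !orbT; ring.
rewrite !hn1 // !hn0 // !hs // IH0 // IH1 // !ZP_normal tileSS -/(y _).
have tB k o' S S' : tile y k o' S - tile y k o' S' =
    tile y k o' (fun r t => S r t + (-1) * S' r t).
  by rewrite tileD tileZ; ring.
congr (_ + _ * _).
  rewrite !tB -!tileD -!tileZ -!tileD; apply: eq_tile => r t e.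
  rewrite zeta_total; last lia.
  rewrite addSn [(r.+1 + _)%N]addSn QW_step1 [zeta q (r + t).+1 0]/= !exprS; ring.
rewrite !tB -!tileD -!tileZ -!tileD; apply: eq_tile => r t e.
rewrite zeta_total; last lia.
rewrite QW_stept addnS [zeta q (r + t).+1 0]/=; ring.
Qed.

(** For a positive starting difference the word is read after a virtual plus in position 0, because
    the first entry is then negative exactly when the first letter is a minus. This produces the
    term in [y 0]. *)
Lemma classI_total n : ZP 0 n.+1 false (0%N, false)
    + \sum_(c < n.+1) ZP 0 n.+1 true (c.+1, true) =
  tile y n.+1 0 (fun r t => QW q (r + t.*2) r)
   + y 0 * tile y n 1 (fun r t => QW q (r + t.*2).+1 r).
Proof.
under eq_bigr do rewrite ZP_true.
rewrite big_split /= sum_ini // ZP_normal addrA -tileD; congr (_ + _).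
  by apply: eq_tile => r t _; ring.
rewrite -mulr_sumr; congr (_ * _).
under eq_bigr do rewrite MmPS orbT.
rewrite big_split /= -mulr_sumr.
rewrite (@sum_shift _ (fun c => ZP 1 n false (c, true))) ?(ZP_gt _ _ _ (ltnSn n)) //=.
rewrite ZP_0ini sum_ini //.
under [X in _ + X]eq_bigr do rewrite ZP_normal.
rewrite ZP_normal -tile_sum -tileD -tileZ -tileD; apply: eq_tile => r t e.
have := @zeta_total n.+1 r t; rewrite big_ord_recl => h.
have -> : \sum_(i < n.+1) zeta q (r + t) i.+1 =
    (2%:R - q) * QW q (r + t.*2) r + 2%:R ^+ r * q ^+ (r + t.*2) * (q - 1) -
    zeta q (r + t) 0.
  by rewrite -h; [rewrite /=; ring | lia].
rewrite QW_step2; last lia.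
rewrite QW_double RW_zeta; ring.
Qed.

(** Induction removes the shortest prefix; what it contributes is the increment [kappa] for a first
    square, and the missing [zeta q (r + t) 1] part of a first domino. *)
Lemma classII_total o n :
  \sum_(j < n) ZP (o + j).+1 (n - j.+1) true (1%N, true) =
  tile y n o (fun r t => zeta q (r + t) 0) - q ^+ n.
Proof.
have -> : q ^+ n = tile y n o (fun r t => q ^+ r *+ (t == 0%N)).
  by rewrite (tile_mono y n o (fun r => q ^+ r)).
elim: n o => [|n IH] o; first by rewrite big_ord0 !tile0 subrr.
rewrite big_ord_recl addn0 subSS subn0.
under eq_bigr do rewrite /= addnS -addSn subSS.
rewrite IH; case: n {IH} => [|n].
  by rewrite ZP0 !tile0 !tile1 /= /finP /delta /= !mulr1n; ring.
rewrite ZP_true ZP_ini1 MmPS /= ZP_0ini !ZP_normal !(tileSS y n o) -/(y _).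
have -> : tile y n o.+2 (fun r t => q ^+ r *+ (t.+1 == 0%N)) = 0.
  by rewrite -[RHS](tile_zero y n o.+2); apply: eq_tile => r t _; rewrite mulr0n.
have tB k o' S S' : tile y k o' S - tile y k o' S' =
    tile y k o' (fun r t => S r t + (-1) * S' r t).
  by rewrite tileD tileZ; ring.
have E2 : q * tile y n o.+2 (fun r t => zeta q (r + t) 0) +
    tile y n o.+2 (fun r t => zeta q (r + t) 1) =
    tile y n o.+2 (fun r t => zeta q (r + t.+1) 0).
  by rewrite -tileZ -tileD; apply: eq_tile => r t _; rewrite addnS.
have E1 : tile y n.+1 o.+1 kappa +
    (tile y n.+1 o.+1 (fun r t => zeta q (r + t) 0) -
     tile y n.+1 o.+1 (fun r t => q ^+ r *+ (t == 0%N))) =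
    tile y n.+1 o.+1 (fun r t => zeta q (r.+1 + t) 0) -
    tile y n.+1 o.+1 (fun r t => q ^+ r.+1 *+ (t == 0%N)).
  rewrite !tB -tileD; apply: eq_tile => r t _; rewrite /kappa addSn.
  by case: t => [|t]; rewrite /= ?mulr0n ?mulr1n ?addn0 ?exprS; ring.
by rewrite addrAC E1 E2 mulr0 addr0 addrAC.
Qed.

End Paths.

(** * Patterns and adjacent swaps *)

Ltac split_ifs := repeat match goal with
  |- context [if ?b then _ else _] => case: (boolP b) => ? end.

(* Stembridge's patterns for windows which are not fully commutative of type B, read on [g 1 .. g n]. *)
Definition bad1 (n : nat) (g : nat -> int) :=
  exists i j : nat, [/\ (0 < i < j)%N, (j <= n)%N, g j < g i & g i < 0].
Definition bad2 (n : nat) (g : nat -> int) :=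
  exists i j k : nat, [/\ (0 < i < j)%N, (j < k <= n)%N, g k < g j & g j < `|g i|].
Definition bad3 (n : nat) (g : nat -> int) :=
  exists i j k : nat, [/\ (0 < i < j)%N, (j < k <= n)%N, `|g i| < - g j & g k < `|g i|].
Definition Bad n g := [\/ bad1 n g, bad2 n g | bad3 n g].

(* The window of [w * s_l], when [g] is the window of [w]. *)
Definition sw (l : nat) (g : nat -> int) (k : nat) : int :=
  if l == 0%N then (if k == 1%N then - g 1%N else g k)
  else if k == l then g l.+1 else if k == l.+1 then g l else g k.

Definition sg (l k : nat) : nat :=
  if k == l then l.+1 else if k == l.+1 then l else k.

Lemma sw_sg l g k : (0 < l)%N -> sw l g (sg l k) = g k.
Proof.
move=> l0; rewrite /sw /sg; have -> : (l == 0%N) = false by lia.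
have [->|kl] := eqVneq k l.
  have -> : (l.+1 == l) = false by lia.
  by rewrite eqxx.
have [->|kl1] := eqVneq k l.+1; first by rewrite eqxx.
by rewrite (negbTE kl) (negbTE kl1).
Qed.

Lemma sg_lt l i j : (i < j)%N -> ~ (i = l /\ j = l.+1) -> (sg l i < sg l j)%N.
Proof. by move=> ? ?; rewrite /sg; split_ifs; lia. Qed.

Lemma sg_bounds l n i : (0 < l < n)%N -> (0 < i <= n)%N -> (0 < sg l i <= n)%N.
Proof. by move=> ? ?; rewrite /sg; split_ifs; lia. Qed.

Lemma sw0_ge2 g k : (1 < k)%N -> sw 0 g k = g k.
Proof. by rewrite /sw /=; split_ifs; lia. Qed.
Lemma sw0_norm g k : `|sw 0 g k| = `|g k|.
Proof. by rewrite /sw /=; case: eqP => // ->; rewrite normrN. Qed.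

Definition inj_abs n (g : nat -> int) :=
  forall i j, (0 < i <= n)%N -> (0 < j <= n)%N -> `|g i| = `|g j| -> i = j.
Definition nonz n (g : nat -> int) := forall i, (0 < i <= n)%N -> g i != 0.

Definition des (g : nat -> int) (l : nat) := (g l.+1 < (if l == 0%N then 0 else g l)).

(** Badness goes up in the right weak order. Positions are carried along by [sg], except when the
    swapped pair consists of two neighbouring pattern positions; then [bad2] becomes [bad3] or
    conversely. For [l = 0] the patterns see the first entry only through its absolute value. *)
Lemma bad_asc n g l : inj_abs n g -> nonz n g -> (l < n)%N -> ~~ des g l ->
  Bad n g -> Bad n (sw l g).
Proof.
move=> gi gz ln; rewrite /des; have [->|l0] := eqVneq l 0%N => nd.
  case=> [[i [j [h1 h2 h3 h4]]]|[i [j [k [h1 h2 h3 h4]]]]|[i [j [k [h1 h2 h3 h4]]]]].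
  - have i1 : i != 1%N by apply: contraTneq h4 => ->; lia.
    by constructor 1; exists i, j; rewrite !sw0_ge2 //; lia.
  - by constructor 2; exists i, j, k; rewrite sw0_norm !sw0_ge2 //; lia.
  - by constructor 3; exists i, j, k; rewrite sw0_norm !sw0_ge2 //; lia.
have hs k : sw l g (sg l k) = g k by apply: sw_sg; lia.
have hb k : (0 < k <= n)%N -> (0 < sg l k <= n)%N by apply: sg_bounds; lia.
have asc : g l < g l.+1.
  have : g l != g l.+1; last by lia.
  apply/eqP => e; have : l = l.+1 by apply: gi; [lia | lia | rewrite e].
  by lia.
case=> [[i [j [h1 h2 h3 h4]]]|[i [j [k [h1 h2 h3 h4]]]]|[i [j [k [h1 h2 h3 h4]]]]].
- constructor 1; exists (sg l i), (sg l j); rewrite !hs.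
  have := hb i; have := hb j.
  have : (sg l i < sg l j)%N by apply: sg_lt; [lia | case=> e1 e2; subst; lia].
  by split; lia.
- have ljk : (sg l j < sg l k)%N by apply: sg_lt; [lia | case=> e1 e2; subst; lia].
  have := hb i; have := hb j; have := hb k => b1 b2 b3.
  have [/andP[/eqP ei /eqP ej]|ne] := boolP ((i == l) && (j == l.+1)); last first.
    constructor 2; exists (sg l i), (sg l j), (sg l k); rewrite !hs.
    have : (sg l i < sg l j)%N by apply: sg_lt; lia.
    by split; lia.
  constructor 3; exists (sg l j), (sg l i), (sg l k); rewrite !hs.
  have : (sg l j < sg l i)%N by subst; rewrite /sg; split_ifs; lia.
  have : (sg l i < sg l k)%N by apply: sg_lt; lia.
  by subst; split; lia.
- have := hb i; have := hb j; have := hb k => b1 b2 b3.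
  have lij : (sg l i < sg l j)%N by apply: sg_lt; [lia | case=> e1 e2; subst; lia].
  have [/andP[/eqP ej /eqP ek]|ne] := boolP ((j == l) && (k == l.+1)); last first.
    constructor 3; exists (sg l i), (sg l j), (sg l k); rewrite !hs.
    have : (sg l j < sg l k)%N by apply: sg_lt; lia.
    by split; lia.
  constructor 2; exists (sg l i), (sg l k), (sg l j); rewrite !hs.
  have : (sg l k < sg l j)%N by subst; rewrite /sg; split_ifs; lia.
  have : (sg l i < sg l k)%N by apply: sg_lt; lia.
  by subst; split; lia.
Qed.

Lemma exists_des (g : nat -> int) i j : (i < j)%N -> g j < g i ->
  exists l : nat, [/\ (i <= l)%N, (l < j)%N & g l.+1 < g l].
Proof.
elim: j => // j IH ij hg.
have [h|h] := ltP (g j.+1) (g j); first by exists j; split; lia.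
have ij' : (i < j)%N.
  by rewrite ltn_neqAle -ltnS ij andbT; apply/eqP => e; subst; lia.
have [|l [h1 h2 h3]] := IH ij'; first by lia.
by exists l; split; lia.
Qed.

Lemma exists_des0 (g : nat -> int) j : (0 < j)%N -> g j < 0 ->
  exists l : nat, (l < j)%N /\ des g l.
Proof.
move=> j0 hj; have [h|h] := ltP (g 1%N) 0; first by exists 0%N.
have j1 : (1 < j)%N.
  by rewrite ltn_neqAle j0 andbT; apply/eqP => e; subst; lia.
have [|l [h1 h2 h3]] := exists_des j1 (g := g); first by lia.
by exists l; split => //; rewrite /des; case: l h1 h2 h3.
Qed.

(** A pattern spans a descent. Sorting a descent that is not the pattern's own adjacent pair keeps a
    pattern; if this is impossible, two consecutive descents appear, that is, two noncommuting final
    letters. *)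
Lemma bad_down n g : inj_abs n g -> nonz n g -> Bad n g ->
  (exists l, [/\ (l.+1 < n)%N, des g l & des g l.+1]) \/
  (exists l, [/\ (l < n)%N, des g l & Bad n (sw l g)]).
Proof.
move=> gi gz.
have desS l : (0 < l)%N -> g l.+1 < g l -> des g l by case: l.
have B1 : bad1 n g -> (exists l, [/\ (l.+1 < n)%N, des g l & des g l.+1]) \/
  (exists l, [/\ (l < n)%N, des g l & Bad n (sw l g)]).
  case=> i [j [h1 h2 h3 h4]].
  have ij : (i < j)%N by lia.
  have [l [l1 l2 l3]] := exists_des ij h3.
  have l0 : (0 < l)%N by lia.
  have [/andP[/eqP ei /eqP ej]|ne] := boolP ((i == l) && (j == l.+1)); last first.
    right; exists l; split; [lia | exact: desS |].
    constructor 1; exists (sg l i), (sg l j); rewrite !sw_sg //.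
    have : (sg l i < sg l j)%N by apply: sg_lt; lia.
    have := @sg_bounds l n i; have := @sg_bounds l n j.
    by split; lia.
  have [i1|i1] := eqVneq i 1%N.
    left; exists 0%N; subst l j; rewrite i1 in h2 h3 h4 l3.
    by split; [lia | rewrite /des /=; lia | exact: desS].
  (* The bad pair is adjacent. If the entry before it is larger, there are two descents in a row;
     otherwise that entry is negative too, and a descent strictly to its left can be sorted without
     touching the pair. *)
  have [hd|hd] := ltP (g i) (g i.-1).
    left; exists i.-1; have -> : i.-1.+1 = i by lia.
    split; [lia | | apply: desS; subst; lia].
    rewrite /des; have -> : (i.-1 == 0%N) = false by lia.
    by have -> : i.-1.+1 = i by lia.
  have hneg : g i.-1 < 0 by lia.
  have i2 : (0 < i.-1)%N by lia.
  have [m [m1 m2]] := exists_des0 i2 hneg.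
  right; exists m; split; [lia | exact: m2 |].
  constructor 1; exists i, j; have [->|m0] := eqVneq m 0%N.
    by split; rewrite ?sw0_ge2; lia.
  have e k : (i <= k)%N -> sw m g k = g k.
    by move=> hk; rewrite /sw (negbTE m0); split_ifs; lia.
  by split; rewrite ?e; lia.
case=> //.
- case=> i [j [k [h1 h2 h3 h4]]].
  have hik : (0 < i)%N by lia.
  have [hd|hd] := ltP (g j) (g i).
    have ij : (i < j)%N by lia. have jk : (j < k)%N by lia.
    have [l [l1 l2 l3]] := exists_des ij hd.
    have [m [m1 m2 m3]] := exists_des jk h3.
    have key l' : (0 < l' < n)%N -> g l'.+1 < g l' -> ~ (i = l' /\ j = l'.+1) ->
        ~ (j = l' /\ k = l'.+1) ->
      exists l : nat, [/\ (l < n)%N, des g l & Bad n (sw l g)].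
      move=> b h n1 n2; exists l'; split; [lia | apply: desS => //; lia |].
      constructor 2; exists (sg l' i), (sg l' j), (sg l' k); rewrite !sw_sg; try lia.
      have : (sg l' i < sg l' j)%N by apply: sg_lt; lia.
      have : (sg l' j < sg l' k)%N by apply: sg_lt; lia.
      have := @sg_bounds l' n i; have := @sg_bounds l' n k.
      by split; lia.
    have [/andP[/eqP e1 /eqP e2]|ne] := boolP ((i == l) && (j == l.+1)); last first.
      by right; apply: (key l) => //; lia.
    have [/andP[/eqP e3 /eqP e4]|ne] := boolP ((j == m) && (k == m.+1)); last first.
      by right; apply: (key m) => //; lia.
    left; exists l; have em : m = l.+1 by lia.
    rewrite em in m3; have l0 : (0 < l)%N by lia.
    by split; [lia | exact: desS | exact: desS].
  have gin : g i < 0 by lia.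
  have [l [l1 l2]] := exists_des0 hik gin.
  right; exists l; split => //; first by lia.
  have [e|l0] := eqVneq l 0%N.
    subst l; constructor 2; exists i, j, k; split; rewrite ?sw0_norm ?sw0_ge2; lia.
  have l0' : (0 < l)%N by lia.
  constructor 2; exists (sg l i), j, k; rewrite sw_sg //.
  have e u : (j <= u)%N -> sw l g u = g u.
    by move=> hu; rewrite /sw (negbTE l0); split_ifs; lia.
  rewrite !e; [|lia|lia].
  have : (0 < sg l i < j)%N by rewrite /sg; split_ifs; lia.
  by split; lia.
- case=> i [j [k [h1 h2 h3 h4]]].
  have ij : (i < j)%N by lia.
  have hd : g j < g i by lia.
  have [l [l1 l2 l3]] := exists_des ij hd.
  have l0 : (0 < l)%N by lia.
  have sk : (0 < sg l k <= n)%N by apply: sg_bounds; lia.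
  have sj : (sg l j < sg l k)%N by apply: sg_lt; lia.
  have si := @sg_bounds l n i; have sj' := @sg_bounds l n j.
  have [/andP[/eqP e1 /eqP e2]|ne] := boolP ((i == l) && (j == l.+1)); last first.
    right; exists l; split; [lia | exact: desS |].
    constructor 3; exists (sg l i), (sg l j), (sg l k); rewrite !sw_sg //.
    have : (sg l i < sg l j)%N by apply: sg_lt; lia.
    by split; lia.
  have [neg|pos] := ltP (g i) 0; first by apply: B1; exists i, j; split; lia.
  right; exists l; split; [lia | exact: desS |].
  constructor 2; exists (sg l j), (sg l i), (sg l k); rewrite !sw_sg //.
  have : (sg l i < sg l k)%N by apply: sg_lt; lia.
  have : (sg l j < sg l i)%N by subst; rewrite /sg; split_ifs; lia.
  by split; lia.
Qed.

Lemma bad_of_des2 n g l : (l.+1 < n)%N -> des g l -> des g l.+1 -> Bad n g.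
Proof.
rewrite /des => ln; have [->|l0] := eqVneq l 0%N => /= h1 h2.
  by constructor 1; exists 1%N, 2%N; split; lia.
by constructor 2; exists l, l.+1, l.+2; split; lia.
Qed.

Lemma eq_Bad n g g' : (forall k, (0 < k <= n)%N -> g k = g' k) -> Bad n g -> Bad n g'.
Proof.
move=> e; case=> [[i [j [h1 h2 h3 h4]]]|[i [j [k [h1 h2 h3 h4]]]]|[i [j [k [h1 h2 h3 h4]]]]].
- by constructor 1; exists i, j; split; rewrite -?e; lia.
- by constructor 2; exists i, j, k; split; rewrite -?e; lia.
- by constructor 3; exists i, j, k; split; rewrite -?e; lia.
Qed.

Lemma eq_sw n g g' l k : (forall u, (0 < u <= n)%N -> g u = g' u) -> (l < n)%N ->
  (0 < k <= n)%N -> sw l g k = sw l g' k.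
Proof. by move=> e ln hk; rewrite /sw; split_ifs; rewrite ?e //; lia. Qed.

Lemma sw_comm g i j k : (i.+1 < j)%N -> sw j (sw i g) k = sw i (sw j g) k.
Proof.
move=> ij; rewrite /sw; split_ifs;
 repeat match goal with h : is_true (?a == ?b :> nat) |- _ => move/eqP: h => h; subst end;
 by [|lia].
Qed.

(** * Full commutativity and pattern avoidance *)

Section Group.
Variable n : nat.
Implicit Types (u v w : SP n) (i j k : 'I_n).

Lemma wn_val w i : wn w i.+1 = wval w i.
Proof.
by rewrite /wn /wseq /= (nth_map i) ?size_enum_ord // nth_ord_enum.
Qed.

Lemma ord_pred_ex (k : nat) : (0 < k <= n)%N -> exists i : 'I_n, k = i.+1.
Proof.
by case: k => // k /= hk; exists (Ordinal hk).
Qed.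

Lemma wval_norm w i : `|wval w i| = (w.1 i).+1%:Z.
Proof. by rewrite /wval; case: ifP => _; lia. Qed.

Lemma wval_neg w i : (wval w i < 0) = w.2 i.
Proof. by rewrite /wval; case: ifP => _; lia. Qed.

Lemma wval_inj u w : wval u =1 wval w -> u = w.
Proof.
move=> e; have e1 : u.1 = w.1.
  by apply/permP => i; apply/val_inj; have := wval_norm u i; rewrite e wval_norm => -[] //.
have e2 : u.2 = w.2 by apply/ffunP => i; rewrite -!wval_neg e.
by case: u w e1 e2 {e} => a b [c d] /= -> ->.
Qed.

Lemma wn_inj u w : (forall k : nat, (0 < k <= n)%N -> wn u k = wn w k) -> u = w.
Proof. by move=> e; apply: wval_inj => i; rewrite -!wn_val; apply: e => /=. Qed.

Lemma wn_inj_abs w : inj_abs n (wn w).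
Proof.
move=> a b /ord_pred_ex[i ->] /ord_pred_ex[j ->].
rewrite !wn_val !wval_norm => -[/val_inj/perm_inj ->] //.
Qed.

Lemma wn_nonz w : nonz n (wn w).
Proof.
by move=> a /ord_pred_ex[i ->]; rewrite wn_val -normr_eq0 wval_norm.
Qed.

Lemma wval_gen w i k : wval (mulSP w (gen i)) k =
  if val i == 0%N then (if val k == 0%N then - wval w k else wval w k)
  else wval w (tperm (prevI i) i k).
Proof.
rewrite /gen; case: ifP => _; rewrite /wval /mulSP /= ffunE /=.
  by rewrite !perm1 ffunE mul1g; case: (val k == 0%N); case: (w.2 k); rewrite /= ?opprK.
by rewrite ffunE /= permM.
Qed.

Lemma wn_gen w i (k : nat) : (0 < k <= n)%N -> wn (mulSP w (gen i)) k = sw i (wn w) k.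
Proof.
case/ord_pred_ex => j ->; rewrite wn_val wval_gen /sw.
case: ifP => i0.
  have [j0|j0] := eqVneq (val j) 0%N.
    by rewrite /= j0 /= -wn_val j0.
  by rewrite wn_val; case: eqP => // /eqP; rewrite eqSS (negbTE j0).
have ip : (prevI i).+1 = i :> nat by rewrite /= prednK // lt0n; apply/negbT.
case: tpermP => [->|->|n1 n2].
- by rewrite ip eqxx wn_val.
- have -> : (i.+1 == i) = false by lia.
  by rewrite eqxx -ip wn_val.
- have -> : (j.+1 == i) = false.
    by apply/eqP => e; apply: n1; apply/val_inj => /=; lia.
  have -> : (j.+1 == i.+1) = false by apply/eqP => -[e]; apply: n2; apply/val_inj.
  by rewrite wn_val.
Qed.

Lemma mulSPA u v w : mulSP u (mulSP v w) = mulSP (mulSP u v) w.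
Proof.
rewrite /mulSP /=; congr (_, _); first by rewrite mulgA.
by apply/ffunP => i; rewrite !ffunE permM addbA.
Qed.

Lemma mul1SP w : mulSP (idSP n) w = w.
Proof.
case: w => a b; rewrite /mulSP /idSP /= mulg1; congr (_, _).
by apply/ffunP => i; rewrite !ffunE addbF.
Qed.

Lemma mulSP1 w : mulSP w (idSP n) = w.
Proof.
case: w => a b; rewrite /mulSP /idSP /= mul1g; congr (_, _).
by apply/ffunP => i; rewrite !ffunE perm1.
Qed.

Lemma gen_invol w i : mulSP (mulSP w (gen i)) (gen i) = w.
Proof.
apply: wval_inj => k; rewrite !wval_gen.
case: (val i == 0%N); last by rewrite tpermK.
by case: (val k == 0%N); rewrite ?opprK.
Qed.

Lemma wordProd_rcons (s : seq 'I_n) i :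
  wordProd (rcons s i) = mulSP (wordProd s) (gen i).
Proof.
elim: s => [|a s IH] /=; first by rewrite mulSP1 mul1SP.
by rewrite IH mulSPA.
Qed.

(** The Coxeter length of type B: inversions, pairs with negative sum, and negative entries. *)
Definition ell w : nat :=
  (\sum_(x : 'I_n * 'I_n | (x.1 < x.2)%N)
     ((wval w x.2 < wval w x.1)%R + (wval w x.1 + wval w x.2 < 0)%R)%N
   + \sum_(i : 'I_n) (wval w i < 0)%R)%N.

Lemma ell_asc w i : ~~ des (wn w) i -> ell (mulSP w (gen i)) = (ell w).+1.
Proof.
rewrite /des wn_val; case: ifP => i0 nd; rewrite /ell.
  have e0 : forall k, val k = 0%N -> k = i.
    by move=> k hk; apply: ord_inj; exact: etrans hk (esym (eqP i0)).
  have wi : 0 < wval w i.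
    by have := @wn_nonz w i.+1 (ltn_ord i); rewrite wn_val; lia.
  rewrite -addnS; congr addn.
    apply: eq_bigr => -[a b] /= ab; rewrite !wval_gen i0.
    have -> : (val b == 0%N) = false by apply: gtn_eqF; apply: leq_ltn_trans ab.
    case: ifP => _ //.
    (* Negating the first entry exchanges the two conditions on a pair that contains it. *)
    by rewrite addnC; congr (nat_of_bool _ + nat_of_bool _)%N; lia.
  rewrite (bigD1 i) //= [in RHS](bigD1 i) //= wval_gen i0.
  have -> : (- wval w i < 0) by lia.
  have -> : (wval w i < 0) = false by lia.
  rewrite add1n add0n; congr _.+1; apply: eq_bigr => k ki.
  rewrite wval_gen i0; case: ifP => // /eqP/e0 e; by rewrite e eqxx in ki.
have ip : (prevI i).+1 = i :> nat by rewrite /= prednK // lt0n; apply/negbT.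
set p := prevI i in ip *.
have pi : wval w p < wval w i.
  have hne : wval w p != wval w i.
    apply/eqP => e; have := @wn_inj_abs w p.+1 i.+1.
    rewrite !wn_val e => /(_ (ltn_ord p) (ltn_ord i) erefl); lia.
  by move: nd; rewrite -ip wn_val /=; lia.
rewrite -addSn; congr addn; last first.
  rewrite (reindex_inj (@perm_inj _ (tperm p i))) /=.
  by apply: eq_bigr => k _; rewrite wval_gen i0 tpermK.
pose s := tperm p i.
have sK k : tperm (prevI i) i (s k) = k by rewrite tpermK.
have sinj : injective (fun x : 'I_n * 'I_n => (s x.1, s x.2)).
  by move=> [a b] [c d] [/perm_inj -> /perm_inj ->].
rewrite (reindex_inj sinj) /=.
(* The swap permutes all pairs other than [(p, i)], and this one gains an inversion while its sum is
   unchanged. *)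
rewrite (bigD1 (i, p)) /=; last first.
  rewrite /s tpermL tpermR; lia.
rewrite [in RHS](bigD1 (p, i)) /=; last lia.
rewrite !wval_gen i0 !sK.
have -> : (wval w p < wval w i) by [].
have -> : (wval w i < wval w p) = false by lia.
rewrite [wval w i + _]addrC -!addnA /= add1n add0n; congr (_ + _).+1.
  apply: eq_big => [[a b]|[a b] /= _] /=; last by rewrite !wval_gen i0 !sK.
rewrite /s !xpair_eqE -!(inj_eq val_inj) /=.
case: tpermP => [->|->|/eqP + /eqP]; case: tpermP => [->|->|/eqP + /eqP];
  rewrite -?(inj_eq val_inj) /= ?eqxx; move: (nat_of_ord a) (nat_of_ord b) ip; lia.
Qed.


Lemma des_gen w i : des (wn (mulSP w (gen i))) i = ~~ des (wn w) i.
Proof.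
have hi := ltn_ord i.
have nz := @wn_nonz w i.+1 hi.
rewrite /des wn_gen // /sw; have [e|i0] := eqVneq (i : nat) 0%N.
  by rewrite e /=; rewrite e in nz; lia.
have hi' : (0 < i <= n)%N by lia.
rewrite wn_gen // /sw (negbTE i0) eqxx eqxx.
have -> : (i.+1 == i :> nat) = false by lia.
have : wn w i != wn w i.+1.
  apply/eqP => e; have := @wn_inj_abs w i i.+1 hi' hi; rewrite e => /(_ erefl); lia.
lia.
Qed.

Lemma ell_des w i : des (wn w) i -> ell w = (ell (mulSP w (gen i))).+1.
Proof.
by move=> d; rewrite -{1}(gen_invol w i) ell_asc // des_gen d.
Qed.

Lemma ell_gen_le w i : (ell (mulSP w (gen i)) <= (ell w).+1)%N.
Proof.
by have [/ell_des ->|/ell_asc ->] := boolP (des (wn w) i); rewrite ?ltnS ?leqW.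
Qed.

Lemma wval_id i : wval (idSP n) i = i.+1%:Z.
Proof. by rewrite /wval /idSP /= ffunE perm1. Qed.

Lemma ell_id : ell (idSP n) = 0%N.
Proof.
rewrite /ell !big1 // => [i _|[a b] /= ab]; rewrite !wval_id; first by lia.
have -> : (b.+1%:Z < a.+1%:Z) = false by lia.
by have -> : (a.+1%:Z + b.+1%:Z < 0) = false by lia.
Qed.

(** Without descents the entries are positive and increasing, so the entry in each position is at
    least that position; equality of the sums over all positions forces equality everywhere. *)
Lemma no_des_id w : (forall i, ~~ des (wn w) i) -> w = idSP n.
Proof.
move=> nd.
have ge (k : nat) : (k < n)%N -> (k%:Z < wn w k.+1).
  elim: k => [|k IH] hk; have := nd (Ordinal hk); rewrite /des /=.
    have := @wn_nonz w 1%N hk; lia.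
  have := IH (ltnW hk).
  have : wn w k.+1 != wn w k.+2; last by lia.
  apply/eqP => e; have := @wn_inj_abs w k.+1 k.+2; rewrite e => /(_ _ _ erefl); lia.
have pos i : ~~ w.2 i.
  by rewrite -wval_neg -wn_val; have := ge i (ltn_ord i); lia.
have gep i : (i <= w.1 i)%N.
  have := ge i (ltn_ord i); rewrite wn_val /wval (negbTE (pos i)); lia.
have e1 i : w.1 i = i.
  have h : (\sum_(j : 'I_n) j <= \sum_(j : 'I_n) w.1 j ?= iff [forall j : 'I_n, (j : nat) == w.1 j])%N.
    by apply: leqif_sum => j _; split.
  have [_] := h.
  rewrite [X in _ == X](_ : _ = \sum_(j : 'I_n) j)%N ?eqxx.
    by move=> /esym/forallP/(_ i)/eqP/val_inj.
  by rewrite [RHS](reindex_inj (@perm_inj _ w.1)).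
apply: wval_inj => i; rewrite wval_id /wval e1 (negbTE (pos i)) //.
Qed.

Lemma word_of w : exists s, wordProd s = w /\ size s = ell w.
Proof.
have [m hm] := ubnP (ell w); elim: m w hm => // m IH w hm.
have [/forallP nd|] := boolP [forall i : 'I_n, ~~ des (wn w) i].
  by exists [::]; rewrite (no_des_id nd) ell_id.
rewrite negb_forall => /existsP[i]; rewrite negbK => d.
have e := ell_des d; have [|s [s1 s2]] := IH (mulSP w (gen i)); first by lia.
by exists (rcons s i); rewrite wordProd_rcons s1 gen_invol size_rcons s2.
Qed.

Lemma ell_wordProd (s : seq 'I_n) : (ell (wordProd s) <= size s)%N.
Proof.
elim/last_ind: s => [|s i IH]; first by rewrite /= ell_id.
by rewrite wordProd_rcons size_rcons; apply: leq_trans (ell_gen_le _ _) _.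
Qed.

Lemma reducedE (s : seq 'I_n) w :
  reducedWord s w <-> wordProd s = w /\ size s = ell w.
Proof.
split=> [[e h]|[e h]]; split => //.
  have [t [t1 t2]] := word_of w; apply/eqP; rewrite eqn_leq -{1}t2 h //=.
  by rewrite -e ell_wordProd.
by move=> t te; rewrite h -te ell_wordProd.
Qed.

Lemma reduced_rcons (s : seq 'I_n) i w :
  reducedWord (rcons s i) w <-> des (wn w) i /\ reducedWord s (mulSP w (gen i)).
Proof.
rewrite !reducedE wordProd_rcons size_rcons; split.
  case=> e h; have es : wordProd s = mulSP w (gen i) by rewrite -e gen_invol.
  have d : des (wn w) i.
    apply/negPn/negP => /ell_asc h2; have := ell_wordProd s; rewrite es; lia.
  by split => //; split => //; have := ell_des d; lia.
by case=> d [e h]; rewrite e gen_invol h (ell_des d).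
Qed.

Definition comm i j := mulSP (gen i) (gen j) = mulSP (gen j) (gen i).

Lemma comm_far i j : (i.+1 < j)%N -> comm i j.
Proof.
move=> ij; rewrite /comm -[gen i in LHS]mul1SP -[gen j in RHS]mul1SP.
apply: wn_inj => k hk; rewrite !wn_gen //.
rewrite (@eq_sw n _ (sw i (wn (idSP n)))) // => [|u hu]; last exact: wn_gen.
rewrite [RHS](@eq_sw n _ (sw j (wn (idSP n)))) // => [|u hu]; last exact: wn_gen.
exact: sw_comm.
Qed.

Lemma comm_sym i j : comm i j -> comm j i. Proof. exact: esym. Qed.

Lemma not_comm_adj i j : i.+1 = j :> nat -> ~ comm i j.
Proof.
move=> ij; rewrite /comm.
have j0 : (j == 0%N :> nat) = false by lia.
have pj : prevI j = i by apply/val_inj => /=; lia.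
have [i0|i0] := eqVneq (i : nat) 0%N => h.
  have := congr1 (fun w : SP n => w.2 j) h.
  by rewrite /mulSP /gen /= i0 j0 /= !ffunE ?pj ?tpermR /= ?i0 ?j0.
have := congr1 (fun w : SP n => w.1 j) h.
rewrite /mulSP /gen /= j0 (negbTE i0) /= !permM pj tpermR tpermR.
have -> : tperm (prevI i) i j = j.
  by rewrite tpermD //; apply/eqP => /(congr1 val) /=; lia.
by rewrite tpermR => /(congr1 val) /=; lia.
Qed.

(* Commutation classes of words are determined by the restrictions to pairs of noncommuting generators. *)
Definition rigid w := forall s t : seq 'I_n, reducedWord s w -> reducedWord t w ->
  forall i j, ~ comm i j -> filter (pred2 i j) s = filter (pred2 i j) t.

Lemma commEquiv_filter s t i j : commEquiv s t -> ~ comm i j ->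
  filter (pred2 i j) s = filter (pred2 i j) t.
Proof.
move=> + nc; elim=> // {}s {}t u [a [b [c [d [cd [-> ->]]]]]] _ <-.
rewrite !filter_cat; congr (_ ++ _) => /=.
have [/orP pc|_] := boolP ((c == i) || (c == j)); last by [].
have [/orP pd|_] := boolP ((d == i) || (d == j)); last by [].
by case: pc => /eqP ?; case: pd => /eqP ?; subst => //; case: nc; rewrite /comm cd.
Qed.

Lemma commEquiv_trans (s t r : seq (ordinal n)) : commEquiv s t -> commEquiv t r -> commEquiv s r.
Proof. by elim=> // {}s {}t r0 st _ IH h; apply: commEquiv_step st (IH h). Qed.

Lemma commStep_rcons (s t : seq 'I_n) i : commStep s t -> commStep (rcons s i) (rcons t i).
Proof.
case=> a [b [c [d [cd [-> ->]]]]]; exists a, (rcons b i), c, d.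
by rewrite !rcons_cat.
Qed.

Lemma commEquiv_rcons (s t : seq 'I_n) i :
  commEquiv s t -> commEquiv (rcons s i) (rcons t i).
Proof.
elim=> [u|u v x uv _ IH]; first exact: commEquiv_refl.
by apply: commEquiv_step IH; apply: commStep_rcons.
Qed.

Lemma FC_rigid w : fullyCommutative w -> rigid w.
Proof. by move=> fc s t hs ht i j nc; apply: commEquiv_filter nc; apply: fc. Qed.

Lemma rigid_gen w i : des (wn w) i -> rigid w -> rigid (mulSP w (gen i)).
Proof.
move=> d r s t hs ht a b nc.
have h := r (rcons s i) (rcons t i) _ _ a b nc.
have := h; rewrite !filter_rcons => h'.
have rs : reducedWord (rcons s i) w by apply/reduced_rcons.
have rt : reducedWord (rcons t i) w by apply/reduced_rcons.
by move: (h' rs rt); case: ifP => // _ /rcons_inj[].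
Qed.

(** Reduced words ending in [i] and in [j] have different restrictions to these two letters, since
    the last letters differ. *)
Lemma rigid_des w i j : rigid w -> des (wn w) i -> des (wn w) j -> i != j -> comm i j.
Proof.
move=> r di dj ij; apply: contrapT => nc.
have [s [s1 s2]] := word_of (mulSP w (gen i)).
have [t [t1 t2]] := word_of (mulSP w (gen j)).
have rs : reducedWord (rcons s i) w by apply/reduced_rcons; rewrite reducedE.
have rt : reducedWord (rcons t j) w by apply/reduced_rcons; rewrite reducedE.
have := r _ _ rs rt _ _ nc; rewrite !filter_rcons /= !eqxx orbT /= => /rcons_inj[_ e].
by rewrite e eqxx in ij.
Qed.

(** [bad_down] leads from a bad window to a shorter one, and rigidity is inherited; the descent
    stops at two noncommuting descents, which [rigid_des] forbids. *)
Lemma rigid_notBad w : rigid w -> ~ Bad n (wn w).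
Proof.
have [m hm] := ubnP (ell w); elim: m w hm => // m IH w hm r bad.
have [[l [l1 l2 l3]]|[l [l1 l2 l3]]] := bad_down (@wn_inj_abs w) (@wn_nonz w) bad.
  pose i := Ordinal (ltnW l1); pose j := Ordinal l1.
  have := @rigid_des w i j r l2 l3; rewrite -(inj_eq val_inj) /= => h.
  by apply: (@not_comm_adj i j erefl); apply: h; lia.
pose i := Ordinal l1.
apply: (IH (mulSP w (gen i))).
- have := @ell_des w i l2; lia.
- exact: rigid_gen.
- by apply: eq_Bad l3 => k hk; rewrite wn_gen.
Qed.

Lemma notBad_gen w i : des (wn w) i -> ~ Bad n (wn w) -> ~ Bad n (wn (mulSP w (gen i))).
Proof.
move=> d nb; apply: contra_not nb => b.
apply: (@eq_Bad n (sw i (wn (mulSP w (gen i))))).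
  by move=> k hk; rewrite -wn_gen // gen_invol.
apply: bad_asc b; [exact: wn_inj_abs | exact: wn_nonz | exact: ltn_ord |].
by rewrite des_gen negbK.
Qed.

Lemma notBad_des w i j : ~ Bad n (wn w) -> des (wn w) i -> des (wn w) j -> (i < j)%N ->
  (i.+1 < j)%N.
Proof.
move=> nb di dj ij; rewrite ltn_neqAle ij andbT; apply/eqP => e; apply: nb.
by apply: (@bad_of_des2 _ _ i) => //; rewrite e.
Qed.

Lemma des_far w i j : (i.+1 < j)%N ->
  (des (wn (mulSP w (gen i))) j = des (wn w) j) *
  (des (wn (mulSP w (gen j))) i = des (wn w) i).
Proof.
move=> ij; have hi := ltn_ord i; have hj := ltn_ord j.
have j0 : (j == 0%N :> nat) = false by lia.
split; rewrite /des ?j0.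
  rewrite !wn_gen; [|lia|lia].
  by rewrite /sw; split_ifs => //; lia.
rewrite wn_gen; last lia.
have -> : sw j (wn w) i.+1 = wn w i.+1 by rewrite /sw j0; split_ifs => //; lia.
case: ifP => // i0; rewrite wn_gen; last lia.
by have -> : sw j (wn w) i = wn w i by rewrite /sw j0; split_ifs => //; lia.
Qed.

(** A diamond argument: distinct last letters [i] and [j] are descents, hence far apart and
    commuting. A reduced word of the element with both removed, extended by [j], [i] or by [i], [j],
    links the two given words by induction. *)
Lemma notBad_FC w : ~ Bad n (wn w) -> fullyCommutative w.
Proof.
have [m hm] := ubnP (ell w); elim: m w hm => // m IH w hm nb s t.
elim/last_ind: s => [|s i _]; elim/last_ind: t => [|t j _].
- by move=> *; exact: commEquiv_refl.
- rewrite !reducedE => -[_ /= h0] [_]; rewrite size_rcons -h0 //.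
- rewrite !reducedE => -[_ h0] [_ /=]; rewrite -h0 size_rcons //.
move=> /reduced_rcons[di hs] /reduced_rcons[dj ht].
have hmi k : des (wn w) k -> (ell (mulSP w (gen k)) < m)%N.
  by move=> d; have := ell_des d; lia.
have nbi k : des (wn w) k -> ~ Bad n (wn (mulSP w (gen k))).
  by move=> d; apply: notBad_gen.
have [e|ij] := eqVneq i j.
  by subst j; apply/commEquiv_rcons/(IH _ (hmi _ di) (nbi _ di)).
have cij : comm i j /\ (des (wn (mulSP w (gen i))) j /\ des (wn (mulSP w (gen j))) i).
  have [h|h|/val_inj h] := ltngtP i j; last by rewrite h eqxx in ij.
    have f := notBad_des nb di dj h; split; first exact: comm_far.
    by rewrite !(des_far w f).
  have f := notBad_des nb dj di h; split; first exact/comm_sym/comm_far.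
  by rewrite !(des_far w f).
case: cij => cij [dij dji].
pose u := mulSP (mulSP w (gen i)) (gen j).
have ue : u = mulSP (mulSP w (gen j)) (gen i) by rewrite /u -!mulSPA cij.
have [r hr] := word_of u.
have r1 : reducedWord (rcons r j) (mulSP w (gen i)).
  by apply/reduced_rcons; split => //; apply/reducedE.
have r2 : reducedWord (rcons r i) (mulSP w (gen j)).
  by apply/reduced_rcons; split => //; apply/reducedE; rewrite -ue.
have c1 := commEquiv_rcons i (IH _ (hmi _ di) (nbi _ di) _ _ hs r1).
have c2 := commEquiv_rcons j (IH _ (hmi _ dj) (nbi _ dj) _ _ r2 ht).
apply: commEquiv_trans c1 _; apply: commEquiv_step c2.
exists r, [::], j, i; split; first exact/esym.
by rewrite -!cats1 -!catA.
Qed.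

Lemma FC_notBad w : fullyCommutative w <-> ~ Bad n (wn w).
Proof. by split=> [/FC_rigid/rigid_notBad|/notBad_FC]. Qed.

End Group.

(** * Structure of the pattern-avoiding windows *)

Section Pigeonhole.
Variables (n : nat) (f : nat -> nat).
Hypothesis f_range : forall p, (0 < p <= n)%N -> (0 < f p <= n)%N.
Hypothesis f_inj : forall p p', (0 < p <= n)%N -> (0 < p' <= n)%N -> f p = f p' -> p = p'.

Lemma map_inj_size (l : seq nat) (a b : nat) : uniq l ->
  (forall p, p \in l -> (0 < p <= n)%N) -> (forall p, p \in l -> (a < f p <= b)%N) ->
  (size l <= b - a)%N.
Proof.
move=> ul hl hf; rewrite -(size_map f) -[X in (_ <= X)%N](size_iota a.+1).
apply: uniq_leq_size.
  by rewrite map_inj_in_uniq // => p p' /hl hp /hl hp'; apply: f_inj.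
by move=> y /mapP[p /hf hp ->]; rewrite mem_iota; lia.
Qed.

(** Otherwise the [n - m] positions after [m], together with [r], would all take values in the
    [n - m] integers above [m]. *)
Lemma exceed_below (r m : nat) : (0 < r <= m)%N -> (m <= n)%N -> (m < f r)%N ->
  exists r', [/\ (m < r')%N, (r' <= n)%N & (f r' <= m)%N].
Proof.
move=> hr mn hf; apply: contrapT => nex.
have h r' : (m < r' <= n)%N -> (m < f r')%N.
  by move=> hr'; rewrite ltnNge; apply/negP => hle; apply: nex; exists r'; split; lia.
have := @map_inj_size (r :: iota m.+1 (n - m)) m n.
rewrite /= size_iota iota_uniq mem_iota; have -> : (m < r < m.+1 + (n - m))%N = false by lia.
move=> /(_ isT) H.
suff : ((n - m).+1 <= n - m)%N by lia.
apply: H => p; rewrite inE => /orP[/eqP -> //|]; rewrite ?mem_iota; try lia.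
  by have := @f_range r; lia.
by move=> hp; have := h p; have := @f_range p; lia.
Qed.

Lemma exceed_above (r m : nat) : (m < r <= n)%N -> (f r <= m)%N ->
  exists r', [/\ (0 < r')%N, (r' <= m)%N & (m < f r')%N].
Proof.
move=> hr hf; apply: contrapT => nex.
have h r' : (0 < r' <= m)%N -> (f r' <= m)%N.
  by move=> hr'; rewrite leqNgt; apply/negP => hle; apply: nex; exists r'; split; lia.
have := @map_inj_size (r :: iota 1 m) 0 m.
rewrite /= size_iota iota_uniq mem_iota; have -> : (0 < r < 1 + m)%N = false by lia.
move=> /(_ isT) H.
suff : (m.+1 <= m - 0)%N by lia.
apply: H => p; rewrite inE => /orP[/eqP -> //|]; rewrite ?mem_iota; try lia.
  by have := @f_range r; lia.
by move=> hp; have := h p; have := @f_range p; lia.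
Qed.

Lemma below_bound (p u : nat) : (0 < p <= n)%N ->
  (forall r, (0 < r < p)%N -> (f r < u)%N) -> (0 < u)%N -> (p <= u)%N.
Proof.
move=> hp h u0; have := @map_inj_size (iota 1 p.-1) 0 u.-1.
rewrite size_iota iota_uniq => /(_ isT) H.
suff : (p.-1 <= u.-1 - 0)%N by lia.
apply: H => r; rewrite mem_iota; first by lia.
by move=> hr; have := h r; have := @f_range r; lia.
Qed.

End Pigeonhole.

Definition isWindowFun n (g : nat -> int) :=
  (forall p, (0 < p <= n)%N -> (0 < `|g p| <= n)%N) /\
  (forall p p', (0 < p <= n)%N -> (0 < p' <= n)%N -> `|g p|%N = `|g p'|%N -> p = p').

Definition ClassI n (g : nat -> int) :=
  [/\ forall p p', (0 < p < p')%N -> (p' <= n)%N -> p%:Z < g p -> p'%:Z < g p' -> g p < g p',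
      forall p p', (0 < p < p')%N -> (p' <= n)%N -> g p <= p%:Z -> g p' <= p'%:Z -> g p < g p' &
      forall p k, (0 < p <= n)%N -> (0 < k <= n)%N -> p%:Z < g p -> g k < 0 -> - g k < g p].

(** Contained in both [bad1] and [bad3]. Unlike these it may occur in a fully commutative window,
    and it then forces the identity prefix. *)
Definition badQ n (g : nat -> int) :=
  exists i j : nat, [/\ (0 < i < j)%N, (j <= n)%N & g j < - `|g i|].

(** In each case a violation lets the pigeonhole lemmas supply the third entry of a [bad2], or is
    itself a [badQ]. *)
Lemma ClassI_of_avoid n g : isWindowFun n g -> ~ badQ n g -> ~ bad2 n g -> ClassI n g.
Proof.
move=> [gr gi] nq nb2.
have /= ph1 := exceed_below gr gi; have /= ph2 := exceed_above gr gi.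
have /= ph3 := below_bound gr gi.
split.
- move=> p p' hp hp' gp gp'; case: (ltP (g p) (g p')) => // hle; exfalso.
  have [||| r [r1 r2 r3]] := ph1 p' p'; try lia.
  have hne : g p != g p'.
    by apply/eqP => e; have := gi p p'; rewrite e => /(_ _ _ erefl); lia.
  by apply: nb2; exists p, p', r; split; lia.
- move=> p p' hp hp' gp gp'; case: (ltP (g p) (g p')) => // hle; exfalso.
  have hne : g p != g p'.
    by apply/eqP => e; have := gi p p'; rewrite e => /(_ _ _ erefl); lia.
  have gr0 := gr p. have gr0' := gr p'.
  have [neg|pos] := ltP (g p) 0; first by apply: nq; exists p, p'; split; lia.
  (* Avoiding [bad2] makes everything before [p] smaller in absolute value. As [p] is not an
     exceedance, its entry is then [p] itself, and the smaller entry at [p'] must lie below [-p], a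
     [badQ]. *)
  have h r : (0 < r < p)%N -> (`|g r|%N < `|g p|%N)%N.
    move=> hr; have hne2 : `|g r|%N != `|g p|%N.
      by apply/eqP => e; have := gi r p; rewrite e => /(_ _ _ erefl); lia.
    rewrite ltn_neqAle hne2 /= leqNgt; apply/negP => hlt.
    by apply: nb2; exists r, p, p'; split; lia.
  have := ph3 p `|g p|%N _ h; have hpp : (0 < p <= n)%N by lia.
  move=> /(_ hpp) hpu.
  have gpp : g p = p%:Z by lia.
  have hpp' : (p <= `|g p'|%N)%N.
    rewrite leqNgt; apply/negP => hlt.
    have [||r [r1 r2 r3]] := ph2 p' p.-1; try lia.
    by have := h r; lia.
  have hne3 : `|g p'|%N != `|g p|%N.
    by apply/eqP => e; have := gi p' p; rewrite e => /(_ _ _ erefl); lia.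
  by apply: nq; exists p, p'; split; lia.
- move=> p k hp hk gp gk; case: (ltP (- g k) (g p)) => // hle; exfalso.
  have hpk : p <> k by move=> e; subst; lia.
  have hne : `|g p|%N != `|g k|%N by apply/eqP => /(gi p k hp hk).
  have [pk|kp] := ltnP p k; first by apply: nq; exists p, k; split; lia.
  have [||| r [r1 r2 r3]] := ph1 p p; try lia.
  by apply: nb2; exists k, p, r; split; lia.
Qed.

Lemma ClassI_avoid n g : ClassI n g -> ~ badQ n g /\ ~ bad2 n g.
Proof.
case=> c1 c2 c3; split.
  case=> i [j [h1 h2 h3]].
  have [hi|hi] := ltP (i%:Z) (g i).
    by have := c3 i j; lia.
  by have := c2 i j; lia.
case=> i [j [k [h1 h2 h3 h4]]].
have hj : j%:Z < g j.
  rewrite ltNge; apply/negP => hj.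
  by have := c2 j k; lia.
have [hi|hi] := ltP (i%:Z) (g i); first by have := c1 i j; lia.
by have := c3 j i; lia.
Qed.

Lemma ClassI_notBad n g : ClassI n g -> ~ Bad n g.
Proof.
move=> /ClassI_avoid[nq nb2] [[i [j [h1 h2 h3 h4]]]|//|[i [j [k [h1 h2 h3 h4]]]]].
  by apply: nq; exists i, j; split; lia.
by apply: nq; exists i, j; split; lia.
Qed.

Definition dsh (j : nat) (y : int) : int := if y < 0 then y + j%:Z else y - j%:Z.

Definition one_neg n (g : nat -> int) := exists k, [/\ (0 < k <= n)%N, g k < 0 &
  forall k', (0 < k' <= n)%N -> g k' < 0 -> k' = k].

Definition shifted n j g :=
  [/\ (0 < j < n)%N, forall p, (0 < p <= j)%N -> g p = p%:Z,
      ClassI (n - j) (fun p => dsh j (g (j + p)%N)) &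
      one_neg (n - j) (fun p => dsh j (g (j + p)%N))].

(** A [badQ] pair ending at [k] has a negative second entry. Avoiding [bad1] and [bad3] then leaves
    no room for another negative entry, nor for anything but fixed points at the small positions
    before [k]. *)
Lemma notBad_cases n g : isWindowFun n g -> ~ Bad n g ->
  ClassI n g \/ exists j, shifted n j g.
Proof.
move=> wf nb; have [gr gi] := wf.
have /= ph1 := exceed_below gr gi; have /= ph2 := exceed_above gr gi.
have /= ph3 := below_bound gr gi.
have nb1 : ~ bad1 n g by move=> h; apply: nb; constructor 1.
have nb2 : ~ bad2 n g by move=> h; apply: nb; constructor 2.
have nb3 : ~ bad3 n g by move=> h; apply: nb; constructor 3.
case: (pselect (badQ n g)) => [|nq]; last by left; apply: ClassI_of_avoid.
case=> [p0 [k [hp0 hk hq]]]; right.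
have ne p p' : (0 < p <= n)%N -> (0 < p' <= n)%N -> p <> p' -> `|g p|%N <> `|g p'|%N.
  by move=> h1 h2 h3 /(gi p p' h1 h2).
(* The positions before [k] with entry smaller than [- g k] in absolute value form an initial segment
   fixed by [g]. *)
pose small p := (0 < p < k)%N && (`|g p|%N < `|g k|%N)%N.
have smallP p : small p -> [/\ g p = p%:Z, forall r, (0 < r < p)%N -> (`|g r|%N < p)%N &
    forall r, (p < r <= n)%N -> r <> k -> p%:Z < g r].
  move=> /andP[hp hs].
  have gp0 : 0 < g p.
    have := gr p; rewrite ltNge => H; apply/negP => hle.
    by apply: nb1; exists p, k; split; lia.
  have hbig r : (p < r <= n)%N -> r <> k -> g p < g r.
    move=> hr hrk; case: (ltP (g p) (g r)) => // hle; exfalso.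
    have n1 := ne p r; have n2 := ne r k.
    have [rk|kr] := ltnP r k; last by apply: nb3; exists p, k, r; split; lia.
    have [h|h] := ltP (g k) (g r); first by apply: nb2; exists p, r, k; split; lia.
    by apply: nb3; exists p, r, k; split; lia.
  have hless r : (0 < r < p)%N -> (`|g r|%N < `|g p|%N)%N.
    move=> hr; rewrite ltnNge; apply/negP => hle; have n1 := ne p r.
    by apply: nb2; exists r, p, k; split; lia.
  have h1 : (p <= `|g p|%N)%N by apply: ph3 => //; lia.
  have h2 : (`|g p|%N <= p)%N.
    rewrite leqNgt; apply/negP => hlt.
    have [||| r [r1 r2 r3]] := ph1 p p; try lia.
    have n1 := ne p r; have [e|rk] := eqVneq r k; first by subst; lia.
    by have := hbig r; lia.
  have gpp : g p = p%:Z by lia.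
  by split=> // r hr; [have := hless r; lia | have := hbig r; lia].
have sp0 : small p0 by rewrite /small; lia.
(* The last small position is the length of the prefix; by maximality no [badQ] is left after it. *)
have [j [hj jmax]] : exists j, small j /\ forall p, small p -> (p <= j)%N.
  have ex : exists p, small p by exists p0.
  have ub p : small p -> (p <= k)%N by rewrite /small; lia.
  case: (ex_maxnP ex ub) => j h1 h2; by exists j.
have [gj jless jbig] := smallP j hj.
have jk : (0 < j < k)%N by case/andP: hj.
have gkj : (j < `|g k|%N)%N by case/andP: hj => _; rewrite gj.
have gk0 : g k < 0 by lia.
exists j; split; first by lia.
- move=> p hp; have [->//|pj] := eqVneq p j.
  have sp : small p by rewrite /small; have := jless p; lia.
  by have [] := smallP p sp.
- have dk r : (0 < r <= n - j)%N -> (j + r)%N <> k -> dsh j (g (j + r)%N) = g (j + r)%N - j%:Z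
      /\ j%:Z < g (j + r)%N.
    by move=> hr hrk; have := jbig (j + r)%N; rewrite /dsh; split_ifs; lia.
  have dk' : dsh j (g k) = g k + j%:Z by rewrite /dsh gk0.
  apply: ClassI_of_avoid.
  + split=> [r hr|r r' hr hr'].
      have := gr (j + r)%N; have [e|e] := eqVneq (j + r)%N k.
        by rewrite e dk'; lia.
      by have := dk r hr; lia.
    have [e|e] := eqVneq (j + r)%N k; have [e'|e'] := eqVneq (j + r')%N k.
    * lia.
    * have := dk r' hr'; have := ne (j + r')%N k; rewrite e dk'; lia.
    * have := dk r hr; have := ne (j + r)%N k; rewrite e' dk'; lia.
    * have := dk r hr; have := dk r' hr'; have := ne (j + r)%N (j + r')%N; lia.
  + case=> i [i' [h1 h2 h3]].
    have [e'|e'] := eqVneq (j + i')%N k; last by have := dk i'; lia.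
    have : small (j + i)%N.
      by rewrite /small; have := dk i; rewrite e' dk' in h3; lia.
    by move/jmax; lia.
  + case=> i [i' [i'' [h1 h2 h3 h4]]]; apply: nb2.
    exists (j + i)%N, (j + i')%N, (j + i'')%N.
    have d1 := dk i; have d2 := dk i'; have d3 := dk i''.
    have [e|e] := eqVneq (j + i)%N k.
      by rewrite e dk' in h4; split; rewrite ?e; lia.
    have [e'|e'] := eqVneq (j + i')%N k.
      by rewrite e' dk' in h3 h4; lia.
    have [e''|e''] := eqVneq (j + i'')%N k.
      by rewrite e'' dk' in h3; split; rewrite ?e''; lia.
    by split; lia.
- exists (k - j)%N; have e : (j + (k - j))%N = k by lia.
  rewrite e /dsh gk0; split; [lia | lia |].
  move=> k' hk'; have := jbig (j + k')%N; split_ifs; lia.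
Qed.

Lemma shifted_notBad n j g : isWindowFun n g -> shifted n j g -> ~ Bad n g.
Proof.
move=> [gr gi] [hj hpre /ClassI_avoid[nq nb2] [k [hk gk uk]]].
have /= ph2 := exceed_above gr gi.
have big p : (j < p <= n)%N -> (j < `|g p|%N)%N.
  move=> hp; rewrite ltnNge; apply/negP => hle.
  have [||r [r1 r2 r3]] := ph2 p j; try lia.
  by have := hpre r; lia.
have neg p : (0 < p <= n)%N -> g p < 0 -> p = (j + k)%N.
  move=> hp gp; have [pj|jp] := leqP p j; first by have := hpre p; lia.
  have := uk (p - j)%N; have := big p; rewrite /dsh.
  have -> : (j + (p - j) = p)%N by lia.
  by rewrite gp; lia.
case=> [[i [i' [h1 h2 h3 h4]]]|[i [i' [i'' [h1 h2 h3 h4]]]]|[i [i' [i'' [h1 h2 h3 h4]]]]].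
- by have := neg i; have := neg i'; lia.
- have [ij|ji] := leqP i j.
    have := hpre i; have := hpre i'; have := hpre i''; have := big i'; have := big i''.
    have := neg i'; have := neg i''; lia.
  apply: nb2; exists (i - j)%N, (i' - j)%N, (i'' - j)%N.
  rewrite /dsh; have -> : (j + (i - j) = i)%N by lia.
  have -> : (j + (i' - j) = i')%N by lia. have -> : (j + (i'' - j) = i'')%N by lia.
  have := big i; have := big i'; have := big i''.
  by split; split_ifs; lia.
- have e' := neg i'; have [ij|ji] := leqP i j.
    by have := hpre i; have := big i''; have := neg i''; lia.
  apply: nq; exists (i - j)%N, (i' - j)%N; rewrite /dsh.
  have -> : (j + (i - j) = i)%N by lia. have -> : (j + (i' - j) = i')%N by lia.
  have := big i; have := big i'.
  by split; split_ifs; lia.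
Qed.

(** * Windows from pairs of subsets *)

Local Close Scope ring_scope.

Definition cnt (X : seq bool) (p : nat) : nat := count id (take p X).
Definition posT (X : seq bool) : seq nat := mask X (iota 1 (size X)).
Definition posF (X : seq bool) : seq nat := posT (map negb X).

Fixpoint shuf (T : Type) (x0 : T) (A : seq bool) (U L : seq T) : seq T :=
  match A with
  | [::] => [::]
  | true :: A' => head x0 U :: shuf x0 A' (behead U) L
  | false :: A' => head x0 L :: shuf x0 A' U (behead L)
  end.

Lemma cnt0 X : cnt X 0 = 0. Proof. by rewrite /cnt take0. Qed.

Lemma cnt_cons b X p : cnt (b :: X) p.+1 = b + cnt X p. Proof. by []. Qed.

Lemma cntS X p : cnt X p.+1 = cnt X p + nth false X p.
Proof.
elim: X p => [|b X IH] [|p] //=; first by rewrite /cnt /= take0 /= addn0.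
by move: (IH p); rewrite /cnt /= -addnA => ->.
Qed.

Lemma cnt_le X p : cnt X p <= p.
Proof. by elim: p => [|p IH]; rewrite ?cnt0 // cntS; case: nth; lia. Qed.

Lemma cnt_mono X p p' : p <= p' -> cnt X p <= cnt X p'.
Proof.
move=> h; have -> : p' = p + (p' - p) by lia.
by elim: (p' - p) => [|k IH]; rewrite ?addn0 // addnS cntS; lia.
Qed.

Lemma cnt_sub X p p' : p <= p' -> cnt X p' <= cnt X p + (p' - p).
Proof.
move=> h; have -> : p' = p + (p' - p) by lia.
rewrite addKn.
elim: (p' - p) => [|k IH]; rewrite ?addn0 // addnS cntS; case: nth; lia.
Qed.

Lemma cnt_size X p : size X <= p -> cnt X p = count id X.
Proof. by move=> h; rewrite /cnt take_oversize. Qed.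

Lemma cnt_max X p : cnt X p <= count id X.
Proof. by rewrite /cnt -{2}(cat_take_drop p X) count_cat leq_addr. Qed.

Lemma cnt_neg X p : p <= size X -> cnt (map negb X) p = p - cnt X p.
Proof.
move=> h; elim: p h => [|p IH] h; rewrite ?cnt0 // !cntS IH ?(nth_map false) //; last by lia.
by have := cnt_le X p; case: nth => /=; lia.
Qed.

Lemma size_posT X : size (posT X) = count id X.
Proof. by rewrite /posT size_mask ?size_iota. Qed.

Lemma count_negb X : count id (map negb X) = size X - count id X.
Proof. by rewrite -(@cnt_size _ (size X)) ?size_map // cnt_neg // cnt_size. Qed.

(** A Galois connection between ranks and counts. It turns every comparison with an entry of the
    window into a comparison with a count of the subset. *)
Lemma nth_posT X k i : k < count id X -> (nth 0 (posT X) k <= i) = (k < cnt X i).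
Proof.
rewrite /posT; suff h m : k < count id X ->
    (nth 0 (mask X (iota m.+1 (size X))) k <= m + i) = (k < cnt X i).
  by move=> hk; rewrite -(h 0 hk).
elim: X k m i => [|b X IH] k m i //= hk.
have big k' : k' < count id X -> m.+1 < nth 0 (mask X (iota m.+2 (size X))) k'.
  by move=> hk'; have := IH k' m.+1 0 hk'; rewrite cnt0; lia.
case: i => [|i].
  rewrite cnt0; case: b hk => hk; last by have := big k hk; lia.
  case: k hk => [|k] hk; rewrite /=; first by lia.
  by have := big k; lia.
rewrite cnt_cons addnS -addSn; case: b hk => hk; last by rewrite add0n IH.
case: k hk => [|k] hk; rewrite /=; first by lia.
by rewrite IH //; lia.
Qed.

Lemma mem_mask_iota X m u :
  (u \in mask X (iota m (size X))) = (m <= u) && nth false X (u - m).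
Proof.
elim: X m => [|b X IH] m /=; first by rewrite nth_nil andbF.
have [e|ne] := eqVneq u m.
  rewrite e in IH *; by rewrite subnn leqnn /=; case: b; rewrite ?inE ?eqxx // IH ltnn.
have -> : (u \in (if b then m :: mask X (iota m.+1 (size X)) else mask X (iota m.+1 (size X))))
    = (u \in mask X (iota m.+1 (size X))) by case: b; rewrite // inE (negbTE ne).
rewrite IH; have [h|h] := ltnP m u.
  have -> : u - m = (u - m.+1).+1 by lia.
  by have -> : m <= u by lia.
by have -> : (m <= u) = false by lia.
Qed.

Lemma mem_posT X u : (u \in posT X) = (0 < u) && nth false X u.-1.
Proof. by rewrite mem_mask_iota subn1. Qed.

Lemma posT_uniq X : uniq (posT X).
Proof. by rewrite mask_uniq ?iota_uniq. Qed.

Lemma size_shuf (T : Type) (x0 : T) A U L : size (shuf x0 A U L) = size A.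
Proof. by elim: A U L => [|[] A IH] U L //=; rewrite IH. Qed.

Lemma nth_shuf (T : Type) (x0 : T) A U L p : p < size A ->
  nth x0 (shuf x0 A U L) p =
  if nth false A p then nth x0 U (cnt A p) else nth x0 L (p - cnt A p).
Proof.
elim: A U L p => [|b A IH] U L p //=; case: p => [|p] hp.
  by rewrite cnt0; case: b; rewrite /= nth0.
rewrite {1}/cnt /= -/(cnt A p) ltnS in hp *.
have := cnt_le A p.
case: b => /= hc; rewrite IH // nth_behead.
  by rewrite /cnt /= add1n subSS.
by rewrite /cnt /= add0n subSn.
Qed.

Lemma shuf_mask (T : Type) (x0 : T) A (s : seq T) : size A = size s ->
  shuf x0 A (mask A s) (mask (map negb A) s) = s.
Proof. by elim: A s => [|[] A IH] [|x s] //= [] /IH ->. Qed.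

Lemma perm_shuf (T : eqType) (x0 : T) A U L :
  size U = count id A -> size L = size A - count id A ->
  perm_eq (shuf x0 A U L) (U ++ L).
Proof.
elim: A U L => [|b A IH] U L /=.
  by move=> /size0nil -> /size0nil ->.
have := count_size id A.
case: b => /= hA; rewrite ?add1n ?add0n ?subSS.
  case: U => // x U [hU] hL /=; rewrite perm_cons; exact: IH.
move=> hU; rewrite subSn //; case: L => // x L [hL] /=.
rewrite -cat_rcons -cats1 -catA perm_sym perm_catCA perm_sym /= perm_cons.
exact: IH.
Qed.

Lemma mem_posF X u : (u \in posF X) = (0 < u <= size X) && ~~ nth false X u.-1.
Proof.
rewrite mem_posT; have [h|h] := ltnP u.-1 (size X).
  rewrite (nth_map false) //; case: u h => //= u h.
  by rewrite h.
rewrite !nth_default ?size_map // andbT andbF.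
by case: u h => //= u h; have -> : (u < size X) = false by lia.
Qed.

Lemma perm_posTF X : perm_eq (posT X ++ posF X) (iota 1 (size X)).
Proof.
apply: uniq_perm; last 1 first.
- move=> u; rewrite mem_cat mem_posT mem_posF mem_iota.
  case: u => //= u; rewrite add1n !ltnS; have [h|h] := ltnP u (size X).
    by case: nth.
  by rewrite nth_default.
- rewrite cat_uniq !posT_uniq andbT /=; apply/hasPn => u; rewrite mem_posF mem_posT.
  by move=> /andP[_ /negbTE ->]; rewrite andbF.
- exact: iota_uniq.
Qed.

Lemma cnt_surj X k : k < count id X ->
  exists p, [/\ p < size X, nth false X p & cnt X p = k].
Proof.
elim: X k => [|b X IH] k //= hk; case: b hk => /= hk.
  case: k hk => [|k] hk; first by exists 0.
  have [|p [p1 p2 p3]] := IH k; first by lia.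
  by exists p.+1; rewrite cnt_cons p3.
have [p [p1 p2 p3]] := IH k hk.
by exists p.+1; rewrite cnt_cons p3.
Qed.

Section Psi.
Variables (A V : seq bool).
Local Notation n := (size A).
Let c := count id V - count id A.

(* The exceedances take the [#A] largest values of [V]; the others are the negatives of the remaining
   values of [V], followed by the complement of [V]. *)
Definition PsiU : seq int := map Posz (drop c (posT V)).
Definition PsiL : seq int :=
  map (fun u => - Posz u)%R (rev (take c (posT V))) ++ map Posz (posF V).
Definition Psi : seq int := shuf 0%R A PsiU PsiL.

Hypothesis sizeV : size V = n.
Hypothesis leAV : count id A <= count id V.

Let cE : c + count id A = count id V. Proof. by rewrite /c; lia. Qed.
Let leVn : count id V <= n. Proof. by rewrite -sizeV count_size. Qed.
Let leAn : count id A <= n. Proof. exact: count_size. Qed.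

Lemma size_Psi : size Psi = n. Proof. exact: size_shuf. Qed.

Let a p := cnt A p.
Let v p := cnt V p.
Local Notation g p := (nth 0%R Psi p).
Local Notation isA p := (nth false A p).

Lemma a_lt p : isA p -> a p < count id A.
Proof. by move=> h; have := cnt_max A p.+1; rewrite cntS h -/(a p); lia. Qed.

Lemma na_lt p : p < n -> ~~ isA p -> p - a p < n - count id A.
Proof.
move=> hp h; have := cnt_max (map negb A) p.+1.
rewrite cntS count_negb cnt_neg ?(nth_map false) ?h //=; last by lia.
rewrite -/(a p); lia.
Qed.

Lemma g_up p : p < n -> isA p -> g p = nth 0 (posT V) (c + a p).
Proof.
move=> hp h; rewrite nth_shuf // h (nth_map 0); first by rewrite nth_drop.
by rewrite size_drop size_posT; have := a_lt h; rewrite /a; lia.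
Qed.

Lemma g_neg p : p < n -> ~~ isA p -> p - a p < c ->
  g p = (- Posz (nth 0 (posT V) (c - (p - a p).+1)))%R.
Proof.
move=> hp h hc; have ts : size (take c (posT V)) = c.
  by rewrite size_take size_posT; case: ifP; lia.
rewrite nth_shuf // (negbTE h) /PsiL nth_cat size_map size_rev ts -/(a p) hc.
rewrite (nth_map 0) ?size_rev ?ts // nth_rev ?ts // nth_take //; lia.
Qed.

Lemma g_low p : p < n -> ~~ isA p -> c <= p - a p ->
  g p = nth 0 (posF V) (p - a p - c).
Proof.
move=> hp h hc; have ts : size (take c (posT V)) = c.
  by rewrite size_take size_posT; case: ifP; lia.
rewrite nth_shuf // (negbTE h) /PsiL nth_cat size_map size_rev ts -/(a p).
rewrite ltnNge hc /= (nth_map 0) // size_posT count_negb sizeV.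
by have := na_lt hp h; lia.
Qed.

(** Here and in [T2], [T3] the three sorts of entries (exceedances, negatives, the rest) are located
    by their rank in [V] or in its complement. *)
Lemma T1 p i : p < n -> isA p -> (`|g p| <= i) = (c + a p < v i).
Proof.
move=> hp h; rewrite g_up // absz_nat nth_posT //.
by have := a_lt h; lia.
Qed.

Lemma T2 p i : p < n -> ~~ isA p -> p - a p < c ->
  (`|g p| <= i) = (c - (p - a p).+1 < v i).
Proof. by move=> hp h hc; rewrite g_neg // abszN absz_nat nth_posT //; lia. Qed.

Lemma T3 p i : p < n -> ~~ isA p -> c <= p - a p -> i <= n ->
  (`|g p| <= i) = (p - a p - c < i - v i).
Proof.
move=> hp h hc hi; rewrite g_low // absz_nat nth_posT.
  by rewrite cnt_neg // sizeV.
by rewrite count_negb sizeV; have := na_lt hp h; lia.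
Qed.

Lemma perm_Psi : perm_eq (map absz Psi) (iota 1 n).
Proof.
have hp : perm_eq Psi (PsiU ++ PsiL).
  apply: perm_shuf; rewrite ?size_cat !size_map ?size_rev ?size_drop ?size_posT //.
    by lia.
  rewrite size_take size_posT count_negb sizeV; case: ifP; lia.
apply: perm_trans (perm_map absz hp) _.
rewrite -sizeV; apply: perm_trans _ (perm_posTF V).
rewrite map_cat /PsiU /PsiL map_cat -!map_comp.
rewrite !(eq_map (_ : _ =1 id)) => [|u|u|u]; rewrite ?map_id /= ?abszN //.
rewrite catA perm_cat2r perm_catC -[X in perm_eq _ X](cat_take_drop c).
by rewrite perm_cat2r perm_rev.
Qed.

Lemma valid_of_up : (forall p, p < n -> isA p = (Posz p.+1 < g p)%R) ->
  forall p, p < n -> v p.+1 <= c + a p.+1 /\ (isA p -> v p.+1 < c + a p.+1).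
Proof.
move=> up p hp; have e := up p hp.
have aS : a p.+1 = a p + isA p by exact: cntS.
have ap : a p <= p by exact: cnt_le.
have vp : v p.+1 <= p.+1 by exact: cnt_le.
have [h|h] := boolP (isA p).
  rewrite h in e aS; have := T1 p.+1 hp h; rewrite /= in aS *.
  by move: e; rewrite g_up // absz_nat; lia.
rewrite (negbTE h) /= in e aS; split=> //.
have [hc|hc] := ltnP (p - a p) c; first by lia.
have := T3 (i := p.+1) hp h hc hp.
by move: e; rewrite g_low // absz_nat; lia.
Qed.

Hypothesis valid : forall p, p < n ->
  v p.+1 <= c + a p.+1 /\ (isA p -> v p.+1 < c + a p.+1).

Let aS p : a p.+1 = a p + isA p. Proof. exact: cntS. Qed.
Let vS p : v p.+1 = v p + nth false V p. Proof. exact: cntS. Qed.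
Let a_le p : a p <= p. Proof. exact: cnt_le. Qed.
Let v_le p : v p <= p. Proof. exact: cnt_le. Qed.

Lemma up_exceeds p : p < n -> (isA p = (Posz p.+1 < g p)%R).
Proof.
move=> hp; have [v1 v2] := valid hp; have := aS p; have [h|h] /= := boolP (isA p) => ha.
  have := T1 p.+1 hp h; rewrite (g_up hp h) absz_nat.
  by move: (v2 h); rewrite -/(v _); lia.
have [hc|hc] := ltnP (p - a p) c.
  by rewrite g_neg //; lia.
have := T3 (i := p.+1) hp h hc hp; rewrite (g_low hp h hc) absz_nat -/(v _).
have := a_le p; have := v_le p.+1; lia.
Qed.

Lemma low_neg p : p < n -> (g p < 0)%R = ~~ isA p && (p - a p < c).
Proof.
move=> hp; have [h|h] /= := boolP (isA p); first by rewrite g_up.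
have [hc|hc] := ltnP (p - a p) c; last by rewrite g_low.
rewrite g_neg //; have := T2 0 hp h hc; rewrite /v cnt0 g_neg // abszN absz_nat; lia.
Qed.

Lemma v_step i : v i <= v i.-1 + 1.
Proof. by case: i => [|i]; [rewrite /v cnt0 | rewrite vS /=; case: (nth _ _ _); lia]. Qed.

Lemma Psi_range p : p < n -> 0 < `|g p| <= n.
Proof.
move=> hp; have : `|g p| \in map absz Psi.
  by apply/mapP; exists (g p) => //; rewrite mem_nth ?size_Psi.
by rewrite (perm_mem perm_Psi) mem_iota; lia.
Qed.

Lemma Psi_inj p p' : p < n -> p' < n -> `|g p| = `|g p'| -> p = p'.
Proof.
move=> hp hp' e; apply/eqP; rewrite -(nth_uniq 0 (s := map absz Psi)) ?size_map ?size_Psi //.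
  by rewrite !(nth_map 0%R) ?size_Psi // e.
by rewrite (perm_uniq perm_Psi) iota_uniq.
Qed.

Lemma abs_lt_of_rank p p' r r' : p < n -> p' < n -> r < r' ->
  (forall i, i <= n -> (`|g p| <= i) = (r < v i)) ->
  (forall i, i <= n -> (`|g p'| <= i) = (r' < v i)) -> `|g p| < `|g p'|.
Proof.
move=> hp hp' rr h h'; rewrite ltnNge; apply/negP => hle.
have := Psi_range hp; have := Psi_range hp' => b b'.
have h1 := h `|g p|; have h2 := h `|g p|.-1; have h3 := h' `|g p|.
by have := v_step `|g p|; lia.
Qed.

Lemma up_mono p p' : p < p' -> p' < n -> isA p -> isA p' -> (g p < g p')%R.
Proof.
move=> pp hp' h h'; have hp : p < n by lia.
have ha : a p.+1 <= a p' by apply: cnt_mono.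
have : `|g p| < `|g p'|.
  apply: (@abs_lt_of_rank p p' (c + a p) (c + a p')) => // [|i _|i _].
  - by have := aS p; rewrite h; lia.
  - exact: T1.
  - exact: T1.
by rewrite !g_up //; lia.
Qed.

Lemma na_mono p p' : p < p' -> p' <= n -> ~~ isA p -> p - a p < p' - a p'.
Proof.
move=> pp hp' h; have := @cnt_sub A p.+1 p' pp; have := aS p; have := a_le p.
by have := a_le p'; rewrite (negbTE h) -!/(a _); lia.
Qed.

Lemma low_mono p p' : p < p' -> p' < n -> ~~ isA p -> ~~ isA p' -> (g p < g p')%R.
Proof.
move=> pp hp' h h'; have hp : p < n by lia.
have hk := na_mono pp (ltnW hp') h.
have nn := low_neg hp; have nn' := low_neg hp'; rewrite h /= in nn; rewrite h' /= in nn'.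
have [hc|hc] := ltnP (p - a p) c; last first.
  have hc' : c <= p' - a p' by lia.
  have rg := Psi_range hp; have rg' := Psi_range hp'.
  have : `|g p| < `|g p'|.
    rewrite ltnNge; apply/negP => hle.
    have h1 := T3 (i := `|g p|) hp h hc; have h2 := T3 (i := `|g p|.-1) hp h hc.
    have h3 := T3 (i := `|g p|) hp' h' hc'.
    by have := v_step `|g p|; have := v_le `|g p|; have := v_le `|g p|.-1;
       have := @cnt_mono V `|g p|.-1 `|g p|; rewrite -!/(v _); lia.
  by rewrite !g_low //; lia.
have [hc'|hc'] := ltnP (p' - a p') c; last first.
  by move: nn nn'; rewrite hc [in X in _ -> X -> _]ltnNge hc' /=; lia.
have : `|g p'| < `|g p|.
  apply: (@abs_lt_of_rank p' p (c - (p' - a p').+1) (c - (p - a p).+1)) => // [|i _|i _].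
  - lia.
  - exact: T2.
  - exact: T2.
by move: nn nn'; rewrite hc hc'; move: (g p) (g p') => x y; lia.
Qed.

Lemma neg_lt_up p k : p < n -> k < n -> isA p -> (g k < 0)%R -> (- g k < g p)%R.
Proof.
move=> hp hk h gk; have := gk; rewrite low_neg // => /andP[h' hc].
have : `|g k| < `|g p|.
  apply: (@abs_lt_of_rank k p (c - (k - a k).+1) (c + a p)) => // [|i _|i _].
  - lia.
  - exact: T2.
  - exact: T1.
by rewrite (g_up hp h); lia.
Qed.

Lemma abs_mem_V p : p < n ->
  nth false V `|g p|.-1 = isA p || (g p < 0)%R.
Proof.
move=> hp; have rg := Psi_range hp.
have inT : `|g p| \in posT V -> nth false V `|g p|.-1 by rewrite mem_posT => /andP[].
have [h|h] /= := boolP (isA p).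
  apply: inT; rewrite g_up // absz_nat mem_nth // size_posT.
  by have := a_lt h; rewrite -/(a _); lia.
rewrite low_neg // h /=; have [hc|hc] := ltnP (p - a p) c.
  by apply: inT; rewrite g_neg // abszN absz_nat mem_nth // size_posT; lia.
have : `|g p| \in posF V; last by rewrite mem_posF => /andP[_ /negbTE].
rewrite g_low // absz_nat mem_nth // size_posT count_negb sizeV.
by have := na_lt hp h; rewrite -/(a _); lia.
Qed.

(** The value of the inverse signed permutation at the absolute value of entry [p]. *)
Definition spos p : int := if (g p < 0)%R then (- Posz p.+1)%R else Posz p.+1.

(** If [v i = c + a i], the number [i] separates the signed positions of the entries of absolute
    value at most [i] from those of the others. If [v i = i], the former are all negatives or
    exceedances and the ranks alone order them. *)
Lemma split_iff i : 0 < i <= n ->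
  (forall p p', p < n -> p' < n -> `|g p| <= i -> i < `|g p'| -> (spos p < spos p')%R)
  <-> v i = c + a i \/ v i = i.
Proof.
move=> hi; have hin : i <= n by lia.
have va : v i <= c + a i by case: i hi hin => // i hi _; case: (@valid i).
have sposA p : p < n -> isA p -> spos p = p.+1.
  by move=> hp h; rewrite /spos low_neg // h.
have sposN p : p < n -> ~~ isA p -> p - a p < c -> (spos p = - Posz p.+1)%R.
  by move=> hp h hc; rewrite /spos low_neg // h hc.
have sposL p : p < n -> ~~ isA p -> c <= p - a p -> spos p = p.+1.
  by move=> hp h hc; rewrite /spos low_neg // h ltnNge hc.
split; last first.
  case=> hv p p' hp hp' h1; rewrite ltnNge => h2.
    have l1 : (spos p <= Posz i)%R.
      have [h|h] := boolP (isA p).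
        rewrite sposA //; rewrite T1 // hv in h1.
        by have := @cnt_mono A i p; rewrite -!/(a _); lia.
      have [hc|hc] := ltnP (p - a p) c; first by rewrite sposN //; lia.
      rewrite sposL //; rewrite T3 // hv in h1.
      have := @na_mono i p; have := @cnt_sub A i p; have := @cnt_mono A i p.
      by have := a_le i; have := a_le p; rewrite -!/(a _); lia.
    have l2 : (Posz i < spos p')%R.
      have [h|h] := boolP (isA p').
        rewrite sposA //; rewrite T1 // hv in h2.
        by have := @cnt_mono A p'.+1 i; have := aS p'; rewrite h -!/(a _); lia.
      have [hc|hc] := ltnP (p' - a p') c.
        by rewrite T2 // hv in h2; lia.
      rewrite sposL //; rewrite T3 // hv in h2.
      by have := @na_mono p' i; have := a_le i; have := a_le p'; lia.
    lia.
  have [h|h] := boolP (isA p); last first.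
    have [hc|hc] := ltnP (p - a p) c; last by rewrite T3 // hv in h1; lia.
    rewrite sposN //; have [h'|h'] := boolP (isA p'); first by rewrite sposA.
    have [hc'|hc'] := ltnP (p' - a p') c; last by rewrite sposL.
    rewrite sposN //; rewrite T2 // in h1; rewrite T2 // in h2.
    have [e|ne] := eqVneq p p'; first by move: h2; rewrite -e h1.
    by have := @na_mono p p'; lia.
  rewrite T1 // hv in h1; rewrite sposA //; have [h'|h'] := boolP (isA p').
    rewrite sposA //; rewrite T1 // hv in h2.
    by have := @cnt_mono A p' p; rewrite -!/(a _); lia.
  have [hc|hc] := ltnP (p' - a p') c; first by rewrite T2 // hv in h2; lia.
  rewrite sposL //; have [pp|pp] := ltnP p p'; first by lia.
  have ne : p <> p' by move=> e; rewrite e (negbTE h') in h.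
  have np : c < p - a p by have := @na_mono p' p; lia.
  have [_ /(_ h) v2] := @valid p hp.
  have h3 := @cnt_mono V (c + a p).+1 p.+1; have h4 := @cnt_sub V (c + a p).+1 i.
  by have := aS p; have := a_le p; rewrite h -!/(v _) in h3 h4 *; lia.
move=> sp; case: (eqVneq (v i) (c + a i)) => [|nD]; first by left.
right; apply/eqP; rewrite eqn_leq v_le leqNgt; apply/negP => hvi.
have hlast : i < n.
  rewrite ltn_neqAle hin andbT; apply/eqP => e; move: nD.
  by rewrite e /v /a (cnt_size (X := V)) ?sizeV // cnt_size // cE eqxx.
have vbound : v i + (n - i) >= count id V.
  by have := @cnt_sub V i n hin; rewrite (@cnt_size V n) ?sizeV.
have abound : a i <= count id A by apply: cnt_max.
(* If both equalities fail, [p] carries the largest value up to [i] outside [V]. It is confronted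
   with [p'], which carries the smallest value of [V] above [i]. *)
have [|p [p1 p2 p3]] := @cnt_surj (map negb A) (c + (i - v i).-1).
  rewrite count_negb; have := @cnt_sub A i n hin; rewrite (@cnt_size A n) // -/(a i).
  by have := v_le i; lia.
rewrite size_map in p1; rewrite (nth_map false) // in p2.
rewrite cnt_neg ?(ltnW p1) // -/(a p) in p3.
have hc : c <= p - a p by lia.
have gp : `|g p| <= i by rewrite T3 //; lia.
have [hc'|hc'] := ltnP (v i) c.
  (* That value of [V] sits on a negative entry, so its signed position is negative. *)
  have [|p' [q1 q2 q3]] := @cnt_surj (map negb A) (c - (v i).+1).
    by rewrite count_negb; lia.
  rewrite size_map in q1; rewrite (nth_map false) // in q2.
  rewrite cnt_neg ?(ltnW q1) // -/(a p') in q3.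
  have hn : p' - a p' < c by lia.
  have gp' : i < `|g p'| by rewrite ltnNge T2 //; lia.
  by have := sp p p' p1 q1 gp gp'; rewrite sposL // sposN //; lia.
(* That value sits on an exceedance, which comes before position [i], whereas [p] does not. *)
have [|p' [q1 q2 q3]] := @cnt_surj A (v i - c); first by lia.
rewrite -/(a p') in q3.
have gp' : i < `|g p'| by rewrite ltnNge T1 //; lia.
have := sp p p' p1 q1 gp gp'; rewrite sposL // sposA //.
have := @cnt_mono A i p'; have := @na_mono p i; have := a_le i; have := a_le p.
by rewrite -!/(a _); lia.
Qed.

End Psi.

(** * Windows of the first kind and valid pairs of subsets *)

Definition gs (t : seq int) (k : nat) : int := nth 0%R (0%R :: t) k.
Definition isWindow (t : seq int) : bool := perm_eq (map absz t) (iota 1 (size t)).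

Lemma isW_WinF t : isWindow t -> isWindowFun (size t) (gs t).
Proof.
move=> h; split=> [[|p] // hp|[|p] [|p'] // hp hp'].
  have : `|gs t p.+1| \in map absz t by apply: map_f; rewrite /gs /= mem_nth.
  by rewrite (perm_mem h) mem_iota; lia.
rewrite /gs /= -!(nth_map _ 0) // => /eqP; rewrite nth_uniq ?size_map //.
  by move=> /eqP ->.
by rewrite (perm_uniq h) iota_uniq.
Qed.

Lemma WinF_isW t : isWindowFun (size t) (gs t) -> isWindow t.
Proof.
case=> r i; have u : uniq (map absz t).
  apply/(uniqP 0) => p p'; rewrite !inE size_map => hp hp'.
  rewrite !(nth_map 0%R) // => e; have := i p.+1 p'.+1 hp hp' e; lia.
apply: uniq_perm => //; first exact: iota_uniq.
have [] := @uniq_min_size _ (map absz t) (iota 1 (size t)) u; rewrite ?size_map ?size_iota //.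
move=> y /mapP[x /(nthP 0%R)[p hp <-] ->]; rewrite mem_iota add1n ltnS.
exact: (r p.+1 hp).
Qed.

Definition validP (A V : seq bool) : Prop :=
  [/\ size V = size A, count id A <= count id V &
    forall p, p < size A ->
      cnt V p.+1 <= count id V - count id A + cnt A p.+1 /\
      (nth false A p -> cnt V p.+1 < count id V - count id A + cnt A p.+1)].

Lemma Psi_isW A V : validP A V -> isWindow (Psi A V).
Proof. by case=> sV le _; rewrite /isWindow size_Psi; apply: perm_Psi. Qed.

Lemma Psi_ClassI A V : validP A V -> ClassI (size A) (gs (Psi A V)).
Proof.
move=> [sV le va]; have up := up_exceeds sV le va.
split=> [[|p] [|p'] // hp hp' /=|[|p] [|p'] // hp hp' /=|[|p] [|k] // hp hk /=]; rewrite /gs /=.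
- by rewrite -!up; [apply: up_mono | lia | lia].
- rewrite !leNgt -!up; [apply: low_mono => //; lia | lia | lia].
- by rewrite -!up // => h1 h2; apply: (neg_lt_up sV le).
Qed.

Lemma Psi_injective A V A' V' : validP A V -> validP A' V' -> Psi A V = Psi A' V' ->
  A = A' /\ V = V'.
Proof.
move=> va va' e; have [sV le v] := va; have [sV' le' v'] := va'.
have sA : size A = size A' by rewrite -(size_Psi A V) e size_Psi.
have eA : A = A'.
  apply: (@eq_from_nth _ false) => // p hp.
  by rewrite (up_exceeds sV le v) // e -(up_exceeds sV' le' v') // -sA.
subst A'; split=> //; apply: (@eq_from_nth _ false); rewrite ?sV ?sV' // => u hu.
have : u.+1 \in map absz (Psi A V).
  by rewrite (perm_mem (perm_Psi sV le)) mem_iota; lia.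
case/mapP => y /(nthP 0%R)[p]; rewrite size_Psi => hp <- hy.
have := abs_mem_V sV le hp; have := abs_mem_V sV' le' hp.
by rewrite -e -hy /= => -> ->.
Qed.

Lemma sorted_neg_split (l : seq int) : sorted (<%R : rel int) l ->
  l = [seq y <- l | (y < 0)%R] ++ [seq y <- l | ~~ (y < 0)%R].
Proof.
elim: l => //= y l IH h; have hs := path_sorted h.
case: ifP => hy /=; first by rewrite -IH.
have all_ge : all (fun z => ~~ (z < 0)%R) l.
  by have := order_path_min lt_trans h; apply: sub_all => z; lia.
rewrite (_ : [seq z <- l | (z < 0)%R] = [::]) /= ?(all_filterP all_ge) //.
apply/eqP; rewrite -[_ == _]negbK -has_filter; apply/hasPn => z hz.
by have := allP all_ge z hz.
Qed.

Lemma mask_sorted_by (t : seq int) (X : seq bool) : size X = size t ->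
  (forall p p', p < p' -> p' < size t -> nth false X p -> nth false X p' ->
     (nth 0%R t p < nth 0%R t p')%R) ->
  sorted (<%R : rel int) (mask X t).
Proof.
move=> sX h; rewrite -{1}(mkseq_nth 0%R t) /mkseq -map_mask.
apply: (@homo_sorted_in _ _ [pred p | (p < size t) && nth false X p] _ ltn).
- move=> p p' /andP[h1 h2] /andP[h3 h4] pp; exact: h.
- apply/allP => p; rewrite -sX mem_mask_iota subn0 /= sX => hp.
  rewrite /= hp andbT ltnNge; apply/negP => hle.
  by rewrite nth_default ?sX in hp.
- by apply: sorted_mask (iota_ltn_sorted _ _); exact: ltn_trans.
Qed.

Lemma absz_lt_opp (x y : int) : (y < 0)%R -> (- y < x)%R -> `|y| < `|x|.
Proof. lia. Qed.
Lemma absz_lt_neg (x y : int) : (x < 0)%R -> (y < 0)%R -> (x < y)%R -> `|y| < `|x|.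
Proof. lia. Qed.
Lemma absz_lt_pos (x y : int) : ~~ (x < 0)%R -> (x < y)%R -> `|x| < `|y|.
Proof. lia. Qed.

Lemma ClassI_Psi t : isWindow t -> ClassI (size t) (gs t) ->
  exists A V, [/\ size A = size t, validP A V & t = Psi A V].
Proof.
move=> hW [c1 c2 c3]; set n := size t.
pose A := mkseq (fun p => (Posz p.+1 < nth 0%R t p)%R) n.
have sA : size A = n by rewrite size_mkseq.
have nA p : p < n -> nth false A p = (Posz p.+1 < nth 0%R t p)%R by move=> hp; rewrite nth_mkseq.
have nnA p : p < n -> nth false (map negb A) p = ~~ (Posz p.+1 < nth 0%R t p)%R.
  by move=> hp; rewrite (nth_map false) ?sA // nA.
pose Ul := mask A t; pose Ll := mask (map negb A) t.
have sU : sorted (<%R : rel int) Ul.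
  apply: mask_sorted_by => // p p' pp hp'; rewrite !nA //; last by lia.
  by have := c1 p.+1 p'.+1; rewrite /gs /=; apply; lia.
have sL : sorted (<%R : rel int) Ll.
  apply: mask_sorted_by; first by rewrite size_map sA.
  move=> p p' pp hp'; rewrite !nnA //; last by lia.
  by rewrite -!leNgt; have := c2 p.+1 p'.+1; rewrite /gs /=; apply; lia.
have memU y : y \in Ul -> exists p, [/\ p < n, (Posz p.+1 < nth 0%R t p)%R & y = nth 0%R t p].
  rewrite /Ul -{1}(mkseq_nth 0%R t) /mkseq -map_mask => /mapP[p hp ->].
  have {}hp : p \in mask A (iota 0 (size A)) by rewrite sA.
  rewrite mem_mask_iota subn0 /= in hp.
  have hpn : p < n by rewrite ltnNge; apply/negP => hle; rewrite nth_default ?sA in hp.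
  by exists p; split => //; rewrite -nA.
have U_pos y : y \in Ul -> (0 < y)%R by move=> /memU[p [h1 h2 ->]]; lia.
pose N := [seq y <- Ll | (y < 0)%R]; pose P := [seq y <- Ll | ~~ (y < 0)%R].
have LNP : Ll = N ++ P by exact: sorted_neg_split.
(* The third condition of [ClassI] places all negatives below all exceedances in absolute value, so
   this list is increasing and enumerates [V]. *)
pose W := rev (map absz N) ++ map absz Ul.
have sN : sorted (<%R : rel int) N by apply: sorted_filter sL; exact: lt_trans.
have sP : sorted (<%R : rel int) P by apply: sorted_filter sL; exact: lt_trans.
have sW : sorted ltn W.
  rewrite (sorted_pairwise ltn_trans) pairwise_cat -!(sorted_pairwise ltn_trans); apply/and3P; split.
  - apply/allrelP => a b; rewrite mem_rev => /mapP[y hy ->] /mapP[z /memU[p [h1 h2 ->]] ->].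
    move: hy; rewrite mem_filter => /andP[yn /mem_mask/(nthP 0%R)[k hk ek]].
    have hh := c3 p.+1 k.+1 h1 hk h2; rewrite /gs /= ek in hh.
    exact: absz_lt_opp yn (hh yn).
  - rewrite rev_sorted; apply: (@homo_sorted_in _ _ [pred y : int | (y < 0)%R] _ <%R _ N) => //.
      exact: absz_lt_neg.
    by apply/allP => y; rewrite mem_filter => /andP[].
  - apply: (@homo_sorted_in _ _ [pred y : int | ~~ (y < 0)%R] _ <%R _ Ul) => //.
      by move=> y z hy _; apply: absz_lt_pos.
    by apply/allP => y /U_pos; rewrite /= -leNgt => /ltW.
have sP' : sorted ltn (map absz P).
  apply: (@homo_sorted_in _ _ [pred y : int | ~~ (y < 0)%R] _ <%R _ P) => //.
    by move=> y z hy _; apply: absz_lt_pos.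
  by apply/allP => y; rewrite mem_filter => /andP[].
have permt : perm_eq t (Ul ++ Ll).
  rewrite -{1}(shuf_mask 0%R (A := A) (s := t)) //; apply: perm_shuf.
    by rewrite size_mask.
  by rewrite -count_negb size_mask // size_map sA.
have permW : perm_eq (W ++ map absz P) (iota 1 n).
  apply: perm_trans hW; rewrite perm_sym.
  apply: perm_trans (perm_map absz permt) _.
  rewrite map_cat LNP map_cat perm_catCA catA perm_cat2r perm_cat2r.
  by rewrite perm_sym perm_rev.
have memWP u : u \in iota 1 n -> (u \in map absz P) = (u \notin W).
  have un : uniq (W ++ map absz P) by rewrite (perm_uniq permW) iota_uniq.
  rewrite -(perm_mem permW) mem_cat; move: un; rewrite cat_uniq => /and3P[_ /hasPn un _].
  by case/orP => h; [rewrite h; apply/negP => /un; rewrite h | rewrite h un].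
have subW u : u \in W ++ map absz P -> u \in iota 1 n by rewrite (perm_mem permW).
pose V := [seq u \in W | u <- iota 1 n].
have sV : size V = n by rewrite size_map size_iota.
have srt (p : pred nat) : sorted ltn (filter p (iota 1 n)).
  by apply: sorted_filter (iota_ltn_sorted _ _); exact: ltn_trans.
have pT : posT V = W.
  rewrite /posT sV -filter_mask.
  apply: (irr_sorted_eq ltn_trans ltnn) => // u; rewrite mem_filter.
  by apply: andb_idr => hu; apply: subW; rewrite mem_cat hu.
have pF : posF V = map absz P.
  rewrite /posF /posT size_map sV -map_comp -filter_mask.
  apply: (irr_sorted_eq ltn_trans ltnn) => // u; rewrite mem_filter /=.
  apply/andP/idP => [[h1 h2]|hu]; first by rewrite memWP.
  have hi : u \in iota 1 n by apply: subW; rewrite mem_cat hu orbT.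
  by rewrite -memWP.
have cA : count id A = size Ul by rewrite size_mask.
have cV : count id V = size N + count id A.
  by rewrite -size_posT pT size_cat size_rev !size_map cA.
have le : count id A <= count id V by rewrite cV leq_addl.
have cNE : count id V - count id A = size (rev (map absz N)).
  by rewrite cV addnK size_rev size_map.
have tE : t = Psi A V.
  rewrite /Psi /PsiU /PsiL pT pF cNE drop_size_cat // take_size_cat //.
  rewrite revK -!map_comp -{1}(shuf_mask 0%R (A := A) (s := t)) //; congr shuf.
    by rewrite -/Ul -[LHS]map_id; apply/eq_in_map => y /U_pos /=; lia.
  rewrite -/Ll LNP; congr (_ ++ _).
    by rewrite -[LHS]map_id; apply/eq_in_map => y; rewrite mem_filter => /andP[+ _] /=; lia.
  by rewrite -[LHS]map_id; apply/eq_in_map => y; rewrite mem_filter => /andP[+ _] /=; lia.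
exists A, V; split=> //; split => //; first by rewrite sA.
apply: valid_of_up => //; first by rewrite sA.
by move=> p; rewrite sA => hp; rewrite -tE nA.
Qed.

Section Windows.
Variable n : nat.

Definition win (w : SP n) : seq int := [seq wval w j | j <- enum 'I_n].

Lemma size_win w : size (win w) = n. Proof. by rewrite size_map size_enum_ord. Qed.
Lemma gs_win w : gs (win w) =1 wn w. Proof. by []. Qed.

Lemma win_isW w : isWindow (win w).
Proof.
apply: WinF_isW; rewrite size_win; split=> [p hp|p p' hp hp' e].
  have [i ->] := ord_pred_ex hp; rewrite gs_win wn_val -(@ler_nat int) /=.
  have := wval_norm w i; have := ltn_ord (w.1 i); lia.
by apply: (@wn_inj_abs n w); rewrite // -!gs_win -!abszE e.
Qed.

Lemma win_inj : injective win.
Proof.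
move=> u w e; apply: wn_inj => k _; by rewrite -!gs_win e.
Qed.

Lemma win_surj t : isWindow t -> size t = n -> exists w, win w = t.
Proof.
move=> hW st; have [r i] := isW_WinF hW; rewrite st in r i.
have ht (k : 'I_n) : nth 0%R t k = gs t k.+1 by [].
pose f (k : 'I_n) : 'I_n := insubd k (`|nth 0%R t k|.-1).
have fE k : val (f k) = `|nth 0%R t k|.-1.
  by rewrite val_insubd; have := r k.+1 (ltn_ord k); rewrite -ht; case: ifP => //; lia.
have fi : injective f.
  move=> k k' /(congr1 val); rewrite !fE => e; apply: ord_inj.
  have := i k.+1 k'.+1 (ltn_ord k) (ltn_ord k'); rewrite -!ht.
  have := r k.+1 (ltn_ord k); have := r k'.+1 (ltn_ord k'); rewrite -!ht; lia.
exists (perm fi, [ffun k : 'I_n => (nth 0%R t k < 0)%R]).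
apply: (@eq_from_nth _ 0%R); rewrite size_win // => p hp.
rewrite (nth_map (Ordinal hp)) ?size_enum_ord //.
have -> : nth (Ordinal hp) (enum 'I_n) p = Ordinal hp.
  by apply: ord_inj; rewrite nth_enum_ord.
rewrite /wval /= ffunE permE fE /=; have := r p.+1 hp; rewrite /gs /=; move: (nth _ _ _) => z.
by case: ifP; lia.
Qed.

Lemma sum_win (R : nmodType) (P : seq int -> Prop) (L : seq (seq int)) (F : seq int -> R) :
  uniq L -> (forall t, t \in L <-> [/\ isWindow t, size t = n & P t]) ->
  (\sum_(w : SP n | `[< P (win w) >]) F (win w) = \sum_(t <- L) F t)%R.
Proof.
move=> uL hL.
rewrite -big_filter -(big_map win xpredT F); apply: perm_big; apply: uniq_perm => //.
  by rewrite map_inj_uniq ?filter_uniq ?index_enum_uniq //; exact: win_inj.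
move=> t; apply/mapP/idP.
  case=> w; rewrite mem_filter => /andP[/asboolP hP _] ->; apply/hL.
  by rewrite win_isW size_win.
move=> /hL[h1 h2 h3]; have [w e] := win_surj h1 h2.
by exists w; rewrite ?mem_filter ?mem_index_enum ?andbT //; apply/asboolP; rewrite e.
Qed.

End Windows.

(** * Identity prefixes *)

Definition ush (j : nat) (y : int) : int := if (y < 0)%R then (y - Posz j)%R else (y + Posz j)%R.
Definition ext (j : nat) (t : seq int) : seq int := map Posz (iota 1 j) ++ map (ush j) t.

Lemma size_ext j t : size (ext j t) = j + size t.
Proof. by rewrite size_cat !size_map size_iota. Qed.

Lemma gs_ext_low j t p : 0 < p <= j -> gs (ext j t) p = p.
Proof.
case: p => // p /= hp; rewrite /gs /= nth_cat size_map size_iota hp.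
by rewrite (nth_map 0) ?size_iota // nth_iota.
Qed.

Lemma gs_ext_high j t p : 0 < p <= size t -> gs (ext j t) (j + p) = ush j (gs t p).
Proof.
case: p => // p /= hp; rewrite addnS /gs /= nth_cat size_map size_iota.
by rewrite ltnNge leq_addr /= addKn (nth_map 0%R).
Qed.

Lemma dsh_ush j y : dsh j (ush j y) = y.
Proof. rewrite /dsh /ush; do 2 case: ifP; lia. Qed.

Lemma ush_dsh j y : j < `|y| -> ush j (dsh j y) = y.
Proof. rewrite /dsh /ush; do 2 case: ifP; lia. Qed.

Lemma absz_ush j y : `|ush j y| = `|y| + j.
Proof. rewrite /ush; case: ifP; lia. Qed.

Lemma ext_isW j t : isWindow t -> isWindow (ext j t).
Proof.
rewrite /isWindow size_ext => h; rewrite map_cat -!map_comp.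
rewrite iotaD; apply: perm_cat; first by rewrite (eq_map (g := id)) ?map_id.
rewrite (eq_map (g := addn j \o absz)) => [|y /=]; last by rewrite absz_ush addnC.
by rewrite map_comp addnC iotaDl perm_map.
Qed.

Lemma ext_inj j : injective (ext j).
Proof.
move=> t t' /eqP; rewrite eqseq_cat // eqxx /= => /eqP /inj_map; apply.
exact: can_inj (dsh_ush j).
Qed.

Lemma eq_ClassI n g g' : (forall p, 0 < p <= n -> g p = g' p) -> ClassI n g -> ClassI n g'.
Proof.
move=> e [c1 c2 c3]; split=> [p p' h1 h2|p p' h1 h2|p k h1 h2].
- by have := c1 p p' h1 h2; rewrite !e //; lia.
- by have := c2 p p' h1 h2; rewrite !e //; lia.
- by have := c3 p k h1 h2; rewrite !e //; lia.
Qed.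

Lemma eq_one_neg n g g' : (forall p, 0 < p <= n -> g p = g' p) -> one_neg n g -> one_neg n g'.
Proof.
move=> e [k [h1 h2 h3]]; exists k; split=> //; first by rewrite -e.
by move=> k' h; rewrite -e //; apply: h3.
Qed.

(** Position 1 is then a non-exceedance, and non-exceedances increase. Hence the two kinds of
    windows are disjoint and the prefix length is determined. *)
Lemma ClassI_no_prefix m g k : ClassI m g -> g 1 = Posz 1 -> 0 < k <= m -> (g k < 0)%R -> False.
Proof.
move=> [_ c2 _] g1 hk gk.
have k1 : k <> 1 by move=> e; subst; lia.
have := c2 1 k; lia.
Qed.

Lemma shifted_not_ClassI n j g : isWindowFun n g -> shifted n j g -> ~ ClassI n g.
Proof.
move=> [r i] [hj hp _ [k [hk gk _]]] c.
suff gk' : (g (j + k) < 0)%R.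
  by apply: (ClassI_no_prefix c (hp 1 _) _ gk'); lia.
move: gk; rewrite /dsh; case: ifP => // h gk.
have := r (j + k); have := hp `|g (j + k)|%N; have := i (j + k) `|g (j + k)|%N; lia.
Qed.

Lemma shifted_lt n j j' g : shifted n j g -> shifted n j' g -> ~ (j < j').
Proof.
move=> [hj hp c [k [hk gk _]]] [hj' hp' _ _] jj.
apply: (ClassI_no_prefix c _ hk gk).
by rewrite /= hp'; [rewrite /dsh; split_ifs; lia | lia].
Qed.

Lemma shifted_uniq n j j' g : shifted n j g -> shifted n j' g -> j = j'.
Proof.
move=> h h'; have := shifted_lt h h'; have := shifted_lt h' h; lia.
Qed.

Lemma ext_shifted j t : isWindow t -> 0 < j -> 0 < size t -> ClassI (size t) (gs t) ->
  one_neg (size t) (gs t) -> shifted (j + size t) j (gs (ext j t)).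
Proof.
move=> hW j0 t0 c o.
have e p : 0 < p <= size t -> gs t p = dsh j (gs (ext j t) (j + p)).
  by move=> hp; rewrite gs_ext_high // dsh_ush.
split; rewrite ?addKn; [lia | exact: gs_ext_low | exact: eq_ClassI c | exact: eq_one_neg o].
Qed.

Lemma shifted_ext n j t : isWindow t -> size t = n -> shifted n j (gs t) ->
  exists t', [/\ isWindow t', size t' = n - j, ClassI (n - j) (gs t'), one_neg (n - j) (gs t')
    & t = ext j t'].
Proof.
move=> hW st [hj hp c o]; have [r i] := isW_WinF hW; rewrite st in r i.
have /= ph2 := exceed_above r i.
have big p : j < p <= n -> j < `|gs t p|.
  move=> hpj; rewrite ltnNge; apply/negP => hle.
  have [||u [r1 r2 r3]] := ph2 p j; try lia.
  by have := hp u; lia.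
pose t' := map (dsh j) (drop j t).
have st' : size t' = n - j by rewrite size_map size_drop st.
have e p : 0 < p <= n - j -> dsh j (gs t (j + p)) = gs t' p.
  case: p => // p hpj; rewrite /gs /= addnS /= (nth_map 0%R) ?nth_drop // size_drop st; lia.
have te : t = ext j t'.
  apply: (@eq_from_nth _ 0%R); rewrite ?size_ext ?st' ?st; first by lia.
  move=> p hpn; rewrite -[LHS]/(gs t p.+1) -[RHS]/(gs (ext j t') p.+1).
  have [pj|jp] := leqP p.+1 j; first by rewrite hp // gs_ext_low.
  have -> : p.+1 = j + (p.+1 - j) by lia.
  rewrite gs_ext_high ?st'; last by lia.
  rewrite -e ?ush_dsh //; [|lia].
  by apply: big; lia.
exists t'; split=> //.
- apply: WinF_isW; rewrite st'; split=> [p hpj|p p' h1 h2].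
    have := r (j + p); have := big (j + p); rewrite -e // /dsh; case: ifP; lia.
  have := i (j + p) (j + p'); have := big (j + p); have := big (j + p').
  by rewrite -!e // /dsh; do 2 case: ifP; lia.
- exact: eq_ClassI c.
- exact: eq_one_neg o.
Qed.

Lemma one_neg_Psi A V : validP A V ->
  one_neg (size A) (gs (Psi A V)) <-> count id V - count id A = 1.
Proof.
case=> sV le va; have ln := low_neg sV le.
have leV : count id V <= size A by rewrite -sV count_size.
have ex k : k < count id V - count id A ->
    exists p, [/\ p < size A, (gs (Psi A V) p.+1 < 0)%R & p - cnt A p = k].
  move=> hk; have [|p [p1 p2 p3]] := @cnt_surj (map negb A) k.
    by rewrite count_negb; lia.
  rewrite size_map in p1; rewrite (nth_map false) // in p2.
  rewrite cnt_neg ?(ltnW p1) // in p3.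
  by exists p; split=> //; rewrite /gs /= ln // p2 p3.
split.
  case=> [[|k]] [] // hk gk uk.
  rewrite /gs /= ln // in gk; case/andP: gk => gk1 gk2.
  apply/eqP; rewrite eqn_leq; apply/andP; split; last by lia.
  rewrite leqNgt; apply/negP => c2.
  have [|p [p1 p2 p3]] := ex 0; first by lia.
  have [|p' [q1 q2 q3]] := ex 1; first by lia.
  have := uk p.+1 p1 p2; have := uk p'.+1 q1 q2; move=> e1 e2.
  have e : p = p' by lia.
  by rewrite e q3 in p3.
move=> c1; have [|p [p1 p2 p3]] := ex 0; first by lia.
exists p.+1; split=> // -[|k] // hk gk; congr _.+1.
move: gk p2; rewrite /gs /= !ln // => /andP[gk1 gk2] /andP[gp1 gp2].
have [h|h|//] := ltngtP k p.
  by have /= := na_mono sV le h (ltnW p1) gk1; lia.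
by have /= := na_mono sV le h (ltnW hk) gp1; lia.
Qed.

(** * Weights of the windows *)

Fixpoint okw (d : nat) (s : seq (bool * bool)) : bool :=
  if s is (a, v) :: s' then okP d a v && okw (d + a - v) s' else d == 0.

Fixpoint stat (d : nat) (ini : bool) (s : seq (bool * bool)) : nat :=
  if s is (a, v) :: s' then
    ((d + a - v == 0) || (ini && v)) + stat (d + a - v) (ini && v) s'
  else 0.

Lemma okwP d s : reflect
  (d + count id (unzip1 s) = count id (unzip2 s) /\
   forall p, p < size s -> cnt (unzip2 s) p.+1 <= d + cnt (unzip1 s) p.+1 /\
     (nth false (unzip1 s) p -> cnt (unzip2 s) p.+1 < d + cnt (unzip1 s) p.+1)) (okw d s).
Proof.
elim: s d => [|[a v] s IH] d /=.
  by rewrite addn0; apply: (iffP eqP) => [->|[]].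
apply: (iffP andP) => [[/andP[h1 h2] /IH[e h]]|[e h]].
  split; first by lia.
  case=> [|p] hp; rewrite !cnt_cons.
    by rewrite !cnt0 /=; case: a h1 h2 {e h}; lia.
  by have := h p hp; rewrite /=; lia.
have := h 0 isT; rewrite !cnt_cons !cnt0 /= !addn0 => -[h1 h2].
split; first by rewrite /okP h1; apply/implyP.
apply/IH; split; first by lia.
move=> p hp; have := h p.+1 hp; rewrite !cnt_cons /=; lia.
Qed.

Lemma statE d ini s : okw d s -> stat d ini s =
  \sum_(p < size s) ((cnt (unzip2 s) p.+1 == d + cnt (unzip1 s) p.+1) ||
     (ini && (cnt (unzip2 s) p.+1 == p.+1))).
Proof.
elim: s d ini => [|[a v] s IH] d ini /=; first by rewrite big_ord0.
move=> /andP[/andP[h1 h2] h]; rewrite IH // big_ord_recl !cnt_cons !cnt0 !addn0.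
congr (nat_of_bool _ + _).
  by case: ini; case: v h1 {h2 h} => /=; lia.
apply: eq_bigr => p _; rewrite !cnt_cons lift0.
congr nat_of_bool; congr (_ || _); first by lia.
have := cnt_le (unzip2 s) p.+1.
by case: ini; case: v {h1 h2 h} => /=; lia.
Qed.

Section Weights.
Variables (R : comNzRingType) (q : R) (x : nat -> R).
Local Open Scope ring_scope.

Lemma runE d ini s :
  run (wtP q) nxP (finP R) (d, ini) s = if okw d s then q ^+ stat d ini s else 0.
Proof.
elim: s d ini => [|[a v] s IH] d ini.
  by rewrite /= /finP /=; case: eqP.
rewrite /= IH; case: (okP d a v); last by rewrite mul0r.
rewrite /=; case: (okw _ s); last by rewrite mulr0.
by case: (_ || _); rewrite /= ?add1n ?exprS // add0n mul1r.
Qed.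

Lemma xwE o prev (s : seq (bool * bool)) : xw fst x o prev s =
  \prod_(i < size s | (if (i : nat) is i'.+1 then nth false (unzip1 s) i' else prev)
     && ~~ nth false (unzip1 s) i) x (o + i)%N.
Proof.
elim: s o prev => [|[a v] s IH] o prev; first by rewrite big_ord0.
rewrite [LHS]/= IH [size _]/= [in RHS]big_mkcond big_ord_recl [in LHS]big_mkcond /=.
rewrite addn0; congr (_ * _); apply: eq_bigr => i _.
rewrite /bump leq0n add1n add0n addnS -addSn; congr (if _ then _ else _).
by case: i => [[|i] hi].
Qed.

Definition dprod (o : nat) (t : seq int) : R :=
  \prod_(i < size t | gs t i.+1 < gs t i) x (o + i)%N.

(** Within each of the two increasing subsequences there is no descent, so descents are the
    exceedances followed by a non-exceedance; the descent at 0 is covered by a virtual plus when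
    there is a negative entry. *)
Lemma dprod_Psi o (s : seq (bool * bool)) : validP (unzip1 s) (unzip2 s) ->
  dprod o (Psi (unzip1 s) (unzip2 s)) =
  xw fst x o (0 < count id (unzip2 s) - count id (unzip1 s))%N s.
Proof.
move=> [sV le va]; rewrite xwE /dprod size_Psi size_map; apply: eq_bigl => -[[|i] hi] /=.
  by rewrite /gs /= (low_neg sV le) ?size_map //= sub0n andbC.
rewrite /gs /=.
have hi' : (i.+1 < size (unzip1 s))%N by rewrite size_map.
have up1 := up_exceeds sV le va (ltnW hi'); have up2 := up_exceeds sV le va hi'.
have [a1|a1] := boolP (nth false (unzip1 s) i); have [a2|a2] := boolP (nth false (unzip1 s) i.+1).
- by rewrite /= ltNge (ltW (up_mono sV le (ltnSn i) hi' a1 a2)).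
- have := Psi_inj sV le (ltnW hi') hi'; move: up1 up2; rewrite a1 (negbTE a2) /=.
  move: (nth _ _ _) (nth _ _ _) => y z; have [e|ne] := eqVneq y z; last by lia.
  by move=> _ _ /(_ (congr1 absz (esym e))); lia.
- by move: up1 up2; rewrite a2 (negbTE a1); move: (nth _ _ _) (nth _ _ _) => y z; lia.
- by rewrite /= ltNge (ltW (low_mono sV le (ltnSn i) hi' a1 a2)).
Qed.

End Weights.

Definition spt (t : seq int) (p : nat) : int :=
  if (nth 0%R t p < 0)%R then (- Posz p.+1)%R else Posz p.+1.

Definition splits (t : seq int) (i : nat) : Prop :=
  forall p p', p < size t -> p' < size t -> `|nth 0%R t p| <= i -> i < `|nth 0%R t p'| ->
    (spt t p < spt t p')%R.

Definition blt (t : seq int) : nat := 1 + \sum_(1 <= i < size t) `[< splits t i >].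

(** The inverse takes the value [spt] at the absolute value of an entry, so its blocks can be read
    off the window of [w]. *)
Lemma bl_inv n (w : SP n) : bl (invSP w) = blt (win w).
Proof.
rewrite /bl /blt size_win; congr addn; apply: eq_bigr => i _; congr nat_of_bool.
have nthw (p : 'I_n) : nth 0%R (win w) p = wval w p.
  by rewrite (nth_map p) ?size_enum_ord // nth_ord_enum.
have vinv (p : 'I_n) : wval (invSP w) (w.1 p) = spt (win w) p.
  by rewrite /wval /invSP /spt /= ffunE permK nthw wval_neg.
apply/idP/asboolP.
  move=> /forallP h p p'; rewrite size_win => hp hp'.
  rewrite -[p]/(nat_of_ord (Ordinal hp)) -[p']/(nat_of_ord (Ordinal hp')) !nthw -!vinv.
  move: (Ordinal hp) (Ordinal hp') => {hp hp'}p {}p' h1 h2.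
  have /forallP/(_ (w.1 p'))/implyP := h (w.1 p); apply.
  by have := wval_norm w p; have := wval_norm w p'; lia.
move=> h; apply/forallP => j; apply/forallP => k; apply/implyP => /andP[h1 h2].
rewrite -(permKV w.1 j) -(permKV w.1 k) !vinv.
set p := (w.1^-1)%g j; set p' := (w.1^-1)%g k.
have ej : j = w.1 p by rewrite permKV.
have ek : k = w.1 p' by rewrite permKV.
apply: h; rewrite ?size_win ?ltn_ord // nthw.
  by have := wval_norm w p; rewrite -ej; lia.
by have := wval_norm w p'; rewrite -ek; lia.
Qed.

(** The last letter always ends in state 0 and earns a [q]; this is the leading 1 of [blt]. *)
Lemma blt_Psi (s : seq (bool * bool)) : 0 < size s -> validP (unzip1 s) (unzip2 s) ->
  blt (Psi (unzip1 s) (unzip2 s)) =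
  stat (count id (unzip2 s) - count id (unzip1 s)) true s.
Proof.
move=> s0 va; have [sV le v] := va.
have ok : okw (count id (unzip2 s) - count id (unzip1 s)) s.
  by apply/okwP; split; [lia | move=> p hp; apply: v; rewrite size_map].
rewrite statE // /blt size_Psi size_map.
have [m em] : exists m, size s = m.+1 by case: (size s) s0 => // m _; exists m.
rewrite em big_add1 big_mkord big_ord_recr /= addnC; congr (_ + _).
  apply: eq_bigr => i _; have hi := ltn_ord i.
  have hh : 0 < i.+1 <= size (unzip1 s) by rewrite size_map em; lia.
  have [d1 d2] := split_iff sV le v hh.
  congr nat_of_bool; apply/asboolP/orP.
    move=> sp; have [|->|->] := d1; [|by left|by right].
    by move=> p p' hp hp'; apply: sp; rewrite size_Psi.
  move=> h p p'; rewrite size_Psi; apply: d2.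
  by case: h => /eqP; [left | right].
by rewrite -em !cnt_size ?size_map // subnK ?eqxx.
Qed.

Lemma sptE t p : spt t p = if (gs t p.+1 < 0)%R then (- Posz p.+1)%R else Posz p.+1.
Proof. by []. Qed.

Lemma ush_lt j y z : 0 < `|y| -> 0 < `|z| -> (ush j y < ush j z)%R = (y < z)%R.
Proof. by rewrite /ush; do 2 case: ifP; lia. Qed.

Lemma ush_neg j y : 0 < `|y| -> (ush j y < 0)%R = (y < 0)%R.
Proof. by rewrite /ush; case: ifP; lia. Qed.

Lemma ush_lt_low j y : 0 < `|y| -> (ush j y < Posz j)%R = (y < 0)%R.
Proof. by rewrite /ush; case: ifP; lia. Qed.

(** The prefix has no descents, and being below [j] after the shift means being negative before it,
    so the descent at 0 becomes the descent at [j]. *)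
Lemma dprod_ext (R : comNzRingType) (x : nat -> R) j t : isWindow t -> 0 < j ->
  dprod x 0 (ext j t) = dprod x j t.
Proof.
move=> hW j0; have [r _] := isW_WinF hW.
rewrite /dprod size_ext big_split_ord /= big1 ?mul1r.
  apply: eq_big => [i|i _]; last by rewrite add0n.
  have hi := ltn_ord i; rewrite -addnS gs_ext_high //.
  have r1 := r i.+1 hi; have [i0|i0] := posnP i.
    rewrite i0 in r1 *; rewrite addn0 gs_ext_low; last by rewrite j0 leqnn.
    by rewrite ush_lt_low //; case/andP: r1.
  have ri := r i; rewrite gs_ext_high; last by lia.
  by rewrite ush_lt //; lia.
move=> i; have hi := ltn_ord i; rewrite gs_ext_low //.
have [i0|i0] := posnP i; first by rewrite i0.
by rewrite gs_ext_low; lia.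
Qed.

Section BltExt.
Variables (j : nat) (t : seq int).
Hypotheses (hW : isWindow t) (j0 : 0 < j) (hneg : one_neg (size t) (gs t)).

Let low p : p < j -> `|gs (ext j t) p.+1| = p.+1 /\ spt (ext j t) p = Posz p.+1.
Proof. by move=> hp; rewrite sptE gs_ext_low. Qed.

Let high p : p < size t -> `|gs (ext j t) (j + p).+1| = `|gs t p.+1| + j /\
  spt (ext j t) (j + p) = if (gs t p.+1 < 0)%R then (- Posz (j + p).+1)%R else Posz (j + p).+1.
Proof.
move=> hp; have [r _] := isW_WinF hW; have r1 := r p.+1 hp.
by rewrite sptE -addnS gs_ext_high // absz_ush ush_neg //; lia.
Qed.

(** The negative entry has absolute value above [j], so the inverse takes a negative value beyond
    [i], below its value 1 at position 1. *)
Lemma not_splits_ext_low i : 0 < i <= j -> ~ splits (ext j t) i.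
Proof.
move=> hi h; have [[|k] [// hk gk _]] := hneg.
have [h1 h2] := low j0; have [h3 h4] := high hk.
have [r _] := isW_WinF hW; have r1 := r k.+1 hk.
have := h 0 (j + k); rewrite size_ext -/(gs (ext j t) 1) -/(gs (ext j t) (j + k).+1).
by rewrite h1 h2 h3 h4 gk; lia.
Qed.

(** Shifting moves positive and negative signed positions apart; no comparison changes because only
    one of them is negative. *)
Lemma splits_ext_high i : 0 < i < size t -> splits (ext j t) (j + i) <-> splits t i.
Proof.
move=> hi; have [[|k] [// hk gk uk]] := hneg.
have [r inj] := isW_WinF hW.
have neg p : p < size t -> (gs t p.+1 < 0)%R -> p = k.
  by move=> hp gp; have := uk p.+1 hp gp; lia.
split=> h p p'.
  move=> hp hp'; rewrite -/(gs t p.+1) -/(gs t p'.+1) => h1 h2.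
  have [a1 a2] := high hp; have [b1 b2] := high hp'.
  have := h (j + p) (j + p'); rewrite size_ext -/(gs (ext j t) (j + p).+1).
  rewrite -/(gs (ext j t) (j + p').+1) a1 a2 b1 b2 !sptE.
  rewrite !ltn_add2l [_ + j]addnC leq_add2l [_ + j]addnC ltn_add2l.
  move=> /(_ hp hp' h1 h2).
  have n12 : ~~ ((gs t p.+1 < 0)%R && (gs t p'.+1 < 0)%R).
    by apply/negP => /andP[/(neg p hp) e1 /(neg p' hp') e2]; subst; lia.
  by move: n12; do 2 case: (_ < 0)%R => //=; lia.
rewrite size_ext => hp hp'; rewrite -/(gs _ p.+1) -/(gs _ p'.+1).
have [pj|jp] := ltnP p' j; first by have [-> _] := low pj; lia.
have e' : p' = j + (p' - j) by lia.
have hs' : p' - j < size t by lia.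
move: (p' - j) e' hs' => q' -> hs' {jp hp'}; have [b1 b2] := high hs'; rewrite b1 b2.
have n2 := neg q' hs'.
(* The value 1 is always on the low side, so its position replaces a prefix position in the
   comparison. *)
have ex1 : exists p, [/\ p < size t & `|gs t p.+1| <= i].
  have : 1 \in map absz t by rewrite (perm_mem hW) mem_iota; lia.
  case/mapP => y /(nthP 0%R)[u hu <-] e; exists u; split=> //.
  by rewrite /gs /= -e; lia.
have [pj|jp] := ltnP p j.
  have [_ ->] := low pj => _ h2; case: ifP => gq; last by lia.
  have [u [u1 u2]] := ex1; have h2' : i < `|gs t q'.+1| by lia.
  have := h u q' u1 hs' u2 h2'; rewrite !sptE gq; case: ifP => gu; last by lia.
  by move: u2 h2'; rewrite (neg u u1 gu) (n2 gq); lia.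
have e : p = j + (p - j) by lia.
have hs : p - j < size t by lia.
move: (p - j) e hs => q -> hs; have [a1 a2] := high hs; rewrite a1 a2 => h1 h2.
have h1' : `|gs t q.+1| <= i by lia.
have h2' : i < `|gs t q'.+1| by lia.
have := h q q' hs hs' h1' h2'; rewrite !sptE.
have n12 : ~~ ((gs t q.+1 < 0)%R && (gs t q'.+1 < 0)%R).
  by apply/negP => /andP[/(neg q hs) e1 /(neg q' hs') e2]; subst; lia.
by move: n12; do 2 case: (_ < 0)%R => //=; lia.
Qed.

Lemma blt_ext : blt (ext j t) = blt t.
Proof.
have t0 : 0 < size t by case: hneg => k [] /andP[h1 h2] _ _; lia.
rewrite /blt size_ext; congr addn.
rewrite (@big_cat_nat _ _ _ j.+1) /=; [|lia|lia].
rewrite big_nat_cond big1 ?add0n.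
  rewrite -[j.+1]add1n big_addn addKn; apply: eq_big_nat => i hi.
  congr nat_of_bool; rewrite addnC; apply/asboolP/asboolP => h.
    by apply/splits_ext_high.
  by apply/splits_ext_high.
move=> i; rewrite andbT => hi; case: asboolP => // h.
by case: (@not_splits_ext_low i _ h); lia.
Qed.

End BltExt.

(** * The sum over fully commutative elements *)

Definition cw (s : seq (bool * bool)) := count id (unzip2 s) - count id (unzip1 s).
Definition okS (s : seq (bool * bool)) :=
  (count id (unzip1 s) <= count id (unzip2 s)) && okw (cw s) s.
Definition PsiW (s : seq (bool * bool)) := Psi (unzip1 s) (unzip2 s).

Lemma okS_valid s : reflect (validP (unzip1 s) (unzip2 s)) (okS s).
Proof.
apply: (iffP andP) => [[h1 /okwP[_ h2]]|[_ h1 h2]].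
  by split; rewrite ?size_map.
by split=> //; apply/okwP; split; [rewrite /cw; lia | move=> p hp; apply: h2; rewrite size_map].
Qed.

Lemma zip_unzip12 (s : seq (bool * bool)) : zip (unzip1 s) (unzip2 s) = s.
Proof. exact: zip_unzip. Qed.

Lemma pairs2_words n (s : seq (bool * bool)) : (s \in words pairs2 n) = (size s == n).
Proof.
rewrite mem_words; apply: andb_idr => _; apply/allP => -[a v] _.
by case: a; case: v.
Qed.

Lemma okS_inj n : {in [seq s <- words pairs2 n | okS s] &, injective PsiW}.
Proof.
move=> s s'; rewrite !mem_filter => /andP[/okS_valid v _] /andP[/okS_valid v' _] e.
have [e1 e2] := Psi_injective v v' e.
by rewrite -(zip_unzip12 s) e1 e2 zip_unzip12.
Qed.

Lemma mem_PsiW n t : t \in [seq PsiW s | s <- words pairs2 n & okS s] <->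
  [/\ isWindow t, size t = n & ClassI n (gs t)].
Proof.
split.
  case/mapP => s; rewrite mem_filter pairs2_words => /andP[/okS_valid v /eqP sn] ->.
  have sP : size (PsiW s) = n by rewrite size_Psi size_map.
  split=> //; first exact: Psi_isW.
  by have := Psi_ClassI v; rewrite size_map sn.
case=> hW st c; rewrite -st in c.
have [A' [V' [sA v e]]] := ClassI_Psi hW c.
have sV : size V' = size A' by case: v.
have e1 : unzip1 (zip A' V') = A' by rewrite unzip1_zip // sV.
have e2 : unzip2 (zip A' V') = V' by rewrite unzip2_zip // sV.
apply/mapP; exists (zip A' V'); last by rewrite /PsiW e1 e2.
rewrite mem_filter pairs2_words size_zip sV minnn sA st eqxx andbT.
by apply/okS_valid; rewrite e1 e2.
Qed.

Lemma mem_PsiW1 n t :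
  t \in [seq PsiW s | s <- words pairs2 n & okS s && (cw s == 1)] <->
  [/\ isWindow t, size t = n, ClassI n (gs t) & one_neg n (gs t)].
Proof.
split.
  case/mapP => s; rewrite mem_filter => /andP[/andP[o c1] hs] ->.
  have /mem_PsiW[h1 h2 h3] : PsiW s \in [seq PsiW s | s <- words pairs2 n & okS s].
    by apply: map_f; rewrite mem_filter o.
  split=> //; have := hs; rewrite pairs2_words => /eqP sn.
  have v := okS_valid s o.
  have := one_neg_Psi v; rewrite size_map sn => -[_]; apply; exact/eqP.
case=> h1 h2 h3 h4.
have /mapP[s] : t \in [seq PsiW s | s <- words pairs2 n & okS s] by apply/mem_PsiW.
rewrite mem_filter => /andP[o hs] e; apply/mapP; exists s => //.
rewrite mem_filter o hs andbT /=; have v := okS_valid s o.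
have := hs; rewrite pairs2_words => /eqP sn.
have := one_neg_Psi v; rewrite size_map sn -/(PsiW s) -e => -[h _].
by apply/eqP/h.
Qed.

Section Total.
Variables (R : comNzRingType) (q : R) (x : nat -> R) (n : nat).
Hypothesis n0 : 0 < n.
Local Open Scope ring_scope.

Definition Gw (o : nat) (t : seq int) : R := dprod x o t * q ^+ blt t.

Lemma Gw_win (w : SP n) :
  (\prod_(i < n | DesBw w i) x i) * q ^+ bl (invSP w) = Gw 0 (win w).
Proof. by rewrite /Gw bl_inv /dprod size_win. Qed.

Lemma FC_indicator (w : SP n) (F : R) :
  (if `[< fullyCommutative w >] then F else 0) =
  (if `[< ClassI n (gs (win w)) >] then F else 0) +
  \sum_(j < n.-1) (if `[< shifted n j.+1 (gs (win w)) >] then F else 0).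
Proof.
have wf : isWindowFun n (gs (win w)) by have := isW_WinF (win_isW w); rewrite size_win.
have [c|nc] := asboolP (ClassI n (gs (win w))).
  rewrite asboolT; last by apply/FC_notBad; apply: ClassI_notBad.
  rewrite big1 ?addr0 // => j _; rewrite asboolF //.
  by move=> h; exact: shifted_not_ClassI wf h c.
rewrite add0r; case: (pselect (exists j, shifted n j (gs (win w)))) => [[j hj]|ns].
  rewrite asboolT; last by apply/FC_notBad; apply: shifted_notBad hj.
  have hjn : (0 < j < n)%N by case: hj.
  have hj1 : (j.-1 < n.-1)%N by lia.
  rewrite (bigD1 (Ordinal hj1)) //= big1 ?addr0 => [|i ne].
    by rewrite asboolT // prednK //; lia.
  rewrite asboolF // => hi; move: ne; rewrite -(inj_eq val_inj) /=.
  by have := shifted_uniq hi hj; lia.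
rewrite asboolF; last first.
  by move=> /FC_notBad /(notBad_cases wf) [].
rewrite big1 // => j _; rewrite asboolF // => h; apply: ns; by exists j.+1.
Qed.

Lemma sum_FC :
  \sum_(w : SP n | `[< fullyCommutative w >])
      (\prod_(i < n | DesBw w i) x i) * q ^+ bl (invSP w) =
  \sum_(s <- words pairs2 n | okS s) Gw 0 (PsiW s) +
  \sum_(j < n.-1) \sum_(s <- words pairs2 (n - j.+1) | okS s && (cw s == 1%N)) Gw j.+1 (PsiW s).
Proof.
under eq_bigr do rewrite Gw_win.
rewrite big_mkcond /=; under eq_bigr do rewrite FC_indicator.
rewrite big_split /= -big_mkcond /=; congr (_ + _).
  rewrite (@sum_win n R (fun t => ClassI n (gs t)) [seq PsiW s | s <- words pairs2 n & okS s]).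
  - by rewrite big_map big_filter.
  - by rewrite map_inj_in_uniq ?filter_uniq ?words_uniq //; exact: okS_inj.
  - exact: mem_PsiW.
rewrite exchange_big /=; apply: eq_bigr => j _; rewrite -big_mkcond /=.
have jn : (j.+1 < n)%N by have := ltn_ord j; lia.
pose L1 := [seq PsiW s | s <- words pairs2 (n - j.+1) & okS s && (cw s == 1%N)].
rewrite (@sum_win n R (fun t => shifted n j.+1 (gs t)) [seq ext j.+1 t | t <- L1]).
- rewrite big_map /L1 big_map big_filter big_seq_cond [RHS]big_seq_cond.
  apply: eq_bigr => s /andP[hs ho].
  have : PsiW s \in L1 by apply: map_f; rewrite mem_filter ho.
  case/mem_PsiW1 => h1 h2 h3 h4; rewrite -h2 in h4.
  by rewrite /Gw dprod_ext // blt_ext.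
- rewrite map_inj_uniq; last exact: ext_inj.
  rewrite map_inj_in_uniq ?filter_uniq ?words_uniq // => s s'.
  rewrite !mem_filter => /andP[/andP[o1 _] m1] /andP[/andP[o2 _] m2].
  by apply: (@okS_inj (n - j.+1)); rewrite mem_filter ?o1 ?o2.
move=> t; split.
  case/mapP => t' /mem_PsiW1[h1 h2 h3 h4] ->.
  split; [exact: ext_isW | by rewrite size_ext h2; lia |].
  have e : (j.+1 + size t')%N = n by rewrite h2; lia.
  rewrite -h2 in h3 h4.
  by have := @ext_shifted j.+1 t' h1 isT _ h3 h4; rewrite e; apply; rewrite h2; lia.
case=> h1 h2 h3; have [t' [k1 k2 k3 k4 ->]] := shifted_ext h1 h2 h3.
by apply: map_f; apply/mem_PsiW1.
Qed.

(** Length 0 is cut out on both sides because [blt] of the empty window is 1 while the empty word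
    has [stat] 0. *)
Lemma sum_okS_c o k (c : nat) :
  \sum_(s <- words pairs2 k | okS s && (cw s == c)) (if k is 0 then 0 else Gw o (PsiW s)) =
  if k is 0 then 0 else ZP q x o k (0 < c)%N (c, true).
Proof.
case: k => [|k]; first by rewrite big1.
rewrite big_mkcond /ZP /Z; apply: eq_big_seq => s; rewrite pairs2_words => /eqP sk.
rewrite runE; case: ifP => [/andP[o1 /eqP <-]|].
  have v := okS_valid s o1; rewrite /Gw dprod_Psi // blt_Psi ?sk // -/(cw s).
  by case/andP: o1 => _ ->.
move=> no; case: ifP => ok; last by rewrite mulr0.
case/okwP: (ok) => e _; move: no; rewrite /okS.
have -> : cw s = c by rewrite /cw -e addnK.
by rewrite ok eqxx -e leq_addl.

Qed.

Lemma sum_FC_ZP :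
  \sum_(w : SP n | `[< fullyCommutative w >])
      (\prod_(i < n | DesBw w i) x i) * q ^+ bl (invSP w) =
  ZP q x 0 n false (0%N, false) + \sum_(c < n) ZP q x 0 n true (c.+1, true) +
  \sum_(j < n.-1) ZP q x j.+1 (n - j.+1) true (1%N, true).
Proof.
rewrite sum_FC; congr (_ + _); last first.
  apply: eq_bigr => j _; have := ltn_ord j => hj.
  have := sum_okS_c j.+1 (n - j.+1) 1; case: (n - j.+1)%N (subn_gt0 j.+1 n) => //; lia.
have -> : \sum_(s <- words pairs2 n | okS s) Gw 0 (PsiW s) =
    \sum_(c < n.+1) \sum_(s <- words pairs2 n | okS s && (cw s == c)) Gw 0 (PsiW s).
  rewrite (exchange_big_dep okS) /=; last by move=> c s _ /andP[].
  rewrite big_seq_cond [RHS]big_seq_cond; apply: eq_bigr => s /andP[hs ho].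
  have cn : (cw s < n.+1)%N.
    move: hs; rewrite pairs2_words => /eqP <-; rewrite ltnS.
    apply: leq_trans (leq_subr _ _) _; apply: leq_trans (count_size _ _) _.
    by rewrite size_map.
  rewrite (big_pred1 (Ordinal cn)) // => c /=.
  by rewrite ho -(inj_eq val_inj) /= eq_sym.
have hc (c : nat) : \sum_(s <- words pairs2 n | okS s && (cw s == c)) Gw 0 (PsiW s) =
    ZP q x 0 n (0 < c)%N (c, true).
  by have := sum_okS_c 0 n c; case: (n) n0.
rewrite big_ord_recl hc ltnn ZP_0ini; congr (_ + _).
by apply: eq_bigr => c _; rewrite hc.
Qed.

End Total.

(** * Domino tableaux and row counts *)

Section Tables.
Variable n : nat.

Definition tn (T : Tab n) (r c : nat) : nat :=
  if insub r is Some i then if insub c is Some j then T (i, j) else 0 else 0.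

Lemma tnE (T : Tab n) (i j : 'I_(2 * n)) : tn T i j = T (i, j).
Proof. by rewrite /tn !valK. Qed.

Lemma tn_le (T : Tab n) r c : tn T r c <= n.
Proof. by rewrite /tn; case: insubP => // i _ _; case: insubP => // j _ _; rewrite -ltnS. Qed.

Lemma tn_out (T : Tab n) r c : ~~ ((r < 2 * n) && (c < 2 * n)) -> tn T r c = 0.
Proof.
rewrite /tn; case: insubP => // i -> _ /=; case: insubP => // j -> _ //.
Qed.

Lemma tn_inj (T T' : Tab n) : (forall r c, r < 2 * n -> c < 2 * n -> tn T r c = tn T' r c) -> T = T'.
Proof.
move=> h; apply/ffunP => -[i j]; apply: ord_inj; rewrite -!tnE; exact: h.
Qed.

Definition tof (f : nat -> nat -> nat) : Tab n := [ffun c : cell n => inord (f c.1 c.2)].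

Lemma tn_tof f r c : (forall r c, f r c <= n) -> r < 2 * n -> c < 2 * n -> tn (tof f) r c = f r c.
Proof.
move=> h hr hc; rewrite -[r]/(nat_of_ord (Ordinal hr)) -[c in LHS]/(nat_of_ord (Ordinal hc)) tnE.
by rewrite ffunE inordK // ltnS.
Qed.

Lemma card_cells (T : Tab n) (l : 'I_n.+1) :
  #|[set c | T c == l]| = \sum_(r < 2 * n) \sum_(c < 2 * n) (tn T r c == l).
Proof.
rewrite pair_bigA /= -sum1_card big_mkcond /=.
transitivity (\sum_(c : cell n) (T c == l)).
  by apply: eq_bigr => c _; rewrite inE; case: (_ == _).
by apply: (eq_bigr (fun c : cell n => nat_of_bool (tn T c.1 c.2 == l))) => -[i j] _; rewrite tnE.
Qed.

Record SDTf (lr : nat -> nat) (f : nat -> nat -> nat) : Prop := {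
  sdt_shape : forall r c, r < 2 * n -> c < 2 * n -> (c < lr r) = (f r c != 0);
  sdt_two : forall l, 0 < l <= n -> \sum_(r < 2 * n) \sum_(c < 2 * n) (f r c == l) = 2;
  sdt_adj : forall r c r' c', r < 2 * n -> c < 2 * n -> r' < 2 * n -> c' < 2 * n ->
    f r c = f r' c' -> f r c <> 0 -> (r, c) <> (r', c') ->
    (r = r' /\ (c.+1 = c' \/ c'.+1 = c)) \/ (c = c' /\ (r.+1 = r' \/ r'.+1 = r));
  sdt_row : forall r c c', r < 2 * n -> c <= c' -> c' < 2 * n -> c' < lr r -> f r c <= f r c';
  sdt_col : forall r r' c, r <= r' -> r' < 2 * n -> c < 2 * n -> c < lr r -> c < lr r' ->
    f r c <= f r' c }.

Lemma inShapeE la (c : cell n) : inShape la c = (c.2 < nth 0 la c.1).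
Proof.
rewrite /inShape; have [h|h] := ltnP c.1 (size la) => //.
by rewrite nth_default // ltn0.
Qed.

Lemma isSDT_SDTf la T : isSDT la T <-> SDTf (nth 0 la) (tn T).
Proof.
have neq (i j i' j' : 'I_(2 * n)) : ((i, j) != (i', j')) <->
   (nat_of_ord i, nat_of_ord j) <> (nat_of_ord i', nat_of_ord j').
  split; first by move=> + [/ord_inj e1 /ord_inj e2]; rewrite e1 e2 eqxx.
  by move=> h; apply/eqP => -[e1 e2]; apply: h; rewrite e1 e2.
split.
  case/and5P => /forallP h1 /forallP h2 /forallP h3 /forallP h4 /forallP h5; split.
  - move=> r c hr hc; have := h1 (Ordinal hr, Ordinal hc); rewrite inShapeE /= -tnE /=.
    by move=> /eqP.
  - move=> l /andP[l0 ln]; have hl : l < n.+1 by [].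
    have := h2 (Ordinal hl); rewrite /= -lt0n l0 /= => /eqP.
    by rewrite card_cells.
  - move=> r c r' c' hr hc hr' hc' e nz ne.
    have /forallP/(_ (Ordinal hr', Ordinal hc'))/implyP := h3 (Ordinal hr, Ordinal hc).
    rewrite -(inj_eq val_inj) /= -!tnE /= e eqxx /=.
    have -> : tn T r' c' != 0 by rewrite -e; apply/eqP.
    have -> : (Ordinal hr, Ordinal hc) != (Ordinal hr', Ordinal hc') by apply/neq.
    move=> /(_ isT); rewrite /adjacent /=; lia.
  - move=> r c c' hr cc hc' hl; have hc : c < 2 * n by lia.
    have /forallP/(_ (Ordinal hr, Ordinal hc'))/implyP := h4 (Ordinal hr, Ordinal hc).
    by rewrite !inShapeE /= -!tnE /=; apply; rewrite hl eqxx cc !andbT /=; lia.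
  - move=> r r' c rr hr' hc hl hl'; have hr : r < 2 * n by lia.
    have /forallP/(_ (Ordinal hr', Ordinal hc))/implyP := h5 (Ordinal hr, Ordinal hc).
    by rewrite !inShapeE /= -!tnE /=; apply; rewrite hl hl' eqxx rr.
case=> h1 h2 h3 h4 h5; apply/and5P; split.
- apply/forallP => -[i j]; rewrite inShapeE /= -tnE; apply/eqP; exact: h1.
- apply/forallP => l; apply/implyP => l0; apply/eqP.
  by rewrite card_cells h2 // lt0n l0 -ltnS ltn_ord.
- apply/forallP => -[i j]; apply/forallP => -[i' j']; apply/implyP => /and3P[e nz /neq ne].
  move: e nz; rewrite -(inj_eq val_inj) /= -!tnE => /eqP e /eqP nz.
  by have := h3 i j i' j' (ltn_ord _) (ltn_ord _) (ltn_ord _) (ltn_ord _) e nz ne;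
     rewrite /adjacent /=; lia.
- apply/forallP => -[i j]; apply/forallP => -[i' j']; apply/implyP.
  rewrite !inShapeE /= -!tnE => /and4P[s1 s2 /eqP e jj]; rewrite e in s1 *.
  by apply: h4.
- apply/forallP => -[i j]; apply/forallP => -[i' j']; apply/implyP.
  rewrite !inShapeE /= -!tnE => /and4P[s1 s2 /eqP e jj]; rewrite e in s1 *.
  by apply: h5.
Qed.

(** A downward closed predicate is determined by how often it holds. This is used to pass from rows
    to counts and back. *)
Lemma threshold (P : nat -> bool) m c : (forall c c', c <= c' -> P c' -> P c) -> c < m ->
  P c = (c < \sum_(i < m) P i).
Proof.
move=> dc; have le k : \sum_(i < k) P i <= k.
  by elim: k => [|k IH]; rewrite ?big_ord0 // big_ord_recr /= -addn1 leq_add // leq_b1.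
have all k : P k -> \sum_(i < k) P i = k.
  elim: k => [|k IH] hk; first by rewrite big_ord0.
  have pk : P k by apply: dc hk.
  by rewrite big_ord_recr /= IH // pk addn1.
elim: m => // m IH; rewrite ltnS leq_eqVlt big_ord_recr /= => /orP[/eqP ->|h].
  case h : (P m); first by rewrite all // addn1 ltnSn.
  by rewrite addn0 ltnNge le.
rewrite IH //; case hm : (P m); last by rewrite addn0.
by rewrite all // h; lia.
Qed.

Lemma sum_supp (g : nat -> nat) a b : a <= b -> (forall r, a <= r -> g r = 0) ->
  \sum_(r < b) g r = \sum_(r < a) g r.
Proof.
move=> ab h; rewrite -!(big_mkord xpredT) (@big_cat_nat _ _ _ a) //=.
rewrite [X in _ + X]big_nat_cond [X in _ + X]big1 ?addn0 // => i.
by rewrite andbT => /andP[hi _]; apply: h.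
Qed.

Lemma sum_ltn k m : k <= m -> \sum_(c < m) (c < k) = k.
Proof.
move=> km; rewrite (@sum_supp (fun c => nat_of_bool (c < k)) k) //.
  by under eq_bigr do rewrite ltn_ord; rewrite sum_nat_const card_ord muln1.
by move=> r hr; rewrite ltnNge hr.
Qed.

(* [N r l] counts the cells of row [r] labelled at most [l]. *)
Record KN (lr : nat -> nat) (N : nat -> nat -> nat) : Prop := {
  kn0 : forall r, N r 0 = 0;
  kn_mono : forall r l, N r l <= N r l.+1;
  kn_end : forall r, N r n = lr r;
  kn_sum : forall l, l < n -> N 0 l.+1 + N 1 l.+1 + N 2 l.+1 = (N 0 l + N 1 l + N 2 l).+2;
  kn_10 : forall l, l <= n -> N 1 l <= N 0 l;
  kn_21 : forall l, l <= n -> N 2 l <= N 1 l;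
  kn_L : forall l, l < n -> N 0 l.+1 = (N 0 l).+1 -> N 1 l.+1 = (N 1 l).+1 -> N 0 l = N 1 l;
  kn_V : forall l, l < n -> N 1 l.+1 = (N 1 l).+1 -> N 2 l.+1 = (N 2 l).+1 -> N 1 l = N 2 l;
  kn_no : forall l, l < n -> ~ (N 0 l.+1 = (N 0 l).+1 /\ N 2 l.+1 = (N 2 l).+1) }.

Definition Nf (f : nat -> nat -> nat) (r l : nat) : nat :=
  \sum_(c < 2 * n) ((0 < f r c) && (f r c <= l)).

Lemma row_count (f : nat -> nat -> nat) r l : 0 < l -> \sum_(c < 2 * n) (f r c == l) + Nf f r l.-1 = Nf f r l.
Proof.
move=> l0; rewrite -big_split; apply: eq_bigr => c _ /=.
by case: (ltngtP (f r c) l); lia.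
Qed.

Section FromTable.
Variables (lr : nat -> nat) (f : nat -> nat -> nat).
Hypothesis S : SDTf lr f.
Hypothesis f_out : forall r c, ~~ ((r < 2 * n) && (c < 2 * n)) -> f r c = 0.
Hypothesis f_le : forall r c, f r c <= n.
Hypothesis lr3 : forall r, 3 <= r -> lr r = 0.
Hypothesis lr_le : forall r, lr r <= 2 * n.
Hypothesis lr_out : forall r, 2 * n <= r -> lr r = 0.
Hypothesis lr_mono : lr 1 <= lr 0 /\ lr 2 <= lr 1.
Local Notation N := (Nf f).

Lemma f_pos r c : (0 < f r c) = (c < lr r).
Proof.
have [h|h] := boolP ((r < 2 * n) && (c < 2 * n)).
  by case/andP: h => hr hc; rewrite (sdt_shape S) // lt0n.
rewrite f_out //; move: h; rewrite negb_and -!leqNgt => /orP[h|h].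
  by rewrite lr_out.
by have := lr_le r; lia.
Qed.

Lemma NfP r l c : c < lr r -> (f r c <= l) = (c < N r l).
Proof.
move=> hc; have hc2 : c < 2 * n by have := lr_le r; lia.
have hr : r < 2 * n by rewrite ltnNge; apply/negP => /lr_out e; rewrite e in hc.
rewrite -(@threshold (fun c => (0 < f r c) && (f r c <= l))) //; first by rewrite f_pos hc.
move=> k k' kk; rewrite !f_pos => /andP[h1 h2].
have k2 : k' < 2 * n by have := lr_le r; lia.
by have := sdt_row S hr kk k2 h1; lia.
Qed.

Lemma Nf_le r l : N r l <= lr r.
Proof.
rewrite -[X in _ <= X](sum_ltn (lr_le r)); apply: leq_sum => c _.
by rewrite f_pos; case: (c < lr r); case: (f r c <= l).
Qed.

Lemma Nf_end r : N r n = lr r.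
Proof.
apply/eqP; rewrite eqn_leq Nf_le leqNgt; apply/negP => h.
by have := NfP n h; rewrite f_le ltnn.
Qed.

Lemma Nf0 r : N r 0 = 0.
Proof. by rewrite /Nf big1 // => c _; case: ltnP. Qed.

Lemma Nf_monoS r l : N r l <= N r l.+1.
Proof.
apply: leq_sum => c _; case: (0 < _) => //=.
by have [h|//] := leqP (f r c) l; rewrite (leqW h).
Qed.

Lemma Nf_cell r l : N r l < N r l.+1 -> [/\ N r l < lr r & f r (N r l) = l.+1].
Proof.
move=> h; have hl : N r l < lr r by apply: leq_trans h (Nf_le _ _).
split=> //; have := NfP l.+1 hl; have := NfP l hl; lia.
Qed.

(** The last three conditions express adjacency: a label present in two rows occupies the same
    column of consecutive rows, which forces equal counts before it. *)
Lemma Nf_KN : KN lr N.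
Proof.
have rng r c : c < lr r -> r < 2 * n /\ c < 2 * n.
  move=> h; split; last by have := lr_le r; lia.
  by rewrite ltnNge; apply/negP => /lr_out e; rewrite e in h.
have colle r l : lr r.+1 <= lr r -> N r.+1 l <= N r l.
  move=> hlr; case e : (N r.+1 l) => [//|c].
  have h1 : c < lr r.+1 by have := Nf_le r.+1 l; lia.
  have [r1 r2] := rng _ _ h1.
  have h2 : f r.+1 c <= l by rewrite NfP // e.
  have h3 : f r c <= f r.+1 c by apply: (sdt_col S) => //; lia.
  by rewrite -(@NfP r l c); lia.
have [m1 m2] := lr_mono.
split.
- exact: Nf0.
- exact: Nf_monoS.
- exact: Nf_end.
- move=> l ln; have := sdt_two S (l := l.+1) ln.
  (* The box has only [2 * n] rows, possibly fewer than 3; padding to [2 * n + 3] allows the cut to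
     exactly three rows. *)
  rewrite -(@sum_supp (fun r => \sum_(c < 2 * n) (f r c == l.+1)) (2 * n) (2 * n + 3)); last 2 first.
  + lia.
  + by move=> r hr; rewrite big1 // => c _; rewrite f_out //; lia.
  rewrite (@sum_supp (fun r => \sum_(c < 2 * n) (f r c == l.+1)) 3 (2 * n + 3)); last 2 first.
  + lia.
  + move=> r hr; rewrite big1 // => c _.
    by have := f_pos r c; rewrite lr3 //; case: (f r c).
  rewrite !big_ord_recr big_ord0 /= add0n.
  have /= := @row_count f 0 l.+1 isT; have /= := @row_count f 1 l.+1 isT.
  have /= := @row_count f 2 l.+1 isT; move: (N _ _) (N _ _) (N _ _) (N _ _) (N _ _) (N _ _).
  by lia.
- by move=> l _; apply: colle.
- by move=> l _; apply: colle.
- move=> l ln e0 e1; have [|a1 a2] := @Nf_cell 0 l; first by lia.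
  have [|b1 b2] := @Nf_cell 1 l; first by lia.
  have [p1 p2] := rng _ _ a1; have [p3 p4] := rng _ _ b1.
  by have := sdt_adj S p1 p2 p3 p4; rewrite a2 b2 => /(_ erefl); case=> //; case.
- move=> l ln e0 e1; have [|a1 a2] := @Nf_cell 1 l; first by lia.
  have [|b1 b2] := @Nf_cell 2 l; first by lia.
  have [p1 p2] := rng _ _ a1; have [p3 p4] := rng _ _ b1.
  by have := sdt_adj S p1 p2 p3 p4; rewrite a2 b2 => /(_ erefl); case=> //; case.
- move=> l ln [e0 e1]; have [|a1 a2] := @Nf_cell 0 l; first by lia.
  have [|b1 b2] := @Nf_cell 2 l; first by lia.
  have [p1 p2] := rng _ _ a1; have [p3 p4] := rng _ _ b1.
  have := sdt_adj S p1 p2 p3 p4; rewrite a2 b2 => /(_ erefl); case=> //; case; lia.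
Qed.


End FromTable.

Section FromCounts.
Variables (lr : nat -> nat) (N : nat -> nat -> nat).
Hypothesis K : KN lr N.
Hypothesis lr3 : forall r, 3 <= r -> lr r = 0.
Hypothesis lr_le : forall r, lr r <= 2 * n.
Hypothesis lr_out : forall r, 2 * n <= r -> lr r = 0.

(** Inverse of [Nf]: the counts in a row are nondecreasing, so this sum is the first [l] with more
    than [c] cells labelled at most [l]. *)
Definition ff (r c : nat) : nat := if c < lr r then \sum_(l < n.+1) (N r l <= c) else 0.

Lemma kn_monoP r l l' : l <= l' -> N r l <= N r l'.
Proof.
move=> h; have -> : l' = l + (l' - l) by lia.
elim: (l' - l) => [|k IH]; rewrite ?addn0 // addnS.
by apply: leq_trans IH (kn_mono K _ _).
Qed.

Lemma ff_leE r c l : c < lr r -> l <= n -> (ff r c <= l) = (c < N r l).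
Proof.
move=> hc ln; rewrite /ff hc leqNgt -(@threshold (fun l => N r l <= c)) ?ltnS // -?ltnNge //.
by move=> a b ab; apply: leq_trans; apply: kn_monoP.
Qed.

Lemma ff_out r c : lr r <= c -> ff r c = 0.
Proof. by move=> h; rewrite /ff ifN // -leqNgt. Qed.

Lemma ff_le r c : ff r c <= n.
Proof.
case: (ltnP c (lr r)) => h; first by rewrite ff_leE // (kn_end K).
by rewrite ff_out.
Qed.

Lemma ff_gt0 r c : (0 < ff r c) = (c < lr r).
Proof.
case: (ltnP c (lr r)) => h; last by rewrite ff_out.
by rewrite ltnNge ff_leE // (kn0 K).
Qed.

Lemma kn_le_lr r l : l <= n -> N r l <= lr r.
Proof. by move=> h; rewrite -(kn_end K r); apply: kn_monoP. Qed.

Lemma Nf_ff r l : l <= n -> Nf ff r l = N r l.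
Proof.
move=> ln; rewrite -[RHS](@sum_ltn (N r l) (2 * n)); last first.
  by apply: leq_trans (kn_le_lr _ ln) (lr_le r).
apply: eq_bigr => c _; rewrite ff_gt0; case: (ltnP c (lr r)) => h /=.
  by rewrite ff_leE.
by rewrite ltnNge (leq_trans (kn_le_lr _ ln) h).
Qed.

Lemma ff_cell r c l : ff r c = l.+1 -> N r l <= c < N r l.+1.
Proof.
move=> e; have hc : c < lr r by rewrite -ff_gt0 e.
have ln : l.+1 <= n by rewrite -e ff_le.
have := ff_leE hc ln; have := ff_leE hc (ltnW ln); rewrite e; lia.
Qed.

Lemma ff_SDTf : SDTf lr ff.
Proof.
have row3 r c : 0 < ff r c -> r < 3.
  by rewrite ff_gt0 => h; rewrite ltnNge; apply/negP => /lr3 e; rewrite e in h.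
have up0 l : N 0 l <= N 0 l.+1 by apply: (kn_mono K).
have up1 l : N 1 l <= N 1 l.+1 by apply: (kn_mono K).
have up2 l : N 2 l <= N 2 l.+1 by apply: (kn_mono K).
split.
- by move=> r c _ _; rewrite -ff_gt0 lt0n.
- case=> // l /= ln.
  rewrite -(@sum_supp (fun r => \sum_(c < 2 * n) (ff r c == l.+1)) (2 * n) (2 * n + 3)); last 2 first.
  + lia.
  + move=> r hr; rewrite big1 // => c _; have := ff_gt0 r c; rewrite lr_out //.
    by case: (ff r c).
  rewrite (@sum_supp (fun r => \sum_(c < 2 * n) (ff r c == l.+1)) 3 (2 * n + 3)); last 2 first.
  + lia.
  + by move=> r hr; rewrite big1 // => c _; have := ff_gt0 r c; rewrite lr3 //; case: (ff r c).
  rewrite !big_ord_recr big_ord0 /= add0n.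
  have /= := @row_count ff 0 l.+1 isT; have /= := @row_count ff 1 l.+1 isT.
  have /= := @row_count ff 2 l.+1 isT; rewrite !Nf_ff //; try lia.
  by have := kn_sum K ln; lia.
- move=> r c r' c' hr hc hr' hc' e nz ne.
  case el : (ff r c) e nz => [//|l] /esym el' _.
  have c1 := ff_cell el; have c2 := ff_cell el'.
  have ln : l < n by have := ff_le r c; lia.
  have r3 : r < 3 by apply: (@row3 r c); rewrite el.
  have r3' : r' < 3 by apply: (@row3 r' c'); rewrite el'.
  have sm := kn_sum K ln; have := kn_no K ln; have := kn_L K ln; have := kn_V K ln.
  have := up0 l; have := up1 l; have := up2 l.
  have ncc : r = r' -> c <> c' by move=> e1 e2; apply: ne; rewrite e1 e2.
  by case: r r' r3 r3' c1 c2 ncc {hr hr' el el' ne} => [|[|[|r]]] [|[|[|r']]] // _ _; lia.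
- move=> r c c' hr cc hc' hl; rewrite ff_leE ?ff_le //; last by lia.
  by apply: leq_ltn_trans cc _; rewrite -ff_leE // ff_le.
- move=> r r' c rr hr' hc hl hl'; rewrite ff_leE ?ff_le //.
  have h : c < N r' (ff r' c) by rewrite -ff_leE // ff_le.
  have r3 : r' < 3 by apply: (@row3 r' c); rewrite ff_gt0.
  have h1 := kn_10 K (ff_le r' c); have h2 := kn_21 K (ff_le r' c).
  by case: r r' r3 rr h h1 h2 {hr' hl hl'} => [|[|[|r]]] [|[|[|r']]] // _ _; lia.
Qed.

End FromCounts.

Lemma SDTf_eq lr f f' : SDTf lr f -> SDTf lr f' ->
  (forall r c, ~~ ((r < 2 * n) && (c < 2 * n)) -> f r c = 0) ->
  (forall r c, ~~ ((r < 2 * n) && (c < 2 * n)) -> f' r c = 0) ->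
  (forall r c, f r c <= n) -> (forall r c, f' r c <= n) ->
  (forall r, lr r <= 2 * n) -> (forall r, 2 * n <= r -> lr r = 0) ->
  (forall r, 3 <= r -> lr r = 0) -> lr 1 <= lr 0 /\ lr 2 <= lr 1 ->
  (forall r l, r < 3 -> l <= n -> Nf f r l = Nf f' r l) -> forall r c, f r c = f' r c.
Proof.
move=> s s' o o' le le' l1 l2 l3 lm e r c.
have [h|h] := ltnP c (lr r); last first.
  have p := f_pos s o l1 l2 lm r c; have p' := f_pos s' o' l1 l2 lm r c; lia.
have r3 : r < 3 by rewrite ltnNge; apply/negP => /l3 e3; rewrite e3 in h.
have q := NfP s o l1 l2 lm; have q' := NfP s' o' l1 l2 lm.
apply/eqP; rewrite eqn_leq q // e // -q' // leqnn /= q' // -e // -q // leqnn.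
Qed.

End Tables.

(** * Tableaux as walks *)

Notation letter := (option bool).

Fixpoint walkb (b : bool) (h : nat) (s : seq letter) : bool :=
  if s is a :: s' then
    (match a with Some true => true | Some false => 0 < h | None => b && (h == 0) end)
    && walkb b (nxW h a) s'
  else true.

Definition hend (h : nat) (s : seq letter) : nat := foldl nxW h s.

Lemma run_walk (R : comNzRingType) b (F : nat -> R) h s :
  run (wtW R b) nxW F h s = if walkb b h s then F (hend h s) else 0%R.
Proof.
elim: s h => [|a s IH] h //=; rewrite IH; case: (walkb _ _ s); last by rewrite andbF mulr0.
rewrite andbT; case: a => [[]|] /=; rewrite ?mul1r //.
  by case: (0 < h); rewrite ?mul1r ?mul0r.
by case: (_ && _); rewrite ?mul1r ?mul0r.
Qed.

Definition nl (a : letter) (s : seq letter) (l : nat) : nat := count_mem a (take l s).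
Local Notation uu := (nl (Some true)).
Local Notation dd := (nl (Some false)).
Local Notation kk := (nl None).

Lemma nl0 a s : nl a s 0 = 0. Proof. by rewrite /nl take0. Qed.

Lemma nlS a s l : l < size s -> nl a s l.+1 = nl a s l + (nth None s l == a).
Proof.
by move=> h; rewrite /nl (take_nth None) // -cats1 count_cat /= addn0.
Qed.

Lemma nl_sum s l : l <= size s -> uu s l + dd s l + kk s l = l.
Proof.
elim: l => [|l IH] h; first by rewrite !nl0.
rewrite !nlS //; have := IH (ltnW h); case: (nth None s l) => [[]|] /=; lia.
Qed.

Definition walkP (b : bool) (s : seq letter) : Prop :=
  forall l, l < size s -> match nth None s l with
    Some true => True | Some false => dd s l < uu s l | None => b /\ uu s l = dd s l end.

Lemma walkb_gen b h s : walkb b h s <-> (forall l, l < size s -> match nth None s l with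
    Some true => True | Some false => dd s l < h + uu s l | None => b /\ h + uu s l = dd s l end).
Proof.
elim: s h => [|a s IH] h; first by split.
have nc c l : nl c (a :: s) l.+1 = (a == c) + nl c s l by [].
rewrite [walkb _ _ _]/=; split.
  case/andP=> ha /IH hs [hl|l hl]; rewrite ?nl0 ?addn0 /=.
    by case: a ha {IH hs nc hl} => [[]|] //= /andP[-> /eqP].
  have := hs l hl; rewrite !nc; move: (nth None s l) (nl _ s l) (nl _ s l) => z u d.
  by case: z => [[]|] //=; case: a ha {IH hs nc hl} => [[]|] //=; lia.
move=> hs; apply/andP; split.
  have := hs 0 isT; rewrite !nl0 addn0 /=; case: a {IH hs nc} => [[]|] //= [-> ->].
  by rewrite eqxx.
have h0 := hs 0 isT; rewrite !nl0 addn0 /= in h0.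
apply/IH => l hl; have := hs l.+1 hl; rewrite !nc /=.
by case: (nth None s l) => [[]|] //=; case: a h0 {IH hs nc} => [[]|] //=; lia.
Qed.

Lemma walkbP b s : walkb b 0 s <-> walkP b s.
Proof. exact: walkb_gen. Qed.

Lemma walk_dd_le b s l : walkP b s -> l <= size s -> dd s l <= uu s l.
Proof.
move=> w; elim: l => [|l IH] h; first by rewrite !nl0.
have := w l h; have := IH (ltnW h); rewrite !nlS //.
case: (nth None s l) => [[]|] /=; lia.
Qed.

Lemma hend_nl b s : walkP b s -> hend 0 s + dd s (size s) = uu s (size s).
Proof.
move=> w; suff h l : l <= size s -> hend 0 (take l s) + dd s l = uu s l.
  by rewrite -{1}(take_size s); apply: h.
elim: l => [|l IH] hl; first by rewrite take0 !nl0.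
have := w l hl; have := IH (ltnW hl); rewrite !nlS // (take_nth None) //.
rewrite /hend -cats1 foldl_cat /= -/(hend 0 _).
case: (nth None s l) => [[]|] /=; lia.
Qed.

(* With [e], the first down letter stands for the vertical domino in rows 2 and 3. *)
Definition NW3 (e : bool) (s : seq letter) (r l : nat) : nat :=
  match r with
  | 0 => (uu s l).*2 + kk s l
  | 1 => (dd s l).*2 + kk s l - (e && (0 < dd s l))
  | 2 => e && (0 < dd s l)
  | _ => 0
  end.

Definition word_of_N (n : nat) (N : nat -> nat -> nat) : seq letter :=
  mkseq (fun l => if N 0 l.+1 == (N 0 l).+2 then Some true
                  else if N 0 l.+1 == (N 0 l).+1 then None else Some false) n.

Lemma nth_word n N l : l < n -> nth None (word_of_N n N) l =
  if N 0 l.+1 == (N 0 l).+2 then Some true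
  else if N 0 l.+1 == (N 0 l).+1 then None else Some false.
Proof. by move=> h; rewrite nth_mkseq. Qed.

Section Words.
Variables (n : nat) (e : bool) (lr : nat -> nat).
Hypothesis lr2 : lr 2 = e.

(** The first row alone determines the word: it grows by 2, 1 or 0. When [e] holds, loops are
    impossible: before the third row starts the second is empty, and afterwards the first two rows
    have lengths of different parity. *)
Lemma word_KN N : KN n lr N ->
  walkP (~~ e) (word_of_N n N) /\
  forall r l, r < 3 -> l <= n -> N r l = NW3 e (word_of_N n N) r l.
Proof.
move=> K; set s := word_of_N n N.
have sz : size s = n by rewrite size_mkseq.
have mono r l : l < n -> N r l <= N r l.+1 by move=> _; apply: (kn_mono K).
(* A cell in the second row forces the third row, if nonempty, to have been started before *)
have key l : e -> l <= n -> N 2 l = 0 -> N 1 l = 0.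
  move=> he ln h2; apply/eqP; rewrite -leqn0 leqNgt; apply/negP => h1.
  have hn : N 2 n = 1 by rewrite (kn_end K) lr2 he.
  have st k : l + k <= n -> N 2 (l + k) = 0.
    elim: k => [|k IH] hk; first by rewrite addn0.
    have hk' : l + k < n by lia.
    have z := IH (ltnW hk'); rewrite addnS; apply/eqP; rewrite -leqn0 leqNgt; apply/negP => h3.
    have m2 : N 2 (l + k).+1 = 1.
      have := kn_monoP K 2 hk'; lia.
    have m1 : 0 < N 1 (l + k) by have := kn_monoP K 1 (leq_addr k l); lia.
    have sm := kn_sum K hk'; have no := kn_no K hk'; have v := kn_V K hk'.
    by have := mono 0 _ hk'; have := mono 1 _ hk'; lia.
  by have := st (n - l); rewrite subnKC // hn; lia.
have main l : l <= n -> [/\ N 0 l = NW3 e s 0 l, N 1 l = NW3 e s 1 l, N 2 l = NW3 e s 2 l,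
    e -> kk s l = 0 & forall l', l' < l -> match nth None s l' with
    Some true => True | Some false => dd s l' < uu s l' | None => ~~ e /\ uu s l' = dd s l' end].
  elim: l => [|l IH] ln.
    by rewrite !(kn0 K) /NW3 !nl0 /= andbF; split.
  have [i0 i1 i2 ik iw] := IH (ltnW ln).
  have sm := kn_sum K ln; have no := kn_no K ln; have v := kn_V K ln; have L := kn_L K ln.
  have m0 := mono 0 _ ln; have m1 := mono 1 _ ln; have m2 := mono 2 _ ln.
  have c10 := kn_10 K ln; have c21 := kn_21 K ln.
  have d10 := kn_10 K (ltnW ln); have ky := key l.+1 ^~ ln.
  have e2 : N 2 l.+1 <= e by rewrite -lr2; have := kn_monoP K 2 ln; rewrite (kn_end K).
  have nw := nth_word N ln; rewrite -/s in nw.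
  have q a : nl a s l.+1 = nl a s l + (nth None s l == a) by apply: nlS; rewrite sz.
  have step : [/\ N 0 l.+1 = NW3 e s 0 l.+1, N 1 l.+1 = NW3 e s 1 l.+1,
     N 2 l.+1 = NW3 e s 2 l.+1, e -> kk s l.+1 = 0 & match nth None s l with
     Some true => True | Some false => dd s l < uu s l | None => ~~ e /\ uu s l = dd s l end].
    rewrite /NW3 !q nw; rewrite /NW3 in i0 i1 i2.
    move: (uu s l) (dd s l) (kk s l) i0 i1 i2 ik => U D K0 i0 i1 i2 ik.
    clear q nw iw IH.
    case: (N 0 l.+1 =P (N 0 l).+2) => h2 /=; last case: (N 0 l.+1 =P (N 0 l).+1) => h1 /=.
    - case: e i0 i1 i2 ik ky e2 => /= i0 i1 i2 ik ky e2; split=> //; lia.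
    - case: e i0 i1 i2 ik ky e2 => /= i0 i1 i2 ik ky e2; split=> //; lia.
    - case: e i0 i1 i2 ik ky e2 => /= i0 i1 i2 ik ky e2; split=> //; lia.
  have [s0 s1 s2 s3 s4] := step; split=> // l'; rewrite ltnS leq_eqVlt => /orP[/eqP -> //|].
  exact: iw.
split.
  by move=> l; rewrite sz => hl; have [_ _ _ _] := main n (leqnn n); apply.
by move=> r l r3 ln; have [m0 m1 m2 _ _] := main l ln; case: r r3 => [|[|[|r]]].
Qed.

End Words.

Lemma NW3_KN n e s : size s = n -> walkP (~~ e) s -> (e -> 0 < dd s n) ->
  KN n (fun r => NW3 e s r n) (NW3 e s).
Proof.
move=> sz w he.
have q a l : l < n -> nl a s l.+1 = nl a s l + (nth None s l == a) by move=> h; apply: nlS; rewrite sz.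
have k0 l : e -> l <= n -> kk s l = 0.
  move=> ee; elim: l => [|l IH] ln; first by rewrite nl0.
  rewrite q // IH ?(ltnW ln) // add0n; have := w l; rewrite sz => /(_ ln).
  by case: (nth None s l) => [[]|] //; rewrite ee => -[].
have dl l : l <= n -> dd s l <= uu s l by move=> h; apply: (walk_dd_le w); rewrite sz.
have big a l : n <= l -> nl a s l = nl a s n.
  by move=> h; rewrite /nl !take_oversize ?sz.
split.
- by case=> [|[|[|r]]]; rewrite /NW3 ?nl0 ?andbF.
- move=> r l; have [h|h] := ltnP l n; last first.
    by case: r => [|[|[|r]]]; rewrite /NW3 ?(big _ l h) ?(big _ l.+1 (leqW h)).
  by case: r => [|[|[|r]]]; rewrite /NW3 ?q //; case: (nth None s l) => [[]|] /=;
    case: e {w he k0} => /=; lia.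
- by [].
- move=> l ln; rewrite /NW3 !q //; have := k0 l ^~ (ltnW ln).
  move: (nth None s l) (uu s l) (dd s l) (kk s l) => z u d k.
  by case: z => [[]|] /=; case: e {w he k0} => /= h; lia.
- move=> l ln; rewrite /NW3; have := dl l ln; case: e {w he k0} => /=; lia.
- move=> l ln; rewrite /NW3; have := dl l ln; case: e {w he k0} => /=; lia.
- move=> l ln; rewrite /NW3 !q //; have := w l; rewrite sz => /(_ ln); have := k0 l ^~ (ltnW ln).
  move: (nth None s l) (uu s l) (dd s l) (kk s l) => z u d k.
  by case: z => [[]|] /=; case: e {w he k0} => /= h; lia.
- move=> l ln; rewrite /NW3 !q //; have := w l; rewrite sz => /(_ ln); have := k0 l ^~ (ltnW ln).
  move: (nth None s l) (uu s l) (dd s l) (kk s l) => z u d k.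
  by case: z => [[]|] /=; case: e {w he k0} => /= h; lia.
- move=> l ln; rewrite /NW3 !q //; have := w l; rewrite sz => /(_ ln); have := k0 l ^~ (ltnW ln).
  move: (nth None s l) (uu s l) (dd s l) (kk s l) => z u d k.
  by case: z => [[]|] /=; case: e {w he k0} => /= h; lia.
Qed.

Lemma word_of_NW3 n e s : size s = n -> word_of_N n (NW3 e s) = s.
Proof.
move=> sz; apply: (@eq_from_nth _ None); rewrite size_mkseq // => l hl.
rewrite nth_word // /NW3 !nlS ?sz //; case: (nth None s l) => [[]|] /=.
- by have -> : (uu s l + 1).*2 + (kk s l + 0) == ((uu s l).*2 + kk s l).+2 by lia.
- have -> : ((uu s l + 0).*2 + (kk s l + 0) == ((uu s l).*2 + kk s l).+2) = false by lia.
  by have -> : ((uu s l + 0).*2 + (kk s l + 0) == ((uu s l).*2 + kk s l).+1) = false by lia.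
- have -> : ((uu s l + 0).*2 + (kk s l + 1) == ((uu s l).*2 + kk s l).+2) = false by lia.
  by have -> : (uu s l + 0).*2 + (kk s l + 1) == ((uu s l).*2 + kk s l).+1 by lia.
Qed.

Definition des2 (a c : letter) : bool := nonD a && ~~ nonD c.

Fixpoint dmax (a : letter) (s : seq letter) : nat :=
  if s is c :: s' then (if dmax c s' == 0 then nat_of_bool (des2 a c) else (dmax c s').+1) else 0.

Lemma dmaxE a s k :
  \max_(i < size s | des2 (nth None (a :: s) i) (nth None s i)) (k + i.+1) =
  if dmax a s == 0 then 0 else k + dmax a s.
Proof.
elim: s a k => [|c s IH] a k; first by rewrite big_ord0.
rewrite big_mkcond big_ord_recl [size _]/=.
under eq_bigr => i _ do rewrite /= /bump leq0n add1n -addSnnS.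
rewrite -big_mkcond /= IH; case: (des2 a c); case: (dmax c s) => [|m] /=; lia.
Qed.

Lemma path_dmax a s : path noDes a s = (dmax a s == 0).
Proof.
elim: s a => [|c s IH] a //=; rewrite IH /noDes -/(des2 a c).
by case: (dmax c s) => [|m] /=; case: (des2 a c).
Qed.

Lemma tlen_dmax a s : tlen (a :: s) + dmax a s = (size s).+1.
Proof.
elim: s a => [|c s IH] a //.
rewrite [tlen _]/= -/(tlen (c :: s)) path_dmax /noDes -/(des2 a c) /=.
have pe := path_dmax c s; have := IH c; rewrite /= pe; case: (dmax c s) {pe} => [|m] /=.
  by rewrite addn0 => e; case: (des2 a c); move: e => /=; lia.
by rewrite andbF; lia.
Qed.

Definition dword (s : seq letter) (i : nat) : bool :=
  if i is i'.+1 then des2 (nth None s i') (nth None s i) else nth None s 0 == None.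

Lemma tlen_max s : 0 < size s -> tlen s = size s - \max_(i < size s | dword s i) i.
Proof.
case: s => // a s _; rewrite big_mkcond big_ord_recl /=.
have -> : (if a == None then 0 else 0) = 0 by case: ifP.
rewrite max0n; have := dmaxE a s 0.
under eq_bigr do rewrite add0n; rewrite big_mkcond => e.
under eq_bigr => i _ do rewrite /bump leq0n add1n /=.
rewrite e; have := tlen_dmax a s; case: (dmax a s) => [|m] /=; lia.
Qed.

Lemma xw_prod (R : comNzRingType) (x : nat -> R) o prev (s : seq letter) : (xw nonD x o prev s =
  \prod_(i < size s | (if (i : nat) is i'.+1 then nonD (nth None s i') else prev)
     && ~~ nonD (nth None s i)) x (o + i)%N)%R.
Proof.
elim: s o prev => [|a s IH] o prev; first by rewrite big_ord0.
rewrite [LHS]/= IH [size _]/= [in RHS]big_mkcond big_ord_recl [in LHS]big_mkcond /=.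
rewrite addn0; congr (_ * _)%R; apply: eq_bigr => i _.
rewrite /bump leq0n add1n add0n addnS -addSn; congr (if _ then _ else _).
by case: i => [[|i] hi].
Qed.

Lemma prod_dword (R : comNzRingType) (x : nat -> R) s : 0 < size s ->
  (\prod_(i < size s | dword s i) x i =
   (if nth None s 0 == None then x 0 else 1) * xw nonD x 0 false s)%R.
Proof.
case: s => // a s _; rewrite xw_prod [RHS]mulrC [in LHS]big_mkcond [in RHS]big_mkcond /= !big_ord_recl /=.
by rewrite mul1r mulrC.
Qed.

Lemma bigminn_le (I : finType) (P : pred I) (F : I -> nat) m i :
  P i -> \big[minn/m]_(j | P j) F j <= F i.
Proof.
rewrite -[P i]andTb -(mem_index_enum i); elim: (index_enum I) => // j r IH.
rewrite big_cons inE; case: eqVneq => [<-|ne] /=.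
  by move=> ->; rewrite geq_minl.
move=> /IH h; case: ifP => // _; exact: leq_trans (geq_minr _ _) h.
Qed.

Lemma leq_bigminn (I : finType) (P : pred I) (F : I -> nat) m k :
  k <= m -> (forall i, P i -> k <= F i) -> k <= \big[minn/m]_(j | P j) F j.
Proof.
move=> km h; elim: (index_enum I) => [|j r IH]; rewrite ?big_nil // big_cons.
by case: ifP => // pj; rewrite leq_min h.
Qed.

Section Count.
Variables (n : nat) (la : seq nat) (e : bool) (h : nat).
Local Notation lr := (nth 0 la).
Hypothesis n0 : 0 < n.
Hypothesis lr2 : lr 2 = e.
Hypothesis lr3 : forall r, 3 <= r -> lr r = 0.
Hypothesis lr_le : forall r, lr r <= 2 * n.
Hypothesis lr_out : forall r, 2 * n <= r -> lr r = 0.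
Hypothesis lr_mono : lr 1 <= lr 0 /\ lr 2 <= lr 1.
Hypothesis endP : forall s, size s = n -> walkP (~~ e) s ->
  hend 0 s = h <-> (forall r, r < 3 -> NW3 e s r n = lr r).

Definition wordT (P : Tab n) : seq letter := word_of_N n (Nf n (tn P)).

Lemma size_wordT P : size (wordT P) = n.
Proof. by rewrite size_mkseq. Qed.

Lemma tn_KN (P : Tab n) : isSDT la P -> KN n lr (Nf n (tn P)).
Proof.
move=> /isSDT_SDTf S; apply: (Nf_KN S) => //; [exact: tn_out | exact: tn_le].
Qed.

Lemma wordT_walk (P : Tab n) : isSDT la P -> walkP (~~ e) (wordT P) /\ hend 0 (wordT P) = h.
Proof.
move=> hP; have [w N] := word_KN lr2 (tn_KN hP); split=> //.
apply/(endP (size_wordT P) w) => r r3; rewrite -/(wordT P) in N *.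
by rewrite -N // (kn_end (tn_KN hP)).
Qed.

Lemma wordT_inj : {in isSDT la &, injective wordT}.
Proof.
move=> P P' hP hP' ew; have [_ N] := word_KN lr2 (tn_KN hP).
have [_ N'] := word_KN lr2 (tn_KN hP'); rewrite -!/(wordT _) ew in N N'.
apply: tn_inj => r c _ _.
have /isSDT_SDTf S := hP; have /isSDT_SDTf S' := hP'.
apply: (SDTf_eq S S') => //; try exact: tn_out; try exact: tn_le.
by move=> r' l r3 ln; rewrite N // N'.
Qed.

Lemma wordT_surj s : size s = n -> walkb (~~ e) 0 s -> hend 0 s = h ->
  exists2 P, isSDT la P & wordT P = s.
Proof.
move=> sz /walkbP w /(endP sz w) E.
have d : e -> 0 < nl (Some false) s n.
  by move=> ee; have := E 2 isT; rewrite lr2 /= ee /=; case: (0 < _).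
have K0 := NW3_KN sz w d.
have K : KN n lr (NW3 e s).
  split; try apply K0; move=> r; case: (ltnP r 3) => hr; first exact: E.
  by rewrite lr3 //; case: r hr => [|[|[|]]].
have tE r c : tn (tof n (ff n lr (NW3 e s))) r c = ff n lr (NW3 e s) r c.
  case b : ((r < 2 * n) && (c < 2 * n)).
    by case/andP: b => *; apply: tn_tof => // *; apply: (ff_le K).
  rewrite tn_out ?b //; apply/esym/eqP; rewrite -leqn0 leqNgt (ff_gt0 K).
  by have := lr_le r; have := @lr_out r; move: b; lia.
exists (tof n (ff n lr (NW3 e s))).
  apply/isSDT_SDTf; have S := ff_SDTf K lr3 lr_le lr_out.
  split.
  - by move=> *; rewrite tE; apply: (sdt_shape S).
  - by move=> l hl; rewrite -[RHS](sdt_two S hl); do 2 (apply: eq_bigr => ? _); rewrite tE.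
  - by move=> r c r' c'; rewrite !tE; apply: (sdt_adj S).
  - by move=> *; rewrite !tE; apply: (sdt_row S).
  - by move=> *; rewrite !tE; apply: (sdt_col S).
rewrite -[RHS](word_of_NW3 e sz) /wordT /word_of_N; apply/eq_in_map => l.
rewrite mem_iota /= => hl; have eN l' : l' <= n -> Nf n (tn (tof n (ff n lr (NW3 e s)))) 0 l' = NW3 e s 0 l'.
  move=> hl'; rewrite -(Nf_ff K lr_le 0 hl'); apply: eq_bigr => c _; by rewrite tE.
by rewrite !eN //; lia.
Qed.

Lemma sum_SDT_words (V : nmodType) (G : seq letter -> V) :
  (\sum_(P : Tab n | isSDT la P) G (wordT P) =
   \sum_(s <- words steps n | walkb (~~ e) 0 s && (hend 0 s == h)) G s)%R.
Proof.
rewrite -big_filter -(big_map wordT predT G) -[RHS]big_filter /=.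
apply: perm_big; apply: uniq_perm.
- rewrite map_inj_in_uniq ?filter_uniq ?index_enum_uniq // => P P'.
  by rewrite !mem_filter => /andP[hP _] /andP[hP' _]; apply: wordT_inj.
- by rewrite filter_uniq // words_uniq.
move=> s; apply/mapP/idP => [[P]|].
  rewrite mem_filter => /andP[hP _] ->; have [/walkbP w hh] := wordT_walk hP.
  rewrite mem_filter w hh eqxx mem_words size_wordT eqxx /=.
  by apply/allP => -[[]|] _.
rewrite mem_filter mem_words => /andP[/andP[w /eqP hh] /andP[/eqP sz _]].
by have [P hP <-] := wordT_surj sz w hh; exists P => //; rewrite mem_filter hP mem_index_enum.
Qed.

Section Descents.
Variable P : Tab n.
Hypothesis hP : isSDT la P.
Local Notation N := (Nf n (tn P)).

(** Vertical dominoes in the first two rows have their top in row 0, and the one in the last two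
    rows has it in row 1. Hence [neRow] only tells down letters from the others, and tableau
    descents are a non-down followed by a down. *)
Lemma neRow_wordT l : l < n -> neRow P l.+1 = (nth None (wordT P) l == Some false).
Proof.
move=> ln; have K := tn_KN hP; have /isSDT_SDTf S := hP.
have le r c : tn P r c <= n := tn_le P r c.
have cellE r := @Nf_cell n lr (tn P) S (@tn_out n P) lr_le lr_out lr_mono r l.
have m0 := kn_mono K 0 l; have m1 := kn_mono K 1 l; have m2 := kn_mono K 2 l.
have sm := kn_sum K ln; have up r : N r l < N r l.+1 -> neRow P l.+1 <= r.
  move=> hr; have [h1 h2] := cellE r hr.
  have c2 : N r l < 2 * n by have := lr_le r; lia.
  have r2 : r < 2 * n by rewrite ltnNge; apply/negP => /lr_out er; rewrite er in h1.
  have := @bigminn_le (cell n) (fun c => val (P c) == l.+1) (fun c => val c.1) (2 * n)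
    (Ordinal r2, Ordinal c2); rewrite /= -tnE /= h2; exact.
rewrite nth_word //; case: (N 0 l.+1 =P (N 0 l).+2) => h0.
  by apply/eqP; rewrite -[nat_of_bool _]/0 -leqn0; apply: up; rewrite h0.
case: (N 0 l.+1 =P (N 0 l).+1) => h0'.
  by apply/eqP; rewrite -[nat_of_bool _]/0 -leqn0; apply: up; rewrite h0'.
have e2 : N 2 l.+1 <= e by rewrite -lr2 -(kn_end K 2); apply: (kn_monoP K).
rewrite eqxx; apply/eqP; rewrite eqn_leq; apply/andP; split.
  by apply: (up 1); have := leq_b1 e; lia.
apply: leq_bigminn => [|[i j] /=]; first by lia.
rewrite -tnE => /eqP ht; rewrite lt0n; apply/negP => /eqP i0.
have rc := @row_count n (tn P) 0 l.+1 isT; rewrite /= in rc.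
have e0 : N 0 l.+1 = N 0 l by lia.
have /eqP : \sum_(c < 2 * n) (tn P 0 c == l.+1) = 0.
  by move: rc; rewrite e0 -[RHS]add0n => /addIn.
rewrite sum_nat_eq0 => /forallP/(_ j) /=.
by move: ht; rewrite i0 => ->; rewrite eqxx.
Qed.

Lemma firstVertical_wordT : firstVertical P = (nth None (wordT P) 0 == None).
Proof.
have K := tn_KN hP; have /isSDT_SDTf S := hP.
have le r c : tn P r c <= n := tn_le P r c.
have cellE r := @Nf_cell n lr (tn P) S (@tn_out n P) lr_le lr_out lr_mono r 0.
have fp r c : (0 < tn P r c) = (c < lr r) by exact: (f_pos S (@tn_out n P)).
have th r c : c < lr r -> (tn P r c <= 1) = (c < N r 1).
  exact: (NfP S (@tn_out n P)).
have z r : N r 0 = 0 := kn0 K r.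
have sm := kn_sum K n0; have c10 := kn_10 K n0; have c21 := kn_21 K n0; rewrite !z in sm.
rewrite nth_word // z; apply/existsP/idP.
  case=> -[i j] /existsP[[i' j']] /and5P[/= /eqP i0 /eqP j0 /eqP i1 /eqP j1].
  rewrite -!tnE i0 j0 i1 j1 => /andP[/eqP a /eqP b].
  have a1 := th 0 0; have b1 := th 1 0; rewrite -fp a in a1; rewrite -fp b in b1.
  have := a1 isT; have := b1 isT; rewrite !leqnn => /esym h1 /esym h2.
  have -> : N 0 1 = 1 by lia.
  by [].
case: (N 0 1 =P 2) => // h0; case: (N 0 1 =P 1) => // h1 _.
have h2 : N 1 1 = 1 by lia.
have [|a1 a2] := cellE 0; first by rewrite z h1.
have [|b1 b2] := cellE 1; first by rewrite z h2.
have p0 : 0 < 2 * n by lia. have p1 : 1 < 2 * n by lia.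
exists (Ordinal p0, Ordinal p0); apply/existsP; exists (Ordinal p1, Ordinal p0).
by rewrite /= -!tnE /=; rewrite !z in a2 b2; rewrite a2 b2.
Qed.

Lemma DesBT_wordT i : i < n -> DesBT P i = dword (wordT P) i.
Proof.
case: i => [|i] hi; rewrite /DesBT /DesT /=; first exact: firstVertical_wordT.
rewrite hi orbF !neRow_wordT //; last by lia.
by rewrite /des2 /nonD; case: (nth None _ i) => [[]|]; case: (nth None _ i.+1) => [[]|].
Qed.

Lemma ldes_wordT : n - ldes P = tlen (wordT P).
Proof.
rewrite tlen_max ?size_wordT //; congr (_ - _); apply: eq_bigl => i.
exact: DesBT_wordT.
Qed.

Lemma xDes_wordT (R : comNzRingType) (x : nat -> R) : (\prod_(i < n | DesBT P i) x i =
  (if nth None (wordT P) 0 == None then x 0 else 1) * xw nonD x 0 false (wordT P))%R.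
Proof.
rewrite -prod_dword ?size_wordT //; apply: eq_bigl => i; exact: DesBT_wordT.
Qed.

End Descents.

Local Open Scope ring_scope.

Lemma sum_SDT2 (R : comNzRingType) (x : nat -> R) (q : R) :
  \sum_(P : Tab n | isSDT la P) \sum_(Q : Tab n | isSDT la Q)
      (\prod_(i < n | DesBT Q i) x i) * q ^+ (n - ldes P) =
  (\sum_(s <- words steps n) q ^+ tlen s * run (wtW R (~~ e)) nxW (delta R h) 0%N s) *
  (\sum_(s <- words steps n) ((if nth None s 0 == None then x 0%N else 1) * xw nonD x 0 false s)
      * run (wtW R (~~ e)) nxW (delta R h) 0%N s).
Proof.
have word G : \sum_(s <- words steps n) G s * run (wtW R (~~ e)) nxW (delta R h) 0%N s =
   \sum_(P : Tab n | isSDT la P) G (wordT P).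
  rewrite sum_SDT_words [RHS]big_mkcond; apply: eq_bigr => s _; rewrite run_walk /delta.
  by case: (walkb _ _ _); rewrite ?mulr0 //=; case: eqP; rewrite ?mulr1 ?mulr0.
rewrite !word big_distrl /=; apply: eq_bigr => P hP; rewrite big_distrr /=.
apply: eq_bigr => Q hQ; rewrite ldes_wordT // xDes_wordT // mulrC //.
Qed.

End Count.

Local Open Scope ring_scope.

Lemma no_loop_walkP s l : walkP false s -> (l <= size s)%N -> nl None s l = 0%N.
Proof.
move=> w; elim: l => [|l IH] h; first by rewrite nl0.
rewrite nlS // IH ?(ltnW h) // add0n; have := w l h.
by case: (nth None s l) => [[]|] // [].
Qed.

(** * The two sums over tableaux *)

Section Sides.
Variables (R : comNzRingType) (x : nat -> R) (q : R).
Let y (i : nat) : R := x i - 1.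

Definition tlenEnd (b : bool) (n e : nat) : R := XW q b n (delta R e) 0.
Definition desEnd (b : bool) (n e : nat) : R :=
  \sum_(s <- words steps n) ((if nth None s 0 == None then x 0%N else 1) * xw nonD x 0 false s)
      * run (wtW R b) nxW (delta R e) 0%N s.

Lemma sum_SDT_two_rows n k : (0 < n)%N -> (k <= n)%N ->
  \sum_(P : Tab n | isSDT [:: 2 * n - k; k]%N P)
    \sum_(Q : Tab n | isSDT [:: 2 * n - k; k]%N Q)
      (\prod_(i < n | DesBT Q i) x i) * q ^+ (n - ldes P) =
  tlenEnd true n (n - k) * desEnd true n (n - k).
Proof.
move=> n0 kn; apply: (@sum_SDT2 n [:: 2 * n - k; k]%N false (n - k)) => //.
- by case=> [|[|[|[]]]].
- by case=> [|[|[|r]]] /=; lia.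
- by case=> [|[|[|r]]] /=; lia.
- by rewrite /=; lia.
move=> s sz w; have := hend_nl w; have := nl_sum (leqnn (size s)); rewrite sz => h1 h2.
split=> [h [|[|[|r]]] // _ | /(_ 0%N isT)]; rewrite /NW3 /=; lia.
Qed.

Lemma sum_SDT_three_rows n k : (0 < k <= n %/ 2)%N ->
  \sum_(P : Tab n | isSDT [:: 2 * n - 2 * k; 2 * k - 1; 1]%N P)
    \sum_(Q : Tab n | isSDT [:: 2 * n - 2 * k; 2 * k - 1; 1]%N Q)
      (\prod_(i < n | DesBT Q i) x i) * q ^+ (n - ldes P) =
  tlenEnd false n (n - 2 * k) * desEnd false n (n - 2 * k).
Proof.
move=> hk; apply: (@sum_SDT2 n [:: 2 * n - 2 * k; 2 * k - 1; 1]%N true (n - 2 * k)) => //.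
- lia.
- by case=> [|[|[|[|[]]]]].
- by case=> [|[|[|[|r]]]] /=; lia.
- by case=> [|[|[|[|r]]]] /=; lia.
- by rewrite /=; lia.
move=> s sz w; have := hend_nl w; have := nl_sum (leqnn (size s)).
have := no_loop_walkP w (leqnn _); rewrite sz => h0 h1 h2.
split=> [h [|[|[|r]]] // _ | /(_ 0%N isT)]; rewrite /NW3 /=; lia.
Qed.

Lemma ZW_true0 b F o n : ZW x b F o n true 0 = ZW x b F o n false 0.
Proof.
case: n => [|n]; first by rewrite /ZW !Z0.
by rewrite /ZW Z_true -[Mm _ _ _ _ _ _]/(MmW b _ _) MmWE mul0r mulr0 addr0.
Qed.

(** The factor [x 0] belongs to an initial loop, which returns to height 0. There no down step is
    possible, so having a plus before it makes no difference. *)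
Lemma desEndE b n e : desEnd b n.+1 e =
  tile y n.+1 0 (fun r _ => NW R b r e) + b%:R * y 0 * tile y n 1 (fun r _ => NW R b r e).
Proof.
have sym r : iter r (Top b) (delta R e) 0 = NW R b r e by rewrite iter_delta_sym.
transitivity (ZW x b (delta R e) 0 n.+1 false 0 + b%:R * y 0 * ZW x b (delta R e) 1 n true 0).
  rewrite /ZW /Z /desEnd !big_wordsS /steps !big_cons !big_nil /= mulr_sumr.
  rewrite -!addrA; congr (_ + _); first by apply: eq_bigr => s _; ring.
  congr (_ + _); first by apply: eq_bigr => s _; ring.
  rewrite !addr0 !add0r -big_split; apply: eq_bigr => s _ /=; rewrite andbT /y; ring.
rewrite ZW_true0 !ZW_tile; congr (_ + _ * _); apply: eq_tile => r t _; exact: sym.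
Qed.

Lemma hend_le h s : (hend h s <= h + size s)%N.
Proof.
elim: s h => [|a s IH] h /=; first by rewrite addn0.
by apply: leq_trans (IH _) _; case: a => [[]|] /=; lia.
Qed.

(** Concatenation at the end height: a weighted walk of length [n] to height [e] is followed by [r]
    free steps back to 0. Heights above [n] are not reached. *)
Lemma sum_tlenEnd b n r : \sum_(e < n.+1) tlenEnd b n e * NW R b r e = RW q b n r.
Proof.
rewrite /RW /XW /tlenEnd /XW; under eq_bigr do rewrite mulr_suml.
rewrite exchange_big /=; apply: eq_big_seq => s; rewrite mem_words => /andP[/eqP sz _].
under eq_bigr do rewrite -mulrA; rewrite -mulr_sumr run_walk; congr (_ * _).
under eq_bigr do rewrite run_walk.
case: (walkb _ _ _); last by rewrite big1 // => i _; rewrite mul0r.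
have hn : (hend 0 s < n.+1)%N by rewrite ltnS; have := hend_le 0 s; rewrite add0n sz.
rewrite (bigD1 (Ordinal hn)) //= /delta eqxx mul1r big1 ?addr0 // => i hi.
case: eqP => [ei|_]; last by rewrite mul0r.
by case/eqP: hi; apply: val_inj; rewrite /= ei.
Qed.

Lemma sum_tlenEndB b n : \sum_(e < n.+2) tlenEnd b n.+1 e * desEnd b n.+1 e =
  tile y n.+1 0 (fun r _ => RW q b n.+1 r) + b%:R * y 0 * tile y n 1 (fun r _ => RW q b n.+1 r).
Proof.
have lin o m : tile y m o (fun r _ => RW q b n.+1 r) =
    \sum_(e < n.+2) tlenEnd b n.+1 e * tile y m o (fun r _ => NW R b r e).
  transitivity (tile y m o (fun r _ => \sum_(e < n.+2) tlenEnd b n.+1 e * NW R b r e)).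
    by apply: eq_tile => r t _; rewrite sum_tlenEnd.
  by rewrite tile_sum; apply: eq_bigr => e _; rewrite tileZ.
rewrite !lin mulr_sumr -big_split; apply: eq_bigr => e _ /=; rewrite desEndE; ring.
Qed.

Lemma hend_max h s : hend h s = (h + size s)%N -> s = nseq (size s) (Some true).
Proof.
elim: s h => [|a s IH] h //= e; have := hend_le (nxW h a) s; rewrite [hend _ _]e.
case: a e => [[]|] /= e le; try lia.
by congr cons; apply: (IH h.+1); rewrite [hend _ _]e addnS.
Qed.

Lemma tlenEnd_top n : tlenEnd false n n = q ^+ n.
Proof.
have all h m : walkb false h (nseq m (Some true)) by elim: m h => //=.
have hd h m : hend h (nseq m (Some true)) = (h + m)%N.
  by elim: m h => [|m IH] h /=; rewrite ?addn0 // [hend _ _]IH addnS.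
have inw : nseq n (Some true) \in words steps n.
  by rewrite mem_words size_nseq eqxx; apply/allP => a /nseqP[-> _].
have uw : uniq (words steps n) by apply: words_uniq.
rewrite /tlenEnd /XW (bigD1_seq _ inw uw) /= big1_seq ?addr0.
  rewrite run_walk all hd /delta eqxx mulr1 tlen_sorted ?size_nseq //.
  by case: {all hd inw uw} n => // n; elim: n.
move=> s /andP[ns]; rewrite mem_words run_walk /delta => /andP[/eqP sz _].
case: ifP => _; rewrite ?mulr0 //; case: eqP => [h|]; rewrite ?mulr0 //.
by case/eqP: ns; rewrite (@hend_max 0 s) ?sz.
Qed.

Lemma NW_diag b n : NW R b n n = 1.
Proof. by elim: n => // n IH; rewrite NWS /= IH NW_gt // add0r. Qed.

Lemma desEnd_top n : desEnd false n.+1 n.+1 = 1.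
Proof.
rewrite desEndE !mul0r addr0 -(NW_diag false n.+1).
rewrite -[RHS](tile_mono y n.+1 0 (fun r => NW R false r n.+1)).
apply: eq_tile => r [|t] h; rewrite ?mulr1n // mulr0n NW_gt //; lia.
Qed.

Lemma tlenEnd_odd n e : odd (n + e) -> tlenEnd false n e = 0.
Proof.
move=> o; rewrite /tlenEnd /XW big1_seq // => s; rewrite mem_words run_walk => /andP[_ /andP[/eqP sz _]].
case: ifP => [/walkbP w|]; rewrite ?mulr0 //.
have := hend_nl w; have := nl_sum (leqnn (size s)); have := no_loop_walkP w (leqnn _).
rewrite /delta; case: eqP => [->|]; rewrite ?mulr0 //; rewrite sz; lia.
Qed.

Lemma sum_even (g : nat -> R) n : (forall j, odd j -> g j = 0) ->
  \sum_(j < n.+1) g j = \sum_(k < (n %/ 2).+1) g (2 * k)%N.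
Proof.
move=> h; elim/nat_ind2: n => [|| n IH _].
- by rewrite !big_ord1.
- by rewrite !big_ord_recr !big_ord0 /= [g 1%N]h // addr0.
have -> : (n.+2 %/ 2 = (n %/ 2).+1)%N by lia.
rewrite big_ord_recr big_ord_recr /= IH [RHS]big_ord_recr /= -addrA; congr (_ + _).
have [o|o] := boolP (odd n).
  by rewrite [g n.+2]h ?addr0 /=; [congr g; lia | rewrite negbK].
by rewrite [g n.+1]h ?add0r //; congr g; lia.
Qed.

Lemma sum_two_rows n : \sum_(0 <= k < n.+2) tlenEnd true n.+1 (n.+1 - k) * desEnd true n.+1 (n.+1 - k) =
  tile y n.+1 0 (fun r t => QW q (r + t.*2) r) + y 0 * tile y n 1 (fun r t => QW q (r + t.*2).+1 r).
Proof.
rewrite big_mkord (reindex_inj rev_ord_inj) /=.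
transitivity (\sum_(e < n.+2) tlenEnd true n.+1 e * desEnd true n.+1 e).
  by apply: eq_bigr => i _; rewrite subSS subKn // -ltnS.
rewrite sum_tlenEndB mul1r; congr (_ + _ * _); apply: eq_tile => r t e; by rewrite e.
Qed.

(** By parity the sum over [k], completed by [k = 0], runs over all end heights that contribute. The
    added term comes from the walk with up steps only and is the power of [q] subtracted here, the
    same one as in [classII_total]. *)
Lemma sum_three_rows n :
  \sum_(1 <= k < (n.+1 %/ 2).+1) tlenEnd false n.+1 (n.+1 - 2 * k) * desEnd false n.+1 (n.+1 - 2 * k) =
  tile y n.+1 0 (fun r t => zeta q (r + t) 0) - q ^+ n.+1.
Proof.
set f := fun j => if (j <= n.+1)%N then tlenEnd false n.+1 (n.+1 - j) * desEnd false n.+1 (n.+1 - j) else 0.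
have fo j : odd j -> f j = 0.
  by move=> o; rewrite /f; case: ifP => // h; rewrite tlenEnd_odd ?mul0r //; lia.
apply/eqP; rewrite eq_sym subr_eq eq_sym addrC; apply/eqP.
have f0 : f 0%N = q ^+ n.+1 by rewrite /f /= subn0 tlenEnd_top desEnd_top mulr1.
transitivity (\sum_(k < (n.+1 %/ 2).+1) f (2 * k)%N).
  rewrite -(big_mkord predT (fun k => f (2 * k)%N)) [RHS]big_ltn // muln0 f0; congr (_ + _).
  by apply: eq_big_nat => k hk; rewrite /f ifT //; lia.
rewrite -sum_even // (reindex_inj rev_ord_inj) /=.
transitivity (\sum_(e < n.+2) tlenEnd false n.+1 e * desEnd false n.+1 e).
  by apply: eq_bigr => i _; rewrite /f subSS leq_subr subKn // -ltnS.
rewrite sum_tlenEndB !mul0r addr0; apply: eq_tile => r t e; by rewrite -e RW_zeta.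
Qed.

End Sides.

Theorem mainTheorem11 (n : nat) (hn : (0 < n)%N)
    (R : comNzRingType) (x : nat -> R) (q : R) :
  \sum_(w : SP n | `[< fullyCommutative w >])
      (\prod_(i < n | DesBw w i) x i) * q ^+ bl (invSP w)
  =
  \sum_(0 <= k < n.+1)
     \sum_(P : Tab n | isSDT [:: 2 * n - k; k]%N P)
       \sum_(Q : Tab n | isSDT [:: 2 * n - k; k]%N Q)
          (\prod_(i < n | DesBT Q i) x i) * q ^+ (n - ldes P)
  +
  \sum_(1 <= k < (n %/ 2).+1)
     \sum_(P : Tab n | isSDT [:: 2 * n - 2 * k; 2 * k - 1; 1]%N P)
       \sum_(Q : Tab n | isSDT [:: 2 * n - 2 * k; 2 * k - 1; 1]%N Q)
          (\prod_(i < n | DesBT Q i) x i) * q ^+ (n - ldes P).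
Proof.
rewrite sum_FC_ZP //.
(* The additional prefix length leaves an empty word in a state of difference 1, which has weight
   0. *)
have -> : \sum_(j < n.-1) ZP q x j.+1 (n - j.+1) true (1%N, true) =
    \sum_(j < n) ZP q x (0 + j).+1 (n - j.+1) true (1%N, true).
  by case: n hn => // m _; rewrite [RHS]big_ord_recr /= subnn ZP0 addr0.
rewrite classII_total; congr (_ + _); last first.
  rewrite [RHS](eq_big_nat _ _ (F2 := fun k => tlenEnd q false n (n - 2 * k) * desEnd x false n (n - 2 * k))).
    by case: n hn => // m _; rewrite sum_three_rows.
  by move=> k hk; rewrite sum_SDT_three_rows.
rewrite [RHS](eq_big_nat _ _ (F2 := fun k => tlenEnd q true n (n - k) * desEnd x true n (n - k))).
  by case: n hn => // m _; rewrite classI_total sum_two_rows.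
by move=> k hk; rewrite sum_SDT_two_rows.
Qed.
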